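(* Let $(\lambda^{(n)})_{n\ge1}$ be a sequence of partitions, $\lambda^{(n)}$ being a partition of $n$, converging uniformly to the limit curve $\gamma\in\Gamma_1$. Then $$C(\lambda^{(n)})>\frac{\sqrt2\,n^{3/2}}{8}\int_{-\infty}^{\infty}\int_s^{\infty}\left((t-s)+\frac{(\gamma(t)-\gamma(s))^2}{t-s}\right)(1+\gamma'(s))(1-\gamma'(t))\,dt\,ds+o(n^{3/2})$$ as $n\to\infty$ (that is, there is a real sequence $(r_n)$ with $r_n=o(n^{3/2})$ such that the strict inequality holds with the term $o(n^{3/2})$ replaced by $r_n$), where $C(\lambda)$ denotes the average case complexity of the Novelli--Pak--Stoyanovskii algorithm on $\lambda$.
   Context: A partition $\lambda$ of $n$ is a weakly decreasing sequence $\lambda_1\ge\dots\ge\lambda_k>0$ of positive integers with sum $n$; its length is $l(\lambda)=k$, and $\lambda_i=0$ for $i>k$. It is identified with its Young diagram $\{(i,j):1\le i\le l(\lambda),\ 1\le j\le\lambda_i\}$, whose elements are called cells. A cell $(i,j)$ is a corner of $\lambda$ if neither $(i+1,j)$ nor $(i,j+1)$ belongs to $\lambda$. A tableau of shape $\lambda$ is a bijection $T:\lambda\to\{1,\dots,n\}$; the set of tableaux is $\mathrm{T}(\lambda)$. The (column-wise) Novelli--Pak--Stoyanovskii (NPS) algorithm applied to $T\in \mathrm{T}(\lambda)$: order cells by $(i,j)\preceq(i',j')$ if $j<j'$, or $j=j'$ and $i\le i'$. Let $(i_1,j_1)\succ\dots\succ(i_n,j_n)$ be the cells of $\lambda$ in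 decreasing order, put $k_r=T(i_r,j_r)$ (entries of the initial tableau) and $T_0=T$. For $r=1,\dots,n$ the tableau $T_r$ is obtained from $T_{r-1}$ as follows. Start with the current tableau equal to $T_{r-1}$ and repeat: let $(i,j)$ be the cell of the current tableau containing $k_r$. If $(i,j)$ is a corner of $\lambda$, stop. Otherwise let $m$ be the minimum of the entries of the current tableau in the cells of $\lambda\cap\{(i+1,j),(i,j+1)\}$. If $k_r<m$, stop. If $m<k_r$, exchange the entries $m$ and $k_r$ (one exchange) and repeat. When stopped, $T_r$ is the current tableau. $n(T)$ is the total number of exchanges performed during the construction of $T_1,\dots,T_n$, and $C(\lambda)=\frac1{n!}\sum_{T\in \mathrm{T}(\lambda)}n(T)$. Scaling. For $n\ge1$ use coordinates $u=\frac{\sqrt n}{\sqrt2}(x+y)$, $v=\frac{\sqrt n}{\sqrt2}(y-x)$ on $\mathbb R^2$. For a partition $\lambda$ of $n$ let $D_\lambda$ be the set of $(x,y)\in\mathbb R^2$ such that either $0<v$ and $0<u\le\lambda_{\lceil v\rceil}$, or $u\ge0$, $v\ge0$, $uv=0$. The boundary function of $\lambda$ is $x\mapsto\sup\{y\in\mathbb R:(x,y)\in D_\lambda\}$. $\Gamma$ is the set of all $1$-Lipschitz functions $\gamma:\mathbb R\to\mathbb R$ for which there is a (bounded) interval $(a,b)$ with $\gamma(x)=|x|$ for all $x\notin(a,b)$. $\Gamma_1$ is the set of $\gamma\in\Gamma$ with $\int_{\mathbb R}(\gamma(x)-|x|)\,dx=1$. With $\gamma_n$ the boundary function of $\lambda^{(n)}$,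 the sequence $(\lambda^{(n)})$ converges uniformly to $\gamma\in\Gamma_1$ if $\lim_{n\to\infty}\sup_{x\in\mathbb R}|\gamma(x)-\gamma_n(x)|=0$ and there is an interval $(a,b)$ such that $\gamma_n(x)=|x|$ for all $x\notin(a,b)$ and all $n$. The derivative $\gamma'$ exists almost everywhere since $\gamma$ is Lipschitz. *)

(* Defs.v *)
From mathcomp Require Import all_boot all_order all_algebra perm.
From mathcomp Require Import all_classical all_reals all_analysis.

Set Implicit Arguments.
Unset Strict Implicit.
Unset Printing Implicit Defensive.

Import Order.TTheory GRing.Theory Num.Theory.
Import numFieldNormedType.Exports.

Local Open Scope ring_scope.
Local Open Scope classical_set_scope.

Section Diagram.
Local Open Scope nat_scope.

Definition is_partition_of (n : nat) (la : seq nat) : bool :=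
  [&& sorted geq la, 0 \notin la & sumn la == n].

(* Rows are numbered from 1, and [part la i = 0] for [size la < i]. *)
Definition part (la : seq nat) (i : nat) : nat := nth 0 la i.-1.

Definition diagram (la : seq nat) : seq (nat * nat) :=
  [seq (i, j) | i <- iota 1 (size la), j <- iota 1 (part la i)].

Definition is_corner (la : seq nat) (c : nat * nat) : bool :=
  ((c.1.+1, c.2) \notin diagram la) && ((c.1, c.2.+1) \notin diagram la).

Definition cell_le (c d : nat * nat) : bool :=
  (c.2 < d.2) || (c.2 == d.2) && (c.1 <= d.1).

End Diagram.

Notation cell la := (seq_sub (diagram la)).

(* Fillings of the diagram with entries in {0, ..., n}, where n = sumn la. *)
Notation filling la := {ffun cell la -> 'I_(sumn la).+1}.

Section NPS.
Local Open Scope nat_scope.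
Variable la : seq nat.

(* A tableau is an injective filling with set of entries {1, ..., n}. *)
Definition tableaux : {set filling la} :=
  [set T : filling la | injectiveb T &&
     ([set T c | c in [set: cell la]] == [set k : 'I_(sumn la).+1 | 0 < k])]%SET.

Definition next_cells (c : cell la) : {set cell la} :=
  [set d : cell la | (val d == ((val c).1.+1, (val c).2))
                  || (val d == ((val c).1, (val c).2.+1))]%SET.

Definition exchange (k m : 'I_(sumn la).+1) (T : filling la) : filling la :=
  [ffun c => tperm k m (T c)].

(* One round of the loop moving the entry [k]; a state is the current tableau
   with the number of exchanges so far, and it is left unchanged when the loop
   stops.  On a tableau both [pick]s succeed, for [1 <= k <= n]. *)
Definition nps_step (k : 'I_(sumn la).+1) (st : filling la * nat) :
    filling la * nat :=
  let: (T, e) := st in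
  if [pick c | T c == k] is Some c then
    if is_corner la (val c) then st else
    if [pick d in next_cells c | [forall d' in next_cells c, T d <= T d']]
      is Some d then
      if T d < k then (exchange k (T d) T, e.+1) else st
    else st
  else st.

(* Every exchange moves [k] one cell down or to the right, so that the loop
   has stopped after [#|cell la|] rounds. *)
Definition nps_insert (k : 'I_(sumn la).+1) (st : filling la * nat) :
    filling la * nat :=
  iter #|{: cell la}| (nps_step k) st.

Definition cells_decreasing : seq (cell la) :=
  sort (fun c d : cell la => cell_le (val d) (val c)) (enum {: cell la}).

Definition nps_exchanges (T : filling la) : nat :=
  (foldl (fun st c => nps_insert (T c) st) (T, 0) cells_decreasing).2.

End NPS.

Definition nps_complexity (R : realType) (la : seq nat) : R :=
  ((sumn la)`!)%:R^-1 * (\sum_(T in tableaux la) nps_exchanges T)%:R.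

Definition scaled_diagram (R : realType) (la : seq nat) : set (R * R) :=
  [set p | let n : R := (sumn la)%:R in
           let u := Num.sqrt n / Num.sqrt 2 * (p.1 + p.2) in
           let v := Num.sqrt n / Num.sqrt 2 * (p.2 - p.1) in
           (0 < v /\ 0 < u <= (part la `|Num.ceil v|%N)%:R) \/
           [/\ 0 <= u, 0 <= v & u * v = 0]].

Definition boundary (R : realType) (la : seq nat) (x : R) : R :=
  sup [set y | scaled_diagram la (x, y)].

Definition limit_shape (R : realType) (g : R -> R) : Prop :=
  1.-lipschitz g /\
  exists a b : R, forall x, ~~ (a < x < b) -> g x = `|x|.

Definition limit_shape1 (R : realType) (g : R -> R) : Prop :=
  limit_shape g /\
  (\int[lebesgue_measure]_x (g x - `|x|)%:E = 1)%E.

(* The term of index 0 of the sequence is irrelevant. *)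
Definition converges_uniformly (R : realType) (la : nat -> seq nat)
    (g : R -> R) : Prop :=
  (ereal_sup (range (fun x : R => `|g x - boundary (la n) x|%:E))
     @[n --> \oo] --> 0%E) /\
  exists a b : R, forall n : nat, (0 < n)%N ->
    forall x, ~~ (a < x < b) -> boundary (la n) x = `|x|.

(* Main.v *)
Require Import Defs.
From mathcomp Require Import all_boot all_order all_algebra perm.
From mathcomp Require Import all_classical all_reals all_analysis.
From mathcomp Require Import measurable_realfun zify ring lra.
From HB Require Import structures.

Set Implicit Arguments.
Unset Strict Implicit.
Unset Printing Implicit Defensive.

(** The bijective proof of the hook length formula by Novelli, Pak and
    Stoyanovskii turns a tableau [T] into a standard tableau together with a hook
    function, whose value in a cell ranges over the integers from minus the leg
    length to the arm length.  Inserting an entry changes one column of the hook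
    function, and the sum of the absolute values grows by no more than the number
    of exchanges.  Hence [n(T)] is at least this sum, and averaging over the
    uniform hook functions gives, with arm [a] and leg [l] of a cell,
      [C(lambda) >= sum (a (a + 1) + l (l + 1)) / (2 (a + l + 1))],
    each term being at least [((a + l) + (a - l)^2 / (a + l)) / 4].

    A cell sees the boundary curve at an abscissa [s] through its column and at
    [t > s] through its row; [a + l] and [a - l] are about [sqrt (2 n)] times
    [t - s] and [gamma t - gamma s].  On a grid of fixed mesh the cells between two
    pairs of consecutive abscissae are counted by the increments of
    [s + gamma s] and [t - gamma t], which bounds the complexity below by a
    Riemann sum up to [o(n^(3/2))] and the mesh.

    In turn the integral is bounded above by the same Riemann sum up to the mesh:
    the Stieltjes measure of [x + gamma x] is dominated by the Lebesgue
    measure, and its Radon-Nikodym density is [1 + gamma'] almost everywhere. *)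

(** * Forward and backward paths of an insertion *)

(** Averaging needs the hook function to be uniform, so the map has to be onto all pairs of a
    standard tableau and a hook function. The hard point is to undo one insertion: the output does
    not say which entry was moved. Reverse paths from the candidate cells form a tree rooted at the
    inserted cell, and the path to undo is the one that comes last in this tree. That all candidates
    lie in the tree is therefore part of the invariant, and has to survive both an insertion and its
    undoing.

    On the analytic side [derive1 gamma] is arbitrary where [gamma] is not differentiable, and
    neither measurability of the integrand nor finiteness of the integral is given. An upper bound
    of the integral suffices, so both integrals are compared almost everywhere with step functions
    times a density. For the limit the grid is fixed first and [n] grows afterwards, because the
    counting error is small only relative to a fixed mesh. *)

Section ReversePaths.
Variables (i j : nat).
Implicit Types (t : nat -> nat -> nat) (e : nat -> nat).

(* A path from [(i, j)] to [(x, e x.+1)] occupies the columns [e r] to [e r.+1]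
   of each row [r].  The conditions of [rpath] are those under which the path is
   the way back from its end in the sorted tableau [t], when the last insertion
   is undone; [good t x w] says that [(x, w)] is the end of such a path. *)
Definition rpath t x e : Prop :=
  [/\ i <= x, e i = j,
      forall r, i <= r <= x -> e r <= e r.+1,
      forall r w, i <= r <= x -> e r <= w < e r.+1 -> t r.-1 w.+1 < t r w
    & forall r, i <= r < x ->
        e r.+1 = j \/ t r.+1 (e r.+1).-1 <= t r (e r.+1)].

Definition good t x w : Prop := exists2 e, rpath t x e & e x.+1 = w.

Lemma rpath_mono t x e r s : rpath t x e -> i <= r -> r <= s -> s <= x.+1 ->
  e r <= e s.
Proof.
move=> [_ _ mono _ _] ir rs; elim: s rs => [|s IH] rs sx.
  by have -> : r = 0 by lia.
have [->//|rs'] : r = s.+1 \/ r <= s by lia.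
by apply: leq_trans (IH rs' _) (mono s _); lia.
Qed.

Lemma rpath_sub t x e h : rpath t x e -> i <= h -> h <= x -> rpath t h e.
Proof.
move=> [ix ei mono lft up] ih hx; split => // [r|r w|r] rh; first by apply: mono; lia.
  by apply: lft; lia.
by apply: up; lia.
Qed.

(** The way back from a cell depends on the cell alone. If [e2 r < e1 r], the cell [(r, e1 r)] is
    left upwards by the first path and leftwards by the second, which are contradictory comparisons
    of its two neighbours. *)
Lemma rpath_noncross t x1 x2 e1 e2 r : rpath t x1 e1 -> rpath t x2 e2 ->
  i <= r -> r <= x1 -> r <= x2 -> e1 r.+1 <= e2 r.+1 -> e1 r <= e2 r.
Proof.
move=> p1 p2 ir rx1 rx2 le12; rewrite leqNgt; apply/negP => lt21.
have j2 := rpath_mono p2 (leqnn i) ir ltac:(lia).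
case: p1 => [_ e1i mono1 _ up1]; case: p2 => [_ e2i _ lft2 _].
have ri : i < r by rewrite ltn_neqAle ir andbT; apply/eqP => ri; move: lt21; rewrite -ri e1i e2i ltnn.
have Er : r.-1.+1 = r by lia.
have := up1 r.-1 ltac:(lia); rewrite Er => -[|le1]; first by lia.
have := lft2 r (e1 r).-1 ltac:(lia); have := mono1 r ltac:(lia) => m1.
have -> : (e1 r).-1.+1 = e1 r by lia.
by move=> /(_ ltac:(lia)); lia.
Qed.

Lemma rpath_noncross_le t x1 x2 e1 e2 r s : rpath t x1 e1 -> rpath t x2 e2 ->
  i <= r -> r <= s -> s <= x1.+1 -> s <= x2.+1 -> e1 s <= e2 s -> e1 r <= e2 r.
Proof.
move=> p1 p2 ir; elim: s => [|s IH] rs s1 s2 le12.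
  by move: le12; have -> : r = 0 by lia.
have [->//|rs'] : r = s.+1 \/ r <= s by lia.
apply: IH => //; try lia.
by apply: (rpath_noncross p1 p2) => //; lia.
Qed.

Lemma good_root t : good t i j.
Proof.
exists (fun=> j) => //; split => // [r w _|r _]; first by lia.
by left.
Qed.

Lemma good_left t x w : j <= w -> good t x w -> t x.-1 w.+1 < t x w ->
  good t x w.+1.
Proof.
move=> jw [e pe ew] lt; have [ix ei mono lft up] := pe.
exists (fun r => if r == x.+1 then w.+1 else e r); last by rewrite eqxx.
split => //.
- by have -> : (i == x.+1) = false by lia.
- move=> r rx; case: eqP => [|_]; first by lia.
  by case: eqP => [[->]|_]; [rewrite -ew; have := mono x ltac:(lia); lia| apply: mono].
- move=> r v rx; case: eqP => [|_]; first by lia.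
  case: eqP => [[->]|_]; last by apply: lft.
  have [->//|ne] := eqVneq v w.
  by move=> ?; apply: lft; lia.
- move=> r rx; case: eqP => [|_]; first by lia.
  by apply: up.
Qed.

Lemma good_up t x w : j <= w -> good t x w ->
  w = j \/ t x.+1 w.-1 <= t x w -> good t x.+1 w.
Proof.
move=> jw [e pe ew] le; have [ix ei mono lft up] := pe.
exists (fun r => if r == x.+2 then w else e r); last by rewrite eqxx.
split => //.
- lia.
- by have -> : (i == x.+2) = false by lia.
- move=> r rx; case: eqP => [|_]; first by lia.
  by case: eqP => [[->]|ne]; [rewrite ew| apply: mono; lia].
- move=> r v rx; case: eqP => [|_]; first by lia.
  case: eqP => [[->]|ne]; last by apply: lft; lia.
  by rewrite ew; lia.
- move=> r rx; case: eqP => [|_]; first by lia.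
  have [->|ne] := eqVneq r x; first by rewrite ew.
  by apply: up; lia.
Qed.

Lemma good_col t x : i <= x -> good t x j.
Proof.
elim: x => [|x IH] ix.
  have E : 0 = i by lia.
  by rewrite E; exact: good_root.
have [<-|ix'] : i = x.+1 \/ i <= x by lia.
  exact: good_root.
by apply: good_up => //; [exact: IH|left].
Qed.

(** A way back started on or left of a reverse path cannot cross it, so it meets column [j] before
    it could climb above row [i]. In the proof, [weh] says that an upward step stays on the left of
    [e]. *)
Lemma good_weakly_left t x e : rpath t x e ->
  forall h w, i <= h -> h <= x -> j <= w -> w <= e h.+1 -> good t h w.
Proof.
move=> pe h w; have [m] := ubnP (h + w); elim: m h w => // m IH h w hm ih hx jw we.
have [ix ei mono lft up] := pe.
have [->|wj] := eqVneq w j; first exact: good_col.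
have Ew : w.-1.+1 = w by lia.
have [lt|le] := ltnP (t h.-1 w) (t h w.-1).
  by rewrite -Ew; apply: good_left; [lia|apply: IH; lia|rewrite Ew].
have weh : w <= e h.
  rewrite leqNgt; apply/negP => lt.
  by have := lft h w.-1 ltac:(lia) ltac:(lia); rewrite Ew; lia.
have hi : i < h.
  by rewrite ltn_neqAle ih andbT; apply/eqP => hi; move: weh; rewrite -hi ei; lia.
have Eh : h.-1.+1 = h by lia.
by rewrite -Eh; apply: good_up; rewrite ?Eh; [lia|apply: IH; rewrite ?Eh; lia|right].
Qed.

Lemma rpath_glue t x e1 h e2 : rpath t x e1 -> x < h -> e1 x.+1 = e2 x.+1 ->
  (forall r, x < r <= h -> e2 r <= e2 r.+1) ->
  (forall r w, x < r <= h -> e2 r <= w < e2 r.+1 -> t r.-1 w.+1 < t r w) ->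
  (forall r, x <= r < h -> e2 r.+1 = j \/ t r.+1 (e2 r.+1).-1 <= t r (e2 r.+1)) ->
  rpath t h (fun r => if r <= x then e1 r else e2 r).
Proof.
move=> [ix ei mono lft up] xh e12 mono2 lft2 up2; split.
- lia.
- by rewrite ix.
- move=> r rh; case: ifP => rx; case: ifP => rx'; try lia.
  + by apply: mono; lia.
  + have -> : r = x by lia. 
    by rewrite -e12; apply: mono; lia.
  + by apply: mono2; lia.
- move=> r w rh; case: ifP => rx; case: ifP => rx'; try lia.
  + by apply: lft; lia.
  + have -> : r = x by lia. 
    by rewrite -e12; apply: lft; lia.
  + by apply: lft2; lia.
- move=> r rh; case: ifP => rx; first by apply: up; lia.
  by apply: up2; lia.
Qed.

End ReversePaths.

(** * Sliding an entry forwards and backwards *)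

Section Slides.
Variables (p : nat -> nat) (N : nat).
Hypothesis p_mono : forall x, 0 < x -> p x.+1 <= p x.

Definition inl x y := [&& 0 < x, 0 < y & y <= p x].

(* Tableaux are extended by 0 in row 0 and by [N] beyond the diagram of [p]. *)
Definition tab (t : nat -> nat -> nat) : Prop :=
  [/\ forall y, t 0 y = 0, forall x y, inl x y -> 0 < t x y < N
    & forall x y, 0 < x -> 0 < y -> ~~ inl x y -> t x y = N].

(** The processed cells: [(i, j)] and those after it in the column order. The state before the
    insertion of [(i, j)] is the one at [(i.+1, j)], even when [(i.+1, j)] is not a cell. *)
Definition proc i j x y := (j < y) || ((y == j) && (i <= x)).

Definition ord i j (t : nat -> nat -> nat) : Prop :=
  forall x y, inl x y -> proc i j x y -> t x y < t x y.+1 /\ t x y < t x.+1 y.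

Lemma tab_inl t x y : tab t -> 0 < x -> 0 < y -> t x y < N -> inl x y.
Proof.
move=> [_ _ out] x0 y0; apply: contraTT => nl.
by rewrite (out _ _ x0 y0 nl) ltnn.
Qed.

Lemma tab_le t x y : tab t -> 0 < y -> t x y <= N.
Proof.
move=> [t0 inn out] y0; have [->|x0] := posnP x; first by rewrite t0.
have [/inn|/out->//] := boolP (inl x y); lia.
Qed.

Lemma inl_up x y : inl x.+1 y -> 0 < x -> inl x y.
Proof.
rewrite /inl => /and3P[_ y0 le] x0; rewrite x0 y0 /=.
exact: leq_trans le (p_mono x0).
Qed.

Lemma inl_left x y : inl x y.+1 -> 0 < y -> inl x y.
Proof. rewrite /inl; lia. Qed.

Lemma inl_rows x x' y : inl x' y -> 0 < x -> x <= x' -> inl x y.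
Proof.
elim: x' => [|x' IH] l' x0 le; first by rewrite /inl in l'; lia.
have [->//|le'] : x = x'.+1 \/ x <= x' by lia.
by apply: IH => //; apply: inl_up => //; lia.
Qed.

Lemma inl_le x x' y y' : inl x' y' -> 0 < x -> x <= x' -> 0 < y -> y <= y' ->
  inl x y.
Proof. by move=> l' x0 xx' y0 yy'; have := inl_rows l' x0 xx'; rewrite /inl; lia. Qed.

Lemma ord_le i j t x y x' y' : ord i j t -> inl x' y' -> 0 < x -> 0 < y ->
  proc i j x y -> x <= x' -> y <= y' -> t x y <= t x' y'.
Proof.
move=> o + x0 y0 + xx'; elim: y' => [|y' IH] l' pr yy'; first by lia.
have [E|le] : y = y'.+1 \/ y <= y' by lia.
  rewrite -E in l' *; elim: x' xx' l' {IH} => [|x' IH] xx' l'; first by lia.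
  have [->//|le] : x = x'.+1 \/ x <= x' by lia.
  have lx' : inl x' y by apply: inl_up => //; lia.
  apply: leq_trans (IH le lx') _.
  have [|_ h] := o x' y lx'; last exact: ltnW.
  by move: pr; rewrite /proc; lia.
have ly' : inl x' y' by apply: inl_left => //; lia.
apply: leq_trans (IH ly' pr le) _.
have [|h _] := o x' y' ly'; last exact: ltnW.
by move: pr; rewrite /proc; lia.
Qed.

Variables (i j : nat).

(* [e] is the path of the exchanges of the entry in [(i, j)], which transform the
   tableau [t'] into the [t''] with [slide x e t' t'']. *)
Definition fpath (t : nat -> nat -> nat) x (e : nat -> nat) : Prop :=
  [/\ i <= x, e i = j,
      forall r, i <= r <= x -> e r <= e r.+1,
      forall r w, i <= r <= x -> e r <= w < e r.+1 ->
        t r w.+1 < t r.+1 w /\ t r w.+1 < t i j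
    & forall r, i <= r < x ->
        t r.+1 (e r.+1) < t r (e r.+1).+1 /\ t r.+1 (e r.+1) < t i j].

(** Corners need no separate case, since a tableau has the large value [N] beyond the diagram. *)
Definition fpath_end (t : nat -> nat -> nat) x (e : nat -> nat) : Prop :=
  t i j < t x (e x.+1).+1 /\ t i j < t x.+1 (e x.+1).

Definition onpath x (e : nat -> nat) r w := (i <= r <= x) && (e r <= w <= e r.+1).

Definition slide x e (t' t'' : nat -> nat -> nat) : Prop :=
  [/\ forall r w, i <= r <= x -> e r <= w < e r.+1 -> t'' r w = t' r w.+1,
      forall r, i <= r < x -> t'' r (e r.+1) = t' r.+1 (e r.+1),
      t'' x (e x.+1) = t' i j
    & forall r w, ~~ onpath x e r w -> t'' r w = t' r w].

Lemma fpath_ge t' x e r : fpath t' x e -> i <= r -> r <= x.+1 -> j <= e r.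
Proof.
move=> [ix <- mono _ _]; elim: r => [|r IH] ir rx.
  by have -> : i = 0 by lia.
have [->//|ir'] : i = r.+1 \/ i <= r by lia.
by apply: leq_trans (IH _ _) (mono r _); lia.
Qed.

Hypotheses (i0 : 0 < i) (j0 : 0 < j).

Section Forward.
Variables (t' t'' : nat -> nat -> nat) (x : nat) (e : nat -> nat).
Hypotheses (tt' : tab t') (tt'' : tab t'') (lij : inl i j).
Hypotheses (o' : ord i.+1 j t').
Hypotheses (fp : fpath t' x e) (fe : fpath_end t' x e) (sl : slide x e t' t'').

Lemma fpath_lt r w : onpath x e r w -> (r, w) != (i, j) -> t' r w < t' i j.
Proof.
have [ix ei mono rt dn] := fp; move=> /andP[rx wr] ne.
have [lt|le] := ltnP (e r) w.
  have E : w.-1.+1 = w by lia.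
  by have [] := rt r w.-1 rx ltac:(lia); rewrite E.
have E : w = e r by lia.
have ri : i < r.
  have [ri|//] : r = i \/ i < r by lia.
  by case/negP: ne; rewrite E ri ei.
have := dn r.-1 ltac:(lia); have -> : r.-1.+1 = r by lia.
by rewrite -E => -[].
Qed.

Lemma fpath_inl r w : onpath x e r w -> inl r w.
Proof.
move=> on; have [[-> ->]//|ne] := eqVneq (r, w) (i, j).
have lt := fpath_lt on ne; have [_ inn _] := tt'.
move: on => /andP[rx wr]; have := @fpath_ge _ _ _ r fp.
by move=> ge; apply: (tab_inl tt'); [lia|lia|have := inn _ _ lij; lia].
Qed.

Lemma onpath_proc r w : onpath x e r w -> (r, w) != (i, j) -> proc i.+1 j r w.
Proof.
move=> /andP[rx wr] ne; have ge := @fpath_ge _ _ _ r fp; rewrite /proc.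
have [wj|wj] := ltnP j w; first by [].
have E : w = j by lia.
rewrite E eqxx /=; have [ri|//] : r = i \/ i < r by lia.
by case/negP: ne; rewrite E ri.
Qed.

Lemma slide_incr r w : onpath x e r w -> (r, w) != (i, j) -> t' r w < t'' r w.
Proof.
have [ix ei mono rt dn] := fp; have [s1 s2 s3 s4] := sl.
move=> on ne; have lrw := fpath_inl on; have pr := onpath_proc on ne.
have [oR oD] := o' lrw pr; have lt := fpath_lt on ne.
move: on => /andP[rx wr].
have [lt'|le] := ltnP w (e r.+1); first by rewrite s1 //; lia.
have E : w = e r.+1 by lia.
have [Er|rx'] : r = x \/ r < x by lia.
  by rewrite E Er s3 -Er -E.
by rewrite E s2 -?E //; lia.
Qed.

Lemma slide_le r w : (r, w) != (i, j) -> t' r w <= t'' r w.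
Proof.
move=> ne; have [on|off] := boolP (onpath x e r w).
  exact: ltnW (slide_incr on ne).
by have [_ _ _ ->] := sl.
Qed.

(** Entries other than the one in [(i, j)] only grow, so the comparisons at risk are those of a path
    cell with its right and lower neighbours. Its new entry is the smaller of these two old
    neighbours or, at the end, the moving entry, which stopped below both. *)
Lemma slide_ord : ord i j t''.
Proof.
have [ix ei mono rt dn] := fp; have [s1 s2 s3 s4] := sl.
move=> a b lab pr.
have neR : (a, b.+1) != (i, j).
  by apply: contraTneq pr => -[-> <-]; rewrite /proc; lia.
have neD : (a.+1, b) != (i, j).
  by apply: contraTneq pr => -[<- ->]; rewrite /proc; lia.
have leR := slide_le neR; have leD := slide_le neD.
have [on|off] := boolP (onpath x e a b); last first.
  have pr' : proc i.+1 j a b.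
    move: pr off; rewrite /proc /onpath => /orP[->//|/andP[/eqP bj ia]].
    have [ai|ai] : a = i \/ i < a by lia.
      by rewrite bj ai ei; have := mono i; lia.
    by rewrite bj; lia.
  by rewrite s4 //; have [] := o' lab pr'; lia.
move: (on) => /andP[ax be].
have [lt|ge] := ltnP b (e a.+1).
  rewrite s1 //; last by lia.
  have onR : onpath x e a b.+1 by rewrite /onpath; lia.
  have := slide_incr onR neR; have := rt a b ax ltac:(lia); lia.
have E : b = e a.+1 by lia.
have [Ea|ax'] : a = x \/ a < x by lia.
  have -> : t'' a b = t' i j by rewrite E Ea.
  by have [] := fe; rewrite -Ea -E; lia.
have -> : t'' a b = t' a.+1 b by rewrite E s2 //; lia.
have onD : onpath x e a.+1 b by rewrite /onpath E; have := mono a.+1; lia.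
by have := slide_incr onD neD; have := dn a ltac:(lia); rewrite -E; lia.
Qed.

(** A horizontal exchange brings to [(r, w)] the old entry of [(r, w.+1)], which exceeds the unmoved
    entry above that cell. A vertical one brings up the old entry of [(r.+1, e r.+1)], which exceeds
    the unmoved entry on its left. These are the rules of the way back. *)
Lemma slide_rpath : rpath i j t'' x e.
Proof.
have [ix ei mono rt dn] := fp; have [s1 s2 s3 s4] := sl.
have [t0 inn _] := tt'.
split => // [r w rx we|r rx].
  have ge := @fpath_ge _ _ _ r fp; rewrite (s1 r w) //.
  have off : ~~ onpath x e r.-1 w.+1.
    rewrite /onpath; have [E|?] : r = i \/ i < r by lia.
      by rewrite E; lia.
    have -> : r.-1.+1 = r by lia.
    lia.
  rewrite s4 //.
  have l1 : inl r w.+1 by apply: fpath_inl; rewrite /onpath; lia.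
  have [E|r1] := posnP r.-1; first by rewrite E t0; have := inn _ _ l1; lia.
  have E : r.-1.+1 = r by lia.
  have l0 : inl r.-1 w.+1 by apply: inl_up; rewrite ?E.
  have pr0 : proc i.+1 j r.-1 w.+1 by rewrite /proc; lia.
  by have [_] := o' l0 pr0; rewrite E.
have ge := @fpath_ge _ _ _ r.+1 fp.
have [->|ne] := eqVneq (e r.+1) j; [by left|right].
rewrite s2 //; rewrite s4 ?/onpath; last by lia.
have l1 : inl r.+1 (e r.+1) by apply: fpath_inl; rewrite /onpath; have := mono r.+1; lia.
have E : (e r.+1).-1.+1 = e r.+1 by lia.
have l0 : inl r.+1 (e r.+1).-1 by apply: inl_left; rewrite ?E //; lia.
have pr0 : proc i.+1 j r.+1 (e r.+1).-1 by rewrite /proc; lia.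
by have [+ _] := o' l0 pr0; rewrite E; exact: ltnW.
Qed.

End Forward.

Section Backward.
Variables (t' t'' : nat -> nat -> nat) (x : nat) (e : nat -> nat).
Hypotheses (tt' : tab t') (tt'' : tab t'').
Hypotheses (o'' : ord i j t'') (rp : rpath i j t'' x e) (lx : inl x (e x.+1)).
Hypotheses (sl : slide x e t' t'').
Hypothesis tinj : forall a b c d, inl a b -> inl c d -> t'' a b = t'' c d ->
  (a, b) = (c, d).

Lemma onpath_inl r w : onpath x e r w -> inl r w /\ proc i j r w.
Proof.
have [ix ei mono lft up] := rp.
move=> /andP[rx we]; split.
  apply: (inl_le lx); try lia.
    have := rpath_mono rp (leqnn i) (_ : i <= r); lia.
  have := rpath_mono rp (_ : i <= r.+1) (_ : r.+1 <= x.+1); lia.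
have := rpath_mono rp (leqnn i) (_ : i <= r); rewrite /proc; lia.
Qed.

Lemma onpath_le r w : onpath x e r w -> t'' r w <= t' i j.
Proof.
move=> on; have [l pr] := onpath_inl on; have [_ _ s3 _] := sl; rewrite -s3.
move: on => /andP[rx we].
apply: (ord_le o'' lx) => //; try by move: l; rewrite /inl; lia.
have := rpath_mono rp (_ : i <= r.+1) (_ : r.+1 <= x.+1); lia.
Qed.

Lemma onpath_lt r w : onpath x e r w -> (r, w) != (x, e x.+1) -> t'' r w < t' i j.
Proof.
have [ix ei mono lft up] := rp.
move=> on ne; have [l pr] := onpath_inl on; have [oR oD] := o'' l pr.
move: on => /andP[rx we].
have [lt|ge] := ltnP w (e r.+1).
  by apply: leq_trans oR (onpath_le _); rewrite /onpath; lia.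
have [rx'|rx'] := ltnP r x.
  apply: leq_trans oD (onpath_le _); rewrite /onpath.
  have E : w = e r.+1 by lia.
  by rewrite E; have := mono r.+1; lia.
have E : r = x by lia.
by case/negP: ne; rewrite -E; apply/eqP; congr (_, _); lia.
Qed.

Lemma unslide_fpath : fpath t' x e.
Proof.
have [ix ei mono lft up] := rp; have [s1 s2 s3 s4] := sl.
split => // [r w rx we|r rx].
  have on : onpath x e r w by rewrite /onpath; lia.
  rewrite -s1 //; split; last first.
    by apply: onpath_lt => //; apply/eqP => -[? ?]; subst r w; lia.
  rewrite -(s4 r.+1 w); last by rewrite /onpath; lia.
  by have [l pr] := onpath_inl on; have [] := o'' l pr.
have on : onpath x e r (e r.+1) by rewrite /onpath; have := mono r; lia.
rewrite -s2 //; split; last by apply: onpath_lt => //; apply/eqP => -[? _]; lia.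
rewrite -(s4 r (e r.+1).+1); last by rewrite /onpath; lia.
by have [l pr] := onpath_inl on; have [] := o'' l pr.
Qed.

Lemma unslide_fpath_end : fpath_end t' x e.
Proof.
have [ix ei mono lft up] := rp; have [s1 s2 s3 s4] := sl.
have on : onpath x e x (e x.+1) by rewrite /onpath; have := mono x; lia.
have [l pr] := onpath_inl on; have [oR oD] := o'' l pr.
rewrite /fpath_end -s3 -(s4 x) ?/onpath; last by lia.
by rewrite -(s4 x.+1) ?/onpath; last by lia.
Qed.

Lemma unslide_lt r w : onpath x e r w -> (r, w) != (i, j) -> t' r w < t'' r w.
Proof.
have [ix ei mono lft up] := rp; have [s1 s2 s3 s4] := sl.
move=> on ne; have [l pr] := onpath_inl on.
move: (on) => /andP[rx we].
have [lt|ge] := ltnP (e r) w.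
  have E : w.-1.+1 = w by lia.
  have := s1 r w.-1 rx ltac:(lia); rewrite E => <-.
  have [|l' pr'] := @onpath_inl r w.-1; first by rewrite /onpath; lia.
  by have [] := o'' l' pr'; rewrite E.
have Ew : w = e r by lia.
have ri : i < r.
  have [ri|//] : r = i \/ i < r by lia.
  by case/negP: ne; rewrite Ew ri ei.
have E : r.-1.+1 = r by lia.
have := s2 r.-1 ltac:(lia); rewrite E -Ew => <-.
have [|l' pr'] := @onpath_inl r.-1 w; first by rewrite /onpath E; have := mono r.-1; rewrite E; lia.
by have [_] := o'' l' pr'; rewrite E.
Qed.

Lemma unslide_le r w : (r, w) != (i, j) -> t' r w <= t'' r w.
Proof.
move=> ne; have [on|off] := boolP (onpath x e r w).
  exact: ltnW (unslide_lt on ne).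
by have [_ _ _ ->] := sl.
Qed.

(** Sliding back lowers the entries, except in [(i, j)], so only comparisons with a neighbour on the
    path are at risk. That neighbour receives the larger of the entries above it and on its left in
    [t''], by the choice made on the way back. *)
Lemma unslide_ord : ord i.+1 j t'.
Proof.
have [ix ei mono lft up] := rp; have [s1 s2 s3 s4] := sl.
move=> a b lab pr.
have pr0 : proc i j a b by move: pr; rewrite /proc; lia.
have [oR oD] := o'' lab pr0.
have ne : (a, b) != (i, j).
  by apply: contraTneq pr => -[-> ->]; rewrite /proc; lia.
have le := unslide_le ne.
split.
- have [on|off] := boolP (onpath x e a b.+1); last by rewrite -(s4 a b.+1) //; lia.
  move: (on) => /andP[ax be]; have [lt|ge] := ltnP (e a) b.+1.
    rewrite -(s1 a b) //; last by lia.
    by apply: unslide_lt => //; rewrite /onpath; lia.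
  have E : e a = b.+1 by lia.
  have off : ~~ onpath x e a b by rewrite /onpath; lia.
  have [_ +] := onpath_inl on; rewrite /proc => prb.
  have [ai|ai] : a = i \/ i < a by lia.
    by move: pr; rewrite /proc; rewrite ai ei in E; lia.
  have Ea : a.-1.+1 = a by lia.
  have := s2 a.-1 ltac:(lia); rewrite Ea E => <-.
  have [] := up a.-1 ltac:(lia); rewrite Ea E /=; first by move: pr; rewrite /proc; lia.
  (* The rule for upward steps is a weak inequality; distinctness of the entries makes it strict. *)
  rewrite leq_eqVlt -(s4 a b) // => /orP[/eqP|//].
  have l2 : inl a.-1 b.+1.
    have [|//] := @onpath_inl a.-1 b.+1.
    by rewrite /onpath Ea E; have := mono a.-1; rewrite Ea E; lia.
  by move/(tinj lab l2) => [? _]; lia.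
- have [on|off] := boolP (onpath x e a.+1 b); last by rewrite -(s4 a.+1 b) //; lia.
  move: (on) => /andP[ax be]; have [lt|ge] := ltnP (e a.+1) b.
    have Eb : b.-1.+1 = b by lia.
    have := s1 a.+1 b.-1 ax ltac:(lia); rewrite Eb => <-.
    by have := lft a.+1 b.-1 ax ltac:(lia); rewrite Eb /=; lia.
  have E : e a.+1 = b by lia.
  have [_ +] := onpath_inl on; rewrite /proc => prb.
  have [ai|ai] : a.+1 = i \/ i <= a by lia.
    by move: pr; rewrite /proc; rewrite ai ei in E; lia.
  rewrite -E -(s2 a) ?E; last by lia.
  by apply: unslide_lt => //; rewrite /onpath; have := mono a; lia.
Qed.

End Backward.
End Slides.

(** * The tree of reverse paths before and after an insertion *)

Section Transfer.
Variables (i j : nat).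
Hypotheses (i0 : 0 < i) (j0 : 0 < j).
Variables (t' t'' : nat -> nat -> nat) (x : nat) (e : nat -> nat).
Hypotheses (rp : rpath i j t'' x e) (fp : fpath i j t' x e).
Hypotheses (sl : slide i j x e t' t'').
Hypothesis t_le : forall r w, (r, w) != (i, j) -> t' r w <= t'' r w.

(** In [t'] the forward path is a barrier. At a horizontal exchange the entry on the right is
    smaller than the one below, so a way back in the next row has to step left there, and it can
    climb only at or left of the column in which the forward path entered the row above. *)
Lemma good_before h w : i < h -> h <= x.+1 -> j <= w -> w <= e h ->
  good i.+1 j t' h w.
Proof.
have [ix ei mono rt dn] := fp.
have [m] := ubnP (h + w); elim: m h w => // m IH h w hm ih hx jw we.
have [->|wj] := eqVneq w j; first exact: good_col.
have Ew : w.-1.+1 = w by lia.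
have Eh : h.-1.+1 = h by lia.
have [lt|le] := ltnP (t' h.-1 w) (t' h w.-1).
  by rewrite -Ew; apply: good_left; [lia|apply: IH => //; lia|rewrite Ew].
have weh : w <= e h.-1.
  rewrite leqNgt; apply/negP => lt.
  by have := rt h.-1 w.-1 ltac:(lia) ltac:(rewrite Eh; lia); rewrite Ew Eh; lia.
have hi : i < h.-1.
  have [hi|] : h.-1 = i \/ i < h.-1 by lia.
    by move: weh; rewrite hi ei; lia.
  by [].
by rewrite -Eh; apply: good_up; rewrite ?Eh; [lia|apply: IH => //; lia|right].
Qed.

(** A downward exchange at column [e r.+1] forbids a leftward step into that column in row [r.+1],
    so a reverse path of [t'] can never get from the right of the forward path to its left. *)
Lemma good_before_le h w : i < h -> h <= x -> good i.+1 j t' h w -> w <= e h.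
Proof.
have [ix ei mono rt dn] := fp => ih hx [e0 [_ e0i mono0 lft0 _] <-].
have key r : i < r -> r <= h -> e0 r.+1 <= e r.
  elim: r => // r IH ir rh.
  have le0 : e0 r.+1 <= e r.+1.
    have [ri|ri] : r = i \/ i < r by lia.
      by rewrite ri e0i -ei; apply: mono; lia.
    by apply: leq_trans (IH _ _) (mono _ _); lia.
  rewrite leqNgt; apply/negP => lt.
  by have /= := lft0 r.+1 (e r.+1) ltac:(lia) ltac:(lia); have := dn r ltac:(lia); lia.
exact: key.
Qed.

(** Nothing moves below row [x]. In row [x.+1] the leftward steps at or right of [e x.+1] persist,
    so the new way back climbs to row [x] at or left of the end of the forward path, where all cells
    are good by [good_weakly_left]. *)
Lemma good_after h w : x < h -> good i.+1 j t' h w ->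
  exists e2, [/\ rpath i j t'' h e2, e2 h.+1 = w & e2 x.+1 <= e x.+1].
Proof.
have [ix ei mono rt dn] := fp; have [_ _ _ s4] := sl.
move=> xh [e0 p0 <-] {w}; have [_ e0i mono0 lft0 up0] := p0.
have j_e := rpath_mono rp (leqnn i) (_ : i <= x.+1) (leqnn _).
have v_le : e0 x.+1 <= e x.+1.
  have [xi|xi] : x = i \/ i < x by lia.
    by rewrite xi e0i -ei; apply: mono; lia.
  apply: leq_trans (mono x ltac:(lia)); apply: good_before_le => //.
  by exists e0 => //; apply: (rpath_sub p0); lia.
have lftx w : e x.+1 <= w -> w < e0 x.+2 -> t'' x w.+1 < t'' x.+1 w.
  move=> le lt; rewrite !s4 ?/onpath; try lia.
  by apply: (lft0 x.+1 w); lia.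
have gx w : j <= w -> w <= e0 x.+2 -> good i j t'' x.+1 w.
  elim: w => [|w IH] jw we; first by lia.
  have [->|jw'] : w.+1 = j \/ j <= w by lia.
    by apply: good_col; lia.
  have gw : good i j t'' x.+1 w by apply: IH => //; lia.
  have [lt|le] := ltnP (t'' x w.+1) (t'' x.+1 w); first exact: good_left.
  apply: good_up => //; last by right.
  apply: (good_weakly_left rp) => //.
  rewrite ltnNge; apply/negP => le'.
  by have := lftx w le' ltac:(lia); lia.
have jw0 : j <= e0 x.+2.
  by rewrite -e0i; apply: (rpath_mono p0); lia.
have [e2 p2 E2] := gx _ jw0 (leqnn _).
have le2 : e2 x.+1 <= e x.+1.
  rewrite leqNgt; apply/negP => lt.
  have E : (e2 x.+1).-1.+1 = e2 x.+1 by lia.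
  have [_ _ mono2 _ up2] := p2; have := mono2 x.+1 ltac:(lia) => m2.
  have := lftx (e2 x.+1).-1 ltac:(lia) ltac:(lia); rewrite E.
  by have [] := up2 x ltac:(lia); lia.
have [E|xh'] : h = x.+1 \/ x.+1 < h by lia.
  by exists e2; rewrite E; split.
exists (fun r => if r <= x.+1 then e2 r else e0 r); split.
- apply: rpath_glue => // [r rh|r w rh we|r rh].
  + by apply: mono0; lia.
  + by rewrite !s4 ?/onpath; try lia; apply: lft0; lia.
  + by rewrite !s4 ?/onpath; try lia; apply: up0; lia.
- by rewrite ifF //; lia.
- by rewrite leqnn.
Qed.

(** In row [x.+1] the cells up to column [e2 x.+1] are good for [t'] by [good_before]. Further right
    the leftward steps of [e2] remain valid, since row [x] has entries in [t'] that are at most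
    those in [t'']. *)
Lemma good_before_below h e2 : x < h -> rpath i j t'' h e2 ->
  e2 x.+1 <= e x.+1 -> good i.+1 j t' h (e2 h.+1).
Proof.
have [ix ei mono rt dn] := fp; have [_ _ _ s4] := sl.
move=> xh p2 le; have [_ e2i mono2 lft2 up2] := p2.
have jv : j <= e2 x.+1 by rewrite -{1}e2i; apply: (rpath_mono p2); lia.
have gx w : e2 x.+1 <= w -> w <= e2 x.+2 -> good i.+1 j t' x.+1 w.
  elim: w => [|w IH] jw we; first by lia.
  have [E|jw'] : w.+1 = e2 x.+1 \/ e2 x.+1 <= w by lia.
    by apply: good_before; lia.
  apply: good_left; [lia|by apply: IH; lia|].
  have := lft2 x.+1 w ltac:(lia) ltac:(lia); rewrite (s4 x.+1) ?/onpath; last by lia.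
  by apply: leq_ltn_trans; apply: t_le; apply/eqP => -[_ ?]; lia.
have [e1 p1 E1] := gx _ (mono2 x.+1 ltac:(lia)) (leqnn _).
have [E|xh'] : h = x.+1 \/ x.+1 < h by lia.
  by rewrite E; exists e1.
exists (fun r => if r <= x.+1 then e1 r else e2 r); last by rewrite ifF //; lia.
apply: rpath_glue => // [r rh|r w rh we|r rh].
- by apply: mono2; lia.
- by rewrite -!s4 ?/onpath; try lia; apply: lft2; lia.
- by rewrite -!s4 ?/onpath; try lia; apply: up2; lia.
Qed.

End Transfer.

(** * Choice of the path to undo *)

Section LastPath.
Variables (i j : nat) (t : nat -> nat -> nat).
Variables (cand : pred nat) (cw : nat -> nat) (c : nat).

(* The endpoint of [e] comes last, in the in-order traversal of the tree of
   reverse paths, among the candidate cells. *)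
Definition last_path x e : Prop :=
  [/\ rpath i j t x e, e x.+1 = cw x,
      forall h, i <= h < x -> cand h -> cw h < e h.+1
    & forall h e2, x < h <= c -> cand h -> rpath i j t h e2 -> e2 h.+1 = cw h ->
        e2 x.+1 <= e x.+1].

(** For [x1 < x2] the two paths make opposite claims: [e2 x1.+1] would be at most [cw x1] by the
    first and greater by the second. *)
Lemma last_path_uniq x1 x2 e1 e2 : x1 <= c -> x2 <= c -> cand x1 -> cand x2 ->
  last_path x1 e1 -> last_path x2 e2 -> x1 = x2.
Proof.
wlog le12 : x1 x2 e1 e2 / x1 <= x2.
  move=> W; have [le|/ltnW le] := leqP x1 x2; first exact: W.
  by move=> c1 c2 d1 d2 l1 l2; symmetry; apply: (W x2 x1 e2 e1).
move=> c1 c2 d1 d2 [p1 E1 _ b1] [p2 E2 a2 _].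
have [//|lt] : x1 = x2 \/ x1 < x2 by lia.
have [ix1 _ _ _ _] := p1.
have := b1 x2 e2 ltac:(lia) d2 p2 E2.
by have := a2 x1 ltac:(lia) d1; lia.
Qed.

Hypothesis cand_good : forall h, i <= h <= c -> cand h -> good i j t h (cw h).

(** The rows are scanned upwards from [c]. The current path is replaced when the candidate of the
    new row is at or right of the last column of the path in that row; non-crossing carries the
    comparisons with lower candidates over to the new path. *)
Lemma last_path_exists : i <= c -> cand c -> exists x e,
  [/\ i <= x <= c, cand x & last_path x e].
Proof.
move=> ic cc.
suff S m : m <= c - i -> exists x e,
    [/\ c - m <= x <= c, cand x, rpath i j t x e, e x.+1 = cw x &
      (forall h, c - m <= h < x -> cand h -> cw h < e h.+1) /\
      forall h e2, x < h <= c -> cand h -> rpath i j t h e2 -> e2 h.+1 = cw h ->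
        e2 x.+1 <= e x.+1].
  have [x [e [xc dx p E]]] := S _ (leqnn _).
  rewrite subKn // in xc * => -[a b].
  by exists x, e.
elim: m => [|m IH] mc.
  have [e p E] := @cand_good c ltac:(lia) cc.
  by exists c, e; split => //; first lia; split => h; lia.
have [x [e [xc dx p E [a b]]]] := IH ltac:(lia).
set h := c - m.+1; have Eh : c - m = h.+1 by rewrite /h; lia.
rewrite {IH}Eh in xc a.
have keep : (cand h -> cw h < e h.+1) -> exists x e,
    [/\ h <= x <= c, cand x, rpath i j t x e, e x.+1 = cw x &
      (forall h', h <= h' < x -> cand h' -> cw h' < e h'.+1) /\
      forall h e2, x < h <= c -> cand h -> rpath i j t h e2 -> e2 h.+1 = cw h ->
        e2 x.+1 <= e x.+1].
  move=> lt; exists x, e; split => //; first lia; split => // h' hx.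
  have [->//|ne] := eqVneq h' h; apply: a; lia.
have [dh|ndh] := boolP (cand h); last by apply: keep => dh; rewrite dh in ndh.
have [lt|le] := ltnP (cw h) (e h.+1); first exact: keep.
have ih : i <= h <= c by rewrite /h; lia.
have [e' p' E'] := @cand_good h ltac:(lia) dh.
exists h, e'; split => //; first by rewrite /h; lia.
split=> [h'|h' e2 hh' dh' p2 E2]; first by lia.
rewrite E'; apply: leq_trans le.
have [hx|hx] := ltnP h' x.
  apply: (rpath_noncross_le p2 p (s := h'.+1)); try lia.
  by rewrite E2; apply/ltnW/a => //; lia.
have [E2x|hx'] : h' = x \/ x < h' by lia.
  by apply: (rpath_noncross_le p2 p (s := h'.+1)); try lia; rewrite E2x E -E2x E2.
by apply: (rpath_noncross_le p2 p (s := x.+1)); try lia; apply: (b h') => //; lia.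
Qed.

End LastPath.

(** * Prepending one exchange to a path *)

Section Prepend.
Variables (i j : nat) (t t1 t'' : nat -> nat -> nat) (x : nat) (e : nat -> nat).
(** After an exchange to the right the remaining path starts in row [i] at column [j.+1], and this
    start is moved back to [j]. After a downward exchange it starts in row [i.+1], and row [i]
    receives the single column [j]. *)
Let e' r := if r == i then j else e r.

Lemma e'_i : e' i = j. Proof. by rewrite /e' eqxx. Qed.
Lemma e'_gt r : i < r -> e' r = e r.
Proof. by rewrite /e'; case: eqP => // ->; rewrite ltnn. Qed.

Section Right.
Hypotheses (t1ij : t1 i j = t i j.+1) (t1ijS : t1 i j.+1 = t i j).
Hypothesis t1E : forall r w, (r, w) != (i, j) -> (r, w) != (i, j.+1) ->
  t1 r w = t r w.
Hypotheses (lt1 : t i j.+1 < t i j) (lt2 : t i j.+1 < t i.+1 j).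
Hypotheses (fp : fpath i j.+1 t1 x e) (fe : fpath_end i j.+1 t1 x e)
  (sl : slide i j.+1 x e t1 t'').

Let t1o r w : i < r \/ j.+1 < w -> t1 r w = t r w.
Proof. by move=> h; rewrite t1E //; apply/eqP => -[? ?]; lia. Qed.

Let je r : i <= r -> r <= x.+1 -> j.+1 <= e r.
Proof. exact: fpath_ge fp. Qed.

Lemma fpath_cons_right : fpath i j t x e'.
Proof.
have [ix ei mono rt dn] := fp.
split => //; first exact: e'_i.
- move=> r rx; rewrite (@e'_gt r.+1); last by lia.
  have [E|ri] : r = i \/ i < r by lia.
    by rewrite E e'_i; have jr := @je i.+1 ltac:(lia) ltac:(lia); lia.
  by rewrite e'_gt //; apply: mono.
- move=> r w rx; rewrite (@e'_gt r.+1); last by lia.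
  have [E|ri] : r = i \/ i < r by lia.
    rewrite E e'_i => we; have [->//|wj] : w = j \/ j < w by lia.
    by have := rt i w ltac:(lia) ltac:(lia); rewrite t1ijS !t1o; lia.
  rewrite e'_gt // => we; have := rt r w rx we; rewrite t1ijS !t1o //; lia.
- move=> r rx; rewrite (@e'_gt r.+1); last by lia.
  have := dn r rx; have jr := @je r.+1 ltac:(lia) ltac:(lia); rewrite t1ijS !t1o //; lia.
Qed.

Lemma fpath_end_cons_right : fpath_end i j t x e'.
Proof.
have [ix ei mono rt dn] := fp; move: fe; rewrite /fpath_end.
rewrite e'_gt; last by lia.
by have jr := @je x.+1 ltac:(lia) ltac:(lia); rewrite t1ijS !t1o //; lia.
Qed.

Lemma slide_cons_right : slide i j x e' t t''.
Proof.
have [ix ei mono rt dn] := fp; have [s1 s2 s3 s4] := sl.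
split.
- move=> r w rx; rewrite (@e'_gt r.+1); last by lia.
  have [E|ri] : r = i \/ i < r by lia.
    rewrite E e'_i => we; have [->|wj] : w = j \/ j < w by lia.
      by rewrite s4 // /onpath ei; lia.
    by rewrite s1 ?t1o //; lia.
  by rewrite e'_gt // => we; rewrite s1 ?t1o //; lia.
- move=> r rx; rewrite (@e'_gt r.+1); last by lia.
  by rewrite s2 // t1o //; lia.
- by rewrite e'_gt ?s3 //; lia.
- move=> r w; rewrite /onpath => off.
  have [rx|rx] := boolP (i <= r <= x); last first.
    rewrite s4 ?/onpath; last by lia.
    by rewrite t1E //; apply/eqP => -[? ?]; lia.
  move: off; rewrite rx /= (@e'_gt r.+1); last by lia.
  have [E|ri] : r = i \/ i < r by lia.
    rewrite E e'_i => off; rewrite s4 ?/onpath; last by lia.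
    have jei := @je i.+1 ltac:(lia) ltac:(lia).
    by rewrite t1E //; apply/eqP => -[?]; lia.
  rewrite e'_gt // => off; rewrite s4 ?/onpath ?t1o //; lia.
Qed.
End Right.

Section Down.
Hypotheses (t1ij : t1 i j = t i.+1 j) (t1Sij : t1 i.+1 j = t i j).
Hypothesis t1E : forall r w, (r, w) != (i, j) -> (r, w) != (i.+1, j) ->
  t1 r w = t r w.
Hypotheses (lt1 : t i.+1 j < t i j) (lt2 : t i.+1 j < t i j.+1).
Hypotheses (fp : fpath i.+1 j t1 x e) (fe : fpath_end i.+1 j t1 x e)
  (sl : slide i.+1 j x e t1 t'').

Let t1o r w : i.+1 < r \/ j < w -> t1 r w = t r w.
Proof. by move=> h; rewrite t1E //; apply/eqP => -[? ?]; lia. Qed.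

Let je r : i.+1 <= r -> r <= x.+1 -> j <= e r.
Proof. exact: fpath_ge fp. Qed.

Lemma fpath_cons_down : fpath i j t x e'.
Proof.
have [ix ei mono rt dn] := fp.
split => //; [by lia|exact: e'_i| | |].
- move=> r rx; rewrite (@e'_gt r.+1); last by lia.
  have [E|ri] : r = i \/ i < r by lia.
    by rewrite E e'_i ei.
  by rewrite e'_gt //; apply: mono; lia.
- move=> r w rx; rewrite (@e'_gt r.+1); last by lia.
  have [E|ri] : r = i \/ i < r by lia.
    by rewrite E e'_i ei; lia.
  rewrite e'_gt // => we; have := rt r w ltac:(lia) we; have jr := @je r ltac:(lia) ltac:(lia).
  by rewrite t1Sij !t1o //; lia.
- move=> r rx; rewrite (@e'_gt r.+1); last by lia.
  have [E|ri] : r = i \/ i < r by lia.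
    by rewrite E ei; split.
  have := dn r ltac:(lia); have jr := @je r.+1 ltac:(lia) ltac:(lia); rewrite t1Sij !t1o //; lia.
Qed.

Lemma fpath_end_cons_down : fpath_end i j t x e'.
Proof.
have [ix ei mono rt dn] := fp; move: fe; rewrite /fpath_end.
rewrite e'_gt; last by lia.
by have jr := @je x.+1 ltac:(lia) ltac:(lia); rewrite t1Sij !t1o //; lia.
Qed.

Lemma slide_cons_down : slide i j x e' t t''.
Proof.
have [ix ei mono rt dn] := fp; have [s1 s2 s3 s4] := sl.
split.
- move=> r w rx; rewrite (@e'_gt r.+1); last by lia.
  have [E|ri] : r = i \/ i < r by lia.
    by rewrite E e'_i ei; lia.
  by rewrite e'_gt // => we; have jr := @je r ltac:(lia) ltac:(lia); rewrite s1 ?t1o //; lia.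
- move=> r rx; rewrite (@e'_gt r.+1); last by lia.
  have [E|ri] : r = i \/ i < r by lia.
    by rewrite E ei s4 // /onpath; lia.
  by rewrite s2 ?t1o //; lia.
- by rewrite e'_gt ?s3 //; lia.
- move=> r w; rewrite /onpath => off.
  have [rx|rx] := boolP (i <= r <= x); last first.
    rewrite s4 ?/onpath; last by lia.
    by rewrite t1E //; apply/eqP => -[? ?]; lia.
  move: off; rewrite rx /= (@e'_gt r.+1); last by lia.
  have [E|ri] : r = i \/ i < r by lia.
    rewrite E e'_i ei => off; rewrite s4 ?/onpath; last by lia.
    by rewrite t1E //; apply/eqP => -[?]; lia.
  rewrite e'_gt // => off; rewrite s4 ?/onpath //; last by lia.
  rewrite t1E //; apply/eqP => -[? ?]; first by lia.
  by subst r w; have := mono i.+1 ltac:(lia); rewrite ei in off *; lia.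
Qed.
End Down.

Lemma prepend_end : i <= x -> e' x.+1 = e x.+1.
Proof. by move=> ix; rewrite e'_gt. Qed.
End Prepend.

(** * The inverse slide as an injection of cells *)

Section Unslide.
Variables (i j x : nat) (e : nat -> nat).
Hypotheses (ix : i <= x) (ei : e i = j).
Hypothesis mono : forall r, i <= r <= x -> e r <= e r.+1.

(** Where the entry that [(r, w)] held before the slide stands after it: one step back along the
    path, or at its end for the moving entry. As this is a map of cells, its injectivity shows that
    undoing a slide yields a tableau. *)
Definition unslide_cell r w : nat * nat :=
  if onpath i x e r w then
    if e r < w then (r, w.-1) else if i < r then (r.-1, w) else (x, e x.+1)
  else (r, w).

Definition unslide (t : nat -> nat -> nat) r w : nat :=
  t (unslide_cell r w).1 (unslide_cell r w).2.

Lemma unslide_slide t : slide i j x e (unslide t) t.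
Proof.
split.
- move=> r w rx we; rewrite /unslide /unslide_cell /onpath ifT; last by lia.
  by rewrite ifT //; lia.
- move=> r rx; rewrite /unslide /unslide_cell /onpath ifT; last by have := mono (r := r.+1); lia.
  by rewrite ltnn ifT //; lia.
- rewrite /unslide /unslide_cell /onpath ifT; last by have := mono (r := i); lia.
  by rewrite ei !ltnn.
- by move=> r w off; rewrite /unslide /unslide_cell (negPf off).
Qed.

Lemma unslide_cell_onpath r w : onpath i x e r w ->
  onpath i x e (unslide_cell r w).1 (unslide_cell r w).2.
Proof.
move=> on; rewrite /unslide_cell on; move: on; rewrite /onpath.
move=> /andP[rx we]; case: ltnP => lt /=; first by lia.
case: ltnP => ir /=; last by have := mono (r := x); lia.
have E : r.-1.+1 = r by lia.
by have := mono (r := r.-1); rewrite E; lia.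
Qed.

Lemma unslide_cell_inj r1 w1 r2 w2 :
  unslide_cell r1 w1 = unslide_cell r2 w2 -> (r1, w1) = (r2, w2).
Proof.
have [on1|off1] := boolP (onpath i x e r1 w1); last first.
  have [/unslide_cell_onpath|off2] := boolP (onpath i x e r2 w2).
    by move=> on E; move: on; rewrite -E /unslide_cell (negPf off1) /= (negPf off1).
  by rewrite /unslide_cell (negPf off1) (negPf off2).
have [on2|off2] := boolP (onpath i x e r2 w2); last first.
  have := unslide_cell_onpath on1 => on; move=> E; move: on; rewrite E.
  by rewrite /unslide_cell (negPf off2) /= (negPf off2).
rewrite /unslide_cell on1 on2; move: on1 on2; rewrite /onpath.
move=> /andP[rx1 we1] /andP[rx2 we2].
have a1 : e r1 = w1 -> i < r1 -> r1.-1.+1 = r1 by lia.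
case: (ltnP (e r1) w1) => lt1; case: (ltnP (e r2) w2) => lt2.
- by move=> [-> ?]; congr (_, _); lia.
- move=> EE; exfalso; move: EE; case: (ltnP i r2) => ir2 [E1 E2]; last by subst r1; lia.
  have E : r2 = r1.+1 by lia.
  by subst r2; lia.
- move=> EE; exfalso; move: EE; case: (ltnP i r1) => ir1 [E1 E2]; last by subst r2; lia.
  have E : r1 = r2.+1 by lia.
  by subst r1; lia.
- case: (ltnP i r1) => ir1; case: (ltnP i r2) => ir2 EE.
  + by case: EE => E1 E2; congr (_, _); lia.
  + by exfalso; case: EE => E1 E2; lia.
  + by exfalso; case: EE => E1 E2; lia.
  + have F1 : r1 = i by lia.
    have F2 : r2 = i by lia.
    by subst r1 r2; congr (_, _); lia.
Qed.

Lemma slide_unslideE t' t'' : slide i j x e t' t'' ->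
  forall r w, t' r w = unslide t'' r w.
Proof.
move=> [s1 s2 s3 s4] r w; rewrite /unslide /unslide_cell.
case: ifP => [|/negbT off]; last by rewrite s4.
rewrite /onpath => /andP[rx we]; case: ltnP => lt /=.
  by rewrite s1; [congr t'; lia|lia|lia].
case: ltnP => ir /=.
  have E : r.-1.+1 = r by lia.
  have Ew : w = e r.-1.+1 by rewrite E; lia.
  by rewrite {2}Ew s2 ?E; [congr t'; lia|lia].
have F1 : r = i by lia.
by rewrite s3; subst r; congr t'; lia.
Qed.

Lemma eq_unslide e2 : (forall r, i <= r <= x.+1 -> e r = e2 r) ->
  forall r w, unslide_cell r w =
    if onpath i x e2 r w then
      if e2 r < w then (r, w.-1) else if i < r then (r.-1, w) else (x, e2 x.+1)
    else (r, w).
Proof.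
move=> ee r w; rewrite /unslide_cell /onpath -(ee x.+1); last by lia.
have [rx|//] := boolP (i <= r <= x).
by rewrite -!ee //; lia.
Qed.

End Unslide.

(** A longer horizontal run of one path contradicts the downward exchange, or the end, of the other;
    so the inequalities determine the path on its rows. *)
Lemma fpath_uniq i j t x1 x2 e1 e2 : fpath i j t x1 e1 -> fpath_end i j t x1 e1 ->
  fpath i j t x2 e2 -> fpath_end i j t x2 e2 ->
  x1 = x2 /\ forall r, i <= r <= x1.+1 -> e1 r = e2 r.
Proof.
move=> p1 f1 p2 f2.
have le y1 y2 d1 d2 : fpath i j t y1 d1 -> fpath_end i j t y1 d1 ->
    fpath i j t y2 d2 -> forall r, i <= r -> r <= y1 -> r <= y2 -> d1 r = d2 r ->
    d2 r.+1 <= d1 r.+1.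
  move=> [_ _ mono1 _ dn1] [fe1 _] [_ _ _ rt2 _] r ir r1 r2 Er.
  rewrite leqNgt; apply/negP => lt.
  have := mono1 r ltac:(lia) => m1.
  have := rt2 r (d1 r.+1) ltac:(lia) ltac:(lia).
  have [E|lt1] : r = y1 \/ r < y1 by lia.
    by subst r; lia.
  by have := dn1 r ltac:(lia); lia.
have ee r : i <= r -> r <= x1.+1 -> r <= x2.+1 -> e1 r = e2 r.
  elim: r => [|r IH] ir r1 r2.
    have [_ E1 _ _ _] := p1; have [_ E2 _ _ _] := p2.
    have E : i = 0 by lia.
    by subst i; rewrite E1 E2.
  have [E|lt] : i = r.+1 \/ i <= r by lia.
    have [_ E1 _ _ _] := p1; have [_ E2 _ _ _] := p2.
    by rewrite -E E1 E2.
  have Er := IH lt ltac:(lia) ltac:(lia).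
  apply/anti_leq/andP; split; last exact: (le _ _ _ _ p1 f1 p2).
  by apply: (le _ _ _ _ p2 f2 p1).
have nlt y1 y2 d1 d2 : fpath_end i j t y1 d1 -> fpath i j t y1 d1 -> fpath i j t y2 d2 ->
    d1 y1.+1 = d2 y1.+1 -> ~ (y1 < y2).
  move=> [_ fe1] [iy _ _ _ _] [_ _ _ _ dn2] E lt.
  by have := dn2 y1 ltac:(lia); rewrite -E; lia.
have [ix1 _ _ _ _] := p1; have [ix2 _ _ _ _] := p2.
have E : x1 = x2.
  have [lt|gt|//] := ltngtP x1 x2.
    by case: (nlt _ _ _ _ f1 p1 p2 (ee _ _ _ _) lt); lia.
  by case: (nlt _ _ _ _ f2 p2 p1 (esym (ee _ _ _ _)) gt); lia.
by split => // r rx; apply: ee; lia.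
Qed.

Lemma slide_det i j x t' t1 t2 e1 e2 : slide i j x e1 t' t1 -> slide i j x e2 t' t2 ->
  i <= x -> (forall r, i <= r <= x.+1 -> e1 r = e2 r) -> forall r w, t1 r w = t2 r w.
Proof.
move=> [a1 a2 a3 a4] [b1 b2 b3 b4] ix ee r w.
have [on|off] := boolP (onpath i x e1 r w); last first.
  rewrite a4 // b4 //; move: off; rewrite /onpath.
  by have [rx|//] := boolP (i <= r <= x); rewrite !ee //; lia.
move: on => /andP[rx]; rewrite !ee; [|lia|lia] => we.
have [lt|ge] := ltnP w (e2 r.+1).
  by rewrite a1 ?b1 //; rewrite ?ee; lia.
have Ew : w = e1 r.+1 by rewrite ee; lia.
have [E|lt] : r = x \/ r < x by lia.
  rewrite Ew E a3 ee; last by lia.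
  by rewrite b3.
rewrite Ew a2; last by lia.
rewrite ee; last by lia.
by rewrite b2 //; lia.
Qed.

(** * One step of the bijection on hook functions *)

Section HookStep.
Variables (p : nat -> nat) (N : nat) (cl : nat -> nat).
Hypothesis p_mono : forall x, 0 < x -> p x.+1 <= p x.
Hypothesis inl_cl : forall x y, 0 < x -> 0 < y -> inl p x y = (x <= cl y).
Implicit Types t g : nat -> nat -> nat.

(* [g] is the hook function of the NPS bijection with the leg length added, so that
   it takes values in [nat].  Row [h] is a candidate when the hook value is
   nonnegative, and this value then counts the columns right of [j]. *)
Definition cand j g h : bool := cl j <= g h j + h.
Definition cand_col j g h : nat := j + g h j + h - cl j.

(** The bound says, free of subtraction, that [g] is at most arm plus leg. The zeros make the
    function unique where nothing has been inserted. *)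
Definition hook_cond i j g : Prop := forall x y, inl p x y ->
  if proc i j x y then g x y + x + y <= p x + cl y else g x y == 0.

Definition cands_good i j t g : Prop :=
  forall h, i <= h <= cl j -> cand j g h -> good i j t h (cand_col j g h).

(** The rule of Novelli, Pak and Stoyanovskii. A hook value that moves up one row drops by one,
    because [g] is kept while the leg is one longer; row [x] records the number of exchanges to the
    right. *)
Definition hook_step i j x (e : nat -> nat) g g'' : Prop :=
  [/\ forall h, i <= h < x -> g'' h j = g h.+1 j,
      g'' x j = e x.+1 - j + (cl j - x)
    & forall h w, inl p h w -> ~~ ((w == j) && (i <= h <= x)) ->
        g'' h w = g h w].

Variables (i j : nat).
Hypothesis lij : inl p i j.

Let i0 : 0 < i. Proof. by move: lij; rewrite /inl; lia. Qed.
Let j0 : 0 < j. Proof. by move: lij; rewrite /inl; lia. Qed.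
Let icl : i <= cl j. Proof. by rewrite -inl_cl. Qed.

Lemma inl_colj h : 0 < h -> h <= cl j -> inl p h j.
Proof. by move=> h0 hc; rewrite inl_cl. Qed.

Section Forward.
Variables (t t'' g g'' : nat -> nat -> nat) (x : nat) (e : nat -> nat).
Hypotheses (tt' : tab p N t) (o' : ord p i.+1 j t) (hk : hook_cond i.+1 j g)
  (cg : cands_good i.+1 j t g).
Hypotheses (fp : fpath i j t x e) (fe : fpath_end i j t x e)
  (sl : slide i j x e t t'') (lx : inl p x (e x.+1)) (hs : hook_step i j x e g g'').

Let o'' : ord p i j t'' := slide_ord i0 j0 tt' lij o' fp fe sl.
Let rp : rpath i j t'' x e := slide_rpath p_mono i0 j0 tt' lij o' fp sl.

Let jx : j <= e x.+1.
Proof. by have [ix _ _ _ _] := fp; apply: (fpath_ge fp); lia. Qed.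

Let xc : i <= x <= cl j.
Proof.
have [ix _ _ _ _] := fp; rewrite ix -inl_cl //; last by lia.
by apply: (inl_le p_mono lx); lia.
Qed.

Let cx : cand_col j g'' x = e x.+1.
Proof. by have [_ g2 _] := hs; rewrite /cand_col g2; lia. Qed.

(** Such a candidate comes from row [h.+1] with its column lowered by one, and there its column was
    at most [e h.+1] because it was good in [t]. *)
Let before h : i <= h < x -> cand j g'' h -> cand_col j g'' h < e h.+1.
Proof.
have [g1 _ _] := hs.
move=> hx; rewrite /cand /cand_col g1 // => ch.
have := cg (h := h.+1) ltac:(lia); rewrite /cand /cand_col => /(_ ltac:(lia)) gd.
by have := good_before_le i0 j0 fp (h := h.+1) ltac:(lia) ltac:(lia) gd; lia.
Qed.

Let after h : x < h <= cl j -> cand j g'' h -> good i.+1 j t h (cand_col j g'' h).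
Proof.
have [_ _ g3] := hs.
move=> hx ch; have lh : inl p h j by apply: inl_colj; lia.
have gE : g'' h j = g h j by apply: g3 => //; lia.
by move: ch; rewrite /cand /cand_col gE; apply: cg; lia.
Qed.

Lemma hook_step_cond : hook_cond i j g''.
Proof.
have [g1 g2 g3] := hs => a b lab.
have [on|off] := boolP ((b == j) && (i <= a <= x)); last first.
  rewrite g3 //; have := hk lab.
  by have -> : proc i j a b = proc i.+1 j a b by rewrite /proc; lia.
move: on => /andP[/eqP bj ax]; rewrite bj in lab *.
rewrite ifT; last by rewrite /proc; lia.
have [E|lt] : a = x \/ a < x by lia.
  by rewrite E g2; have := lx; rewrite /inl; lia.
rewrite g1; last by lia.
have lS : inl p a.+1 j by apply: inl_colj; lia.
have := hk lS; rewrite ifT; last by rewrite /proc; lia.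
by have := @p_mono a; lia.
Qed.

Lemma hook_step_good : cands_good i j t'' g''.
Proof.
move=> h hc ch; have [lt|ge] := ltnP h x.
  apply: (good_weakly_left rp); [lia|lia| |].
    by rewrite /cand_col; move: ch; rewrite /cand; lia.
  by apply/ltnW/before => //; lia.
have [E|gt] : h = x \/ x < h by lia.
  by rewrite E cx; exists e.
have [e2 [p2 E2 _]] := good_after i0 j0 rp fp sl gt (after (h := h) ltac:(lia) ch).
by exists e2.
Qed.

(** This makes an insertion reversible: the path just taken can be recognized in the output
    alone. *)
Lemma hook_step_last : [/\ i <= x <= cl j, cand j g'' x
  & last_path i j t'' (cand j g'') (cand_col j g'') (cl j) x e].
Proof.
have [ix _ _ _ _] := fp.
split => //; first by have [_ g2 _] := hs; rewrite /cand g2; lia.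
split => // h e2 hx ch p2 E2.
have [e3 [p3 E3 le3]] :=
  good_after i0 j0 rp fp sl (h := h) ltac:(lia) (after hx ch).
apply: leq_trans le3.
by apply: (rpath_noncross_le p2 p3 (s := h.+1)); rewrite ?E2 ?E3 //; lia.
Qed.

End Forward.

Section Backward.
Variables (t t'' g g'' : nat -> nat -> nat) (x : nat) (e : nat -> nat).
Hypotheses (o'' : ord p i j t'') (hk : hook_cond i j g'')
  (cg : cands_good i j t'' g'').
Hypothesis tinj : forall a b c d, inl p a b -> inl p c d -> t'' a b = t'' c d ->
  (a, b) = (c, d).
Hypotheses (xc : i <= x <= cl j) (cx : cand j g'' x).
Hypothesis lp : last_path i j t'' (cand j g'') (cand_col j g'') (cl j) x e.

Let rp : rpath i j t'' x e. Proof. by case: lp. Qed.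

Let je r : i <= r -> r <= x.+1 -> j <= e r.
Proof.
have [_ ei _ _ _] := rp => ir rx.
by have := rpath_mono rp (leqnn i) ir rx; rewrite ei.
Qed.

Lemma last_path_inl : inl p x (e x.+1).
Proof.
have [ix _ _ _ _] := rp; have [_ Ex _ _] := lp.
have jx := je (r := x.+1) ltac:(lia) (leqnn _).
have lxj : inl p x j by apply: inl_colj; lia.
have := hk lxj; rewrite ifT; last by rewrite /proc; lia.
by move: cx; rewrite /cand /inl Ex /cand_col in jx *; lia.
Qed.
Let lx := last_path_inl.

Lemma last_path_onpath r w : onpath i x e r w -> inl p r w.
Proof.
move=> /andP[rx we]; have m1 := rpath_mono rp (r := r.+1) (s := x.+1).
by have j1 := @je r; apply: (inl_le p_mono lx); lia.
Qed.

Hypothesis sl : slide i j x e t t''.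

Lemma last_path_fpath : fpath i j t x e.
Proof. exact: (unslide_fpath p_mono i0 j0 o'' rp lx sl). Qed.
Lemma last_path_fpath_end : fpath_end i j t x e.
Proof. exact: (unslide_fpath_end p_mono i0 j0 o'' rp lx sl). Qed.
Lemma last_path_ord : ord p i.+1 j t.
Proof. exact: (unslide_ord p_mono i0 j0 o'' rp lx sl tinj). Qed.

Hypothesis gi : g i j = 0.
Hypothesis gmid : forall h, i < h <= x -> g h j = g'' h.-1 j.
Hypothesis gout : forall h w, inl p h w -> ~~ ((w == j) && (i <= h <= x)) ->
  g'' h w = g h w.

Lemma last_path_hook_step : hook_step i j x e g g''.
Proof.
have [_ Ex _ _] := lp; split => //; first by move=> h hx; rewrite gmid //; lia.
by rewrite Ex /cand_col; move: cx; rewrite /cand; lia.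
Qed.

Let midcol h : i < h <= x -> cand j g h -> cand_col j g h <= e h.
Proof.
have [_ _ before _] := lp.
move=> hx; rewrite /cand /cand_col gmid // => ch.
(* In the first case a hook value -1 becomes 0 on its way down, and a new candidate appears, in
   column [j]. *)
have [E|lt] : cl j = g'' h.-1 j + h \/ cl j <= g'' h.-1 j + h.-1 by lia.
  by have := @je h; lia.
have := before h.-1 ltac:(lia); rewrite /cand /cand_col => /(_ lt).
have -> : h.-1.+1 = h by lia.
by lia.
Qed.

Lemma last_path_hook_cond : hook_cond i.+1 j g.
Proof.
have [ix ei mono lft up] := rp => a b lab.
have [on|off] := boolP ((b == j) && (i <= a <= x)); last first.
  rewrite -gout //; have := hk lab.
  by have -> : proc i j a b = proc i.+1 j a b by rewrite /proc; lia.
move: on => /andP[/eqP bj ax]; rewrite bj in lab *.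
have [E|lt] : a = i \/ i < a by lia.
  by rewrite E ifF ?gi // /proc; lia.
rewrite ifT; last by rewrite /proc; lia.
have [ca|nca] := boolP (cand j g a); last first.
  by move: nca lab; rewrite /cand /inl; lia.
have := midcol (h := a) ltac:(lia) ca; rewrite /cand_col.
have /and3P[_ _] : inl p a (e a).
  by apply: last_path_onpath; rewrite /onpath; have := mono a; lia.
by move: ca; rewrite /cand; lia.
Qed.

Lemma last_path_cands_good : cands_good i.+1 j t g.
Proof.
have [ix ei mono lft up] := rp; have [_ _ _ after] := lp.
have fp := last_path_fpath.
have tle := unslide_le p_mono i0 j0 o'' rp lx sl.
move=> h hc ch; have [hx|hx] := leqP h x.
  apply: (good_before i0 j0 fp); [lia|lia| |].
    by move: ch; rewrite /cand /cand_col; lia.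
  by apply: midcol => //; lia.
have lh : inl p h j by apply: inl_colj; lia.
have gE : g'' h j = g h j by apply: gout => //; lia.
have ch'' : cand j g'' h by move: ch; rewrite /cand gE.
have [e2 p2 E2] := cg (h := h) ltac:(lia) ch''.
have := after h e2 ltac:(lia) ch'' p2 E2 => le2.
rewrite /cand_col -gE -/(cand_col j g'' h) -E2.
exact: (good_before_below i0 j0 fp sl tle).
Qed.

End Backward.
End HookStep.

Definition absdiff (a b : nat) := (a - b) + (b - a).

(** Each of the [x - i] values moved up drops by one, so its absolute value grows by at most one;
    this is paid by the downward exchanges. The new value of row [x] is [y], the number of exchanges
    to the right. *)
Lemma column_dist_shift (g g'' : nat -> nat) i x c y : i <= x <= c ->
  (forall h, i <= h < x -> g'' h = g h.+1) -> g'' x = y + (c - x) ->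
  (forall h, x < h <= c -> g'' h = g h) ->
  \sum_(i <= h < c.+1) absdiff (g'' h) (c - h) <=
  \sum_(i.+1 <= h < c.+1) absdiff (g h) (c - h) + (x - i + y).
Proof.
move=> /andP[ix xc] g1 g2 g3.
rewrite (big_cat_nat (n := x)) //=; last by lia.
rewrite (big_ltn (m := x)) // g2 (big_cat_nat (m := i.+1) (n := x.+1)) //=.
rewrite [X in X + _ + _](big_add1 _ _ i x.+1) /=.
have -> : absdiff (y + (c - x)) (c - x) = y by rewrite /absdiff; lia.
rewrite [X in _ + (y + X)](_ : _ = \sum_(x.+1 <= h < c.+1) absdiff (g h) (c - h)).
  have : \sum_(i <= h < x) absdiff (g'' h) (c - h) <=
         \sum_(i <= h < x) absdiff (g h.+1) (c - h.+1) + (x - i); last by lia.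
  rewrite -[X in _ + X]muln1 -sum_nat_const_nat -big_split /=.
  rewrite big_nat_cond [X in _ <= X]big_nat_cond; apply: leq_sum => h.
  by move=> /andP[hx _]; rewrite g1 // /absdiff; lia.
by apply: eq_big_nat => h hx; rewrite g3 //; lia.
Qed.

(** The hook values [v - l] run from [-l] to [a] and give two triangular sums. *)
Lemma sum_absdiff a l : 
  2 * \sum_(0 <= v < (a + l).+1) absdiff v l = a * a.+1 + l * l.+1.
Proof.
elim: a => [|a IH].
  elim: l => [|l IH]; first by rewrite big_nat1.
  rewrite big_ltn // big_add1 /= mulnDr.
  have -> : \sum_(0 <= i < (0 + l).+1) absdiff i.+1 l.+1 = \sum_(0 <= v < (0 + l).+1) absdiff v l.
    by apply: eq_bigr => i _; rewrite /absdiff !subSS.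
  by rewrite IH /absdiff; nia.
by rewrite addSn big_nat_recr //= mulnDr IH /absdiff; nia.
Qed.

Import Order.TTheory GRing.Theory Num.Theory.

(** * The NPS bijection and the number of exchanges *)

Section Fillings.
Local Open Scope nat_scope.

(** For [j > 0], the [j]-th part of the conjugate partition. *)
Definition clen (la : seq nat) (j : nat) : nat := count (leq j) la.

Lemma part_cons l la x : 0 < x -> part (l :: la) x.+1 = part la x.
Proof. by case: x. Qed.

Lemma leq_part_clen la x y : sorted geq la -> 0 < x -> 0 < y ->
  (y <= part la x) = (x <= clen la y).
Proof.
elim: la x => [|l la IH] x; first by rewrite /part nth_nil /clen /=; lia.
move=> /= s x0 y0; have s' := path_sorted s.
have geq_tr : transitive geq by move=> a b c /=; lia.
have [E|x1] : x = 1 \/ 1 < x by lia.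
  rewrite E /part /clen /=; case: (leqP y l) => //= lt; rewrite ?add0n.
  rewrite (_ : count _ _ = 0) //; apply/eqP; rewrite -leqn0 leqNgt -has_count.
  apply/hasPn => m mla; rewrite -ltnNge.
  have /allP /(_ m mla) /= := order_path_min geq_tr s; lia.
have E : x.-1.+1 = x by lia.
rewrite -E part_cons; last by lia.
rewrite IH //; last by lia.
rewrite /clen /=; case: (leqP y l) => //= lt; rewrite ?add0n.
rewrite (_ : count _ _ = 0); first by lia.
apply/eqP; rewrite -leqn0 leqNgt -has_count.
apply/hasPn => m mla; rewrite -ltnNge.
have /allP /(_ m mla) /= := order_path_min geq_tr s; lia.
Qed.

Lemma inl_addn la x y : 0 \notin la -> inl (part la) x y -> x + y <= (sumn la).+1.
Proof.
elim: la x y => [|l s IH] x y /=; first by rewrite /inl /part nth_nil; lia.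
rewrite inE negb_or /inl => /andP[l0 pl] /and3P[x0 y0].
have [->|x1] : x = 1 \/ 1 < x by lia.
  by rewrite /part /=; lia.
have E : x.-1.+1 = x by lia.
rewrite -E part_cons => [yx|]; last by lia.
have := IH x.-1 y pl; rewrite /inl yx; lia.
Qed.

(** Row [x] up to column [y], and one cell in each of the rows below it down to [a], are distinct
    cells. Hence the shifted hook values are at most [n], and hook functions can be encoded as
    fillings. *)
Lemma inl_hook la x y a b : 0 \notin la ->
  inl (part la) x y -> inl (part la) a b -> x <= a -> y + (a - x) <= sumn la.
Proof.
elim: la x a => [|l s IH] x a /=; first by rewrite /inl /part nth_nil; lia.
rewrite inE negb_or => /andP[l0 pl] lxy lab xa.
have [a1|a1] : a = 1 \/ 1 < a by rewrite /inl in lab; lia.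
  have E : x = 1 by rewrite /inl in lxy; lia.
  by move: lxy; rewrite a1 E /inl /part /=; lia.
have lab' : inl (part s) a.-1 b.
  move: lab; have {1}-> : a = a.-1.+1 by lia.
  by rewrite /inl part_cons; lia.
have [x1|x1] : x = 1 \/ 1 < x by rewrite /inl in lxy; lia.
  have := inl_addn pl lab'; move: lxy lab'; rewrite x1 /inl /part /=; lia.
have lxy' : inl (part s) x.-1 y.
  move: lxy; have {1}-> : x = x.-1.+1 by lia.
  by rewrite /inl part_cons; lia.
by have := IH _ _ pl lxy' lab' ltac:(lia); lia.
Qed.

Variable la : seq nat.
Hypothesis la_sorted : sorted geq la.
Hypothesis la_pos : 0 \notin la.

Let N := (sumn la).+1.
Notation p := (part la).

Lemma part_mono x : 0 < x -> p x.+1 <= p x.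
Proof.
move=> x0; have [->//|px] := posnP (p x.+1).
by rewrite leq_part_clen // (@leq_trans x.+1) // -leq_part_clen.
Qed.

Lemma mem_diagram x y : ((x, y) \in diagram la) = inl p x y.
Proof.
apply/allpairsPdep/idP => [[a [b [+ + [-> ->]]]]|].
  by rewrite !mem_iota /inl; lia.
rewrite /inl => /and3P[x0 y0 yx].
exists x, y; rewrite !mem_iota; split => //; last by lia.
have := count_size (leq y) la; rewrite -/(clen la y).
by move: yx; rewrite leq_part_clen //; lia.
Qed.

Lemma diagram_uniq : uniq (diagram la).
Proof.
apply: allpairs_uniq_dep; first exact: iota_uniq.
  by move=> *; exact: iota_uniq.
by move=> [a b] [c d] _ _ /= [-> ->].
Qed.

Lemma size_diagram : size (diagram la) = sumn la.
Proof.
rewrite size_allpairs_dep; congr sumn.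
rewrite -[RHS](mkseq_nth 0) /mkseq -[1]addn0 iotaDl -map_comp.
by apply: eq_map => i /=; rewrite size_iota /part add1n.
Qed.

Lemma card_cell : #|{: cell la}| = sumn la.
Proof. by rewrite card_seq_sub ?diagram_uniq // size_diagram. Qed.

Lemma cell_inl (c : cell la) : inl p (val c).1 (val c).2.
Proof. by rewrite -mem_diagram -surjective_pairing; exact: valP c. Qed.

Lemma inl_clen x y : 0 < x -> 0 < y -> inl p x y = (x <= clen la y).
Proof. by move=> x0 y0; rewrite /inl x0 y0 /= leq_part_clen. Qed.

Implicit Types (T g : filling la).

Definition tv T x y : nat :=
  if x == 0 then 0 else if (insub (x, y) : option (cell la)) is Some c
  then T c else N.

Definition gv g x y : nat :=
  if (insub (x, y) : option (cell la)) is Some c then g c else 0.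

Lemma tv_cell T (c : cell la) : tv T (val c).1 (val c).2 = T c.
Proof.
rewrite /tv -surjective_pairing valK; have := cell_inl c; rewrite /inl.
by case: eqP => // ->.
Qed.

Lemma gv_cell g (c : cell la) : gv g (val c).1 (val c).2 = g c.
Proof. by rewrite /gv -surjective_pairing valK. Qed.

Lemma inlP x y : inl p x y -> {c : cell la | (val c) = (x, y)}.
Proof. by rewrite -mem_diagram => h; exists (Sub (x, y) h); rewrite SubK. Qed.

(** Positive values and cells are equally numerous, so injectivity gives surjectivity. *)
Lemma tableauxP T : reflect (injective T /\ forall c, 0 < T c) (T \in tableaux la).
Proof.
rewrite inE; apply: (iffP andP) => [[/injectiveP inj /eqP im]|[inj pos]].
  split=> // c; have : T c \in [set T c | c in [set: cell la]]%SET by apply/imset_f.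
  by rewrite im inE.
split; first exact/injectiveP.
rewrite eqEcard; apply/andP; split.
  by apply/fintype.subsetP => k /imsetP[c _ ->]; rewrite inE.
rewrite card_imset // cardsT card_cell.
have -> : [set k : 'I_(sumn la).+1 | 0 < k]%SET = [set~ ord0]%SET.
  by apply/setP => k; rewrite !inE -val_eqE lt0n.
by rewrite cardsC1 card_ord.
Qed.

Lemma tv_tab T : T \in tableaux la -> tab p N (tv T).
Proof.
move=> /tableauxP[_ pos]; split=> [y|x y l|x y x0 y0 nl]; first by rewrite /tv.
  have [c E] := inlP l; have := tv_cell T c; rewrite E => ->.
  by rewrite pos /N ltn_ord.
rewrite /tv; case: eqP => [E|_]; first by lia.
by rewrite -mem_diagram in nl; case: insubP => // c h; rewrite h in nl.
Qed.

Lemma tv_inj T a b c d : T \in tableaux la -> inl p a b -> inl p c d ->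
  tv T a b = tv T c d -> (a, b) = (c, d).
Proof.
move=> /tableauxP[inj _] /inlP[u Eu] /inlP[v Ev].
have := tv_cell T u; have := tv_cell T v; rewrite Eu Ev /= => -> ->.
by move=> /val_inj/inj uv; rewrite -Eu -Ev uv.
Qed.

Lemma tv_ext T1 T2 : (forall x y, inl p x y -> tv T1 x y = tv T2 x y) -> T1 = T2.
Proof.
move=> h; apply/ffunP => c; apply: val_inj.
by have := h _ _ (cell_inl c); rewrite !tv_cell.
Qed.

Lemma gv_ext T1 T2 : (forall x y, inl p x y -> gv T1 x y = gv T2 x y) -> T1 = T2.
Proof.
move=> h; apply/ffunP => c; apply: val_inj.
by have := h _ _ (cell_inl c); rewrite !gv_cell.
Qed.

Lemma tv_neq T x y : T \in tableaux la -> 0 < x -> 0 < y -> tv T x y < N ->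
  inl p x y.
Proof. by move=> Tt; apply: tab_inl; exact: tv_tab Tt. Qed.

Lemma pick_entry T c : T \in tableaux la -> [pick c' | T c' == T c] = Some c.
Proof.
move=> /tableauxP[inj _]; case: pickP => [d /eqP/inj->//|/(_ c)].
by rewrite eqxx.
Qed.

Lemma exchange_tableau T c d : T \in tableaux la ->
  exchange (T c) (T d) T \in tableaux la.
Proof.
move=> /tableauxP[inj pos]; apply/tableauxP; split=> [a b|a].
  by rewrite !ffunE => /perm_inj/inj.
by rewrite ffunE; case: tpermP => // _; exact: pos.
Qed.

Lemma exchange_cell T c d a : T \in tableaux la ->
  exchange (T c) (T d) T a = if a == c then T d else if a == d then T c else T a.
Proof.
move=> /tableauxP[inj _]; rewrite ffunE; case: tpermP => [/inj->|/inj->|].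
- by rewrite eqxx.
- by rewrite eqxx; case: eqP => // ->.
- by case: eqP => [-> //|_]; case: eqP => [-> //|].
Qed.

Lemma tv_exchange T c d x y : T \in tableaux la ->
  tv (exchange (T c) (T d) T) x y =
  if (x, y) == val c then T d : nat else if (x, y) == val d then T c : nat
  else tv T x y.
Proof.
move=> Tt; have [|nl] := boolP (inl p x y).
  move=> /inlP[a E]; rewrite -E; have := tv_cell (exchange (T c) (T d) T) a.
  have := tv_cell T a; rewrite E /= => -> ->; rewrite -E exchange_cell //.
  by rewrite !(inj_eq val_inj); case: ifP => // _; case: ifP.
have ne (a : cell la) : ((x, y) == val a) = false.
  by apply: contraNF nl => /eqP E; have := cell_inl a; rewrite -E.
rewrite !ne /tv; case: eqP => // _.
by rewrite insubN // mem_diagram.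
Qed.

Lemma next_cellsP (c d : cell la) : reflect
  (val d = ((val c).1.+1, (val c).2) \/ val d = ((val c).1, (val c).2.+1))
  (d \in next_cells c).
Proof. by rewrite inE; apply: (iffP orP) => -[/eqP|/eqP]; [left|right|left|right]. Qed.

Lemma nps_step_exchange T c d s : T \in tableaux la -> d \in next_cells c ->
  (forall d', d' \in next_cells c -> T d <= T d') -> T d < T c ->
  nps_step (T c) (T, s) = (exchange (T c) (T d) T, s.+1).
Proof.
move=> Tt dc dmin lt; rewrite /nps_step pick_entry //.
have -> : is_corner la (val c) = false.
  apply/negP => /andP[/negP D /negP R].
  by case/next_cellsP: dc => E; [case: D|case: R]; rewrite -E; exact: valP d.
have [inj _] := tableauxP _ Tt.
case: pickP => [d'|/(_ d)]; last first.
  by rewrite dc /= => /negP[]; apply/forallP => d'; apply/implyP; exact: dmin.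
move=> /andP[d'c /forallP/(_ d)]; rewrite dc /= => le.
have -> : d' = d by apply: inj; apply: val_inj; apply/anti_leq; rewrite le dmin.
by rewrite lt.
Qed.

Lemma nps_step_stop T c s : T \in tableaux la ->
  (forall d, d \in next_cells c -> T c < T d) -> nps_step (T c) (T, s) = (T, s).
Proof.
move=> Tt gt; rewrite /nps_step pick_entry //; case: ifP => // _.
by case: pickP => // d /andP[dc _]; rewrite ltnNge ltnW // gt.
Qed.

Lemma next_cells_tv T (c d : cell la) : d \in next_cells c ->
  (T d : nat) = tv T (val c).1.+1 (val c).2 \/
  (T d : nat) = tv T (val c).1 (val c).2.+1.
Proof.
by move=> /next_cellsP[E|E]; [left|right]; rewrite -tv_cell E.
Qed.

Lemma slide_refl i j t : slide i j i (fun=> j) t t.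
Proof. by split => // r w; lia. Qed.

Lemma nps_run T c s : T \in tableaux la ->
  let i := (val c).1 in let j := (val c).2 in
  exists T'' x e, [/\ T'' \in tableaux la, inl p x (e x.+1),
    [/\ fpath i j (tv T) x e, fpath_end i j (tv T) x e
      & slide i j x e (tv T) (tv T'')],
    iter (x - i + (e x.+1 - j)) (nps_step (T c)) (T, s) =
      (T'', s + (x - i + (e x.+1 - j)))
    & forall s', nps_step (T c) (T'', s') = (T'', s')].
Proof.
have [m] := ubnP ((sumn la).+2 - ((val c).1 + (val c).2)).
elim: m T c s => // m IH T c s hm Tt i j.
have lc : inl p i j := cell_inl c.
have [i0 j0] : 0 < i /\ 0 < j by move: lc; rewrite /inl; lia.
have ij := inl_addn la_pos lc.
have ttab := tv_tab Tt.
have tc : tv T i j = T c by rewrite tv_cell.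
have tR : tv T i j.+1 <= N by apply: tab_le ttab _.
have tD : tv T i.+1 j <= N by apply: tab_le ttab _.
have [stop|go] := boolP ((T c < tv T i j.+1) && (T c < tv T i.+1 j)).
  exists T, i, (fun=> j); rewrite !subnn /=; split => //.
  - split; last exact: slide_refl.
    + by split => // r w; lia.
    + by rewrite /fpath_end tc; move: stop => /andP[].
  - by rewrite !addn0.
  - move=> s'; apply: nps_step_stop => // d /(next_cells_tv T)[] ->;
      by move: stop => /andP[].
have TcN : T c < N by exact: ltn_ord.
have neS (k : nat) : k.+1 != k by rewrite neq_ltn ltnSn orbT.
have step d : d \in next_cells c ->
    (forall d', d' \in next_cells c -> T d <= T d') -> T d < T c ->
    exists T'' x e, let T1 := exchange (T c) (T d) T in
    let i1 := (val d).1 in let j1 := (val d).2 in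
    [/\ T'' \in tableaux la, inl p x (e x.+1),
      [/\ fpath i1 j1 (tv T1) x e, fpath_end i1 j1 (tv T1) x e
        & slide i1 j1 x e (tv T1) (tv T'')],
      iter (x - i1 + (e x.+1 - j1)).+1 (nps_step (T c)) (T, s) =
        (T'', s + (x - i1 + (e x.+1 - j1)).+1)
      & forall s', nps_step (T c) (T'', s') = (T'', s')].
  move=> dc dmin lt.
  have T1t := exchange_tableau c d Tt.
  have T1d : exchange (T c) (T d) T d = T c.
    by rewrite exchange_cell // eqxx; case: eqP => // ->.
  have hd : (sumn la).+2 - ((val d).1 + (val d).2) < m.
    by case/next_cellsP: dc => ->; rewrite /= -/i -/j; lia.
  have [T'' [x [e [T''t lx pth it fx]]]] := IH _ d s.+1 hd T1t.
  exists T'', x, e; split => //; last by rewrite -T1d.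
  by rewrite iterSr (nps_step_exchange s Tt dc dmin lt) -{1}T1d it addSnnS.
have in_of_lt x y : 0 < x -> 0 < y -> tv T x y < N -> inl p x y by exact: tv_neq.
have [lt|ge] := ltnP (tv T i j.+1) (tv T i.+1 j).
- have lr : inl p i j.+1 by apply: in_of_lt => //; lia.
  have [d Ed] := inlP lr.
  have td : (T d : nat) = tv T i j.+1 by rewrite -tv_cell Ed.
  have dc : d \in next_cells c by apply/next_cellsP; right.
  have ltc : T d < T c.
    rewrite ltn_neqAle leqNgt; apply/andP; split; last by apply: contra go => le; rewrite td in le; rewrite le (ltn_trans le lt).
    apply/eqP => /val_inj; have [inj _] := tableauxP _ Tt.
    by move=> /inj E; move: Ed; rewrite E [val c]surjective_pairing -/i -/j => -[] /eqP; rewrite eq_sym (negPf (neS _)).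
  have [|T'' [x [e /= [T''t lx [fp fe sl] it fx]]]] := step d dc _ ltc.
    by move=> d' /(next_cells_tv T)[] ->; rewrite td // ltnW.
  have t1E x' y' : tv (exchange (T c) (T d) T) x' y' =
      if (x', y') == (i, j) then tv T i j.+1 else
      if (x', y') == (i, j.+1) then tv T i j else tv T x' y'.
    by rewrite tv_exchange // Ed td tc -surjective_pairing.
  have E1 : tv (exchange (T c) (T d) T) i j = tv T i j.+1 by rewrite t1E eqxx.
  have E2 : tv (exchange (T c) (T d) T) i j.+1 = tv T i j.
    by rewrite t1E eqxx xpair_eqE (negPf (neS _)) ?andbF.
  have E3 r w : (r, w) != (i, j) -> (r, w) != (i, j.+1) ->
      tv (exchange (T c) (T d) T) r w = tv T r w.
    by move=> /negPf n1 /negPf n2; rewrite t1E n1 n2.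
  rewrite Ed /= in fp fe sl it.
  have [ix _ _ _ _] := fp; have jx := fpath_ge fp (r := x.+1) (leqW ix) (leqnn _).
  exists T'', x, (fun r => if r == i then j else e r).
  rewrite (prepend_end j e ix).
  have -> : x - i + (e x.+1 - j) = (x - i + (e x.+1 - j.+1)).+1.
    by clear -jx; lia.
  have ltv : tv T i j.+1 < tv T i j by rewrite tc -td.
  split => //; split.
  + exact: (fpath_cons_right E1 E2 E3 ltv lt fp).
  + exact: (fpath_end_cons_right E1 E2 E3 ltv lt fp fe).
  + exact: (slide_cons_right E1 E2 E3 ltv lt fp sl).
- have lt : tv T i.+1 j < tv T i j.+1.
    rewrite ltn_neqAle ge andbT; apply/eqP => E.
    have lN : tv T i.+1 j < N by lia.
    have l1 := in_of_lt i.+1 j isT j0 lN; rewrite E in lN.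
    have l2 := in_of_lt i j.+1 i0 isT lN.
    by have [/eqP] := tv_inj Tt l1 l2 E; rewrite (negPf (neS _)).
  have lr : inl p i.+1 j by apply: in_of_lt => //; lia.
  have [d Ed] := inlP lr.
  have td : (T d : nat) = tv T i.+1 j by rewrite -tv_cell Ed.
  have dc : d \in next_cells c by apply/next_cellsP; left.
  have ltc : T d < T c.
    rewrite ltn_neqAle leqNgt; apply/andP; split; last by apply: contra go => le; rewrite td in le; rewrite le (ltn_trans le lt).
    apply/eqP => /val_inj; have [inj _] := tableauxP _ Tt.
    by move=> /inj E; move: Ed; rewrite E [val c]surjective_pairing -/i -/j => -[] /eqP; rewrite eq_sym (negPf (neS _)).
  have [|T'' [x [e /= [T''t lx [fp fe sl] it fx]]]] := step d dc _ ltc.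
    by move=> d' /(next_cells_tv T)[] ->; rewrite td // ltnW.
  have t1E x' y' : tv (exchange (T c) (T d) T) x' y' =
      if (x', y') == (i, j) then tv T i.+1 j else
      if (x', y') == (i.+1, j) then tv T i j else tv T x' y'.
    by rewrite tv_exchange // Ed td tc -surjective_pairing.
  have E1 : tv (exchange (T c) (T d) T) i j = tv T i.+1 j by rewrite t1E eqxx.
  have E2 : tv (exchange (T c) (T d) T) i.+1 j = tv T i j.
    by rewrite t1E eqxx xpair_eqE (negPf (neS _)) ?andbF.
  have E3 r w : (r, w) != (i, j) -> (r, w) != (i.+1, j) ->
      tv (exchange (T c) (T d) T) r w = tv T r w.
    by move=> /negPf n1 /negPf n2; rewrite t1E n1 n2.
  rewrite Ed /= in fp fe sl it.
  have [ix _ _ _ _] := fp; have jx := fpath_ge fp (r := x.+1) (leqW ix) (leqnn _).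
  exists T'', x, (fun r => if r == i then j else e r).
  rewrite (prepend_end j e (ltnW ix)).
  have -> : x - i + (e x.+1 - j) = (x - i.+1 + (e x.+1 - j)).+1.
    by clear -ix; lia.
  have ltv : tv T i.+1 j < tv T i j by rewrite tc -td.
  split => //; split.
  + exact: (fpath_cons_down E1 E2 E3 ltv lt fp).
  + exact: (fpath_end_cons_down E1 E2 E3 ltv lt fp fe).
  + exact: (slide_cons_down E1 E2 E3 ltv lt fp sl).
Qed.

(** * One insertion as a bijection of pairs *)

Notation clj j := (clen la j).

Lemma inl_clj x y : 0 < x -> 0 < y -> inl p x y = (x <= clj y).
Proof. exact: inl_clen. Qed.

(** The loop invariant: an insertion is a bijection between the pairs satisfying two consecutive
    instances of it. *)
Definition sorted_upto i j (Tg : filling la * filling la) : Prop :=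
  [/\ Tg.1 \in tableaux la, ord p i j (tv Tg.1),
      hook_cond p (clen la) i j (gv Tg.2)
    & cands_good (clen la) i j (tv Tg.1) (gv Tg.2)].

Definition insertion i j x e (Tg Tg'' : filling la * filling la) : Prop :=
  [/\ fpath i j (tv Tg.1) x e, fpath_end i j (tv Tg.1) x e,
      slide i j x e (tv Tg.1) (tv Tg''.1), inl p x (e x.+1)
    & hook_step p (clen la) i j x e (gv Tg.2) (gv Tg''.2)].

Section Step.
Variables (i j : nat).
Hypothesis lij : inl p i j.

Let i0 : 0 < i. Proof. by move: lij; rewrite /inl; lia. Qed.
Let j0 : 0 < j. Proof. by move: lij; rewrite /inl; lia. Qed.

Lemma insertion_sorted x e T g T'' g'' : T'' \in tableaux la ->
  sorted_upto i.+1 j (T, g) -> insertion i j x e (T, g) (T'', g'') ->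
  sorted_upto i j (T'', g'').
Proof.
move=> T''t [/= Tt o' hk cg] [/= fp fe sl lx hs]; have tt' := tv_tab Tt.
split => //=.
- exact: (slide_ord i0 j0 tt' lij o' fp fe sl).
- exact: (hook_step_cond part_mono inl_clj lij hk fp lx hs).
- exact: (hook_step_good part_mono inl_clj lij tt' o' cg fp sl lx hs).
Qed.

Lemma insertion_last x e T g T'' g'' :
  sorted_upto i.+1 j (T, g) -> insertion i j x e (T, g) (T'', g'') ->
  [/\ i <= x <= clj j, cand (clen la) j (gv g'') x
    & last_path i j (tv T'') (cand (clen la) j (gv g''))
        (cand_col (clen la) j (gv g'')) (clj j) x e].
Proof.
move=> [/= Tt o' hk cg] [/= fp fe sl lx hs]; have tt' := tv_tab Tt.
exact: (hook_step_last part_mono inl_clj lij tt' o' cg fp sl lx hs).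
Qed.

(** Both paths are the last path of the same output, hence equal. Sliding back along it recovers the
    tableau, and shifting back recovers the hooks, the one in [(i, j)] having been 0. *)
Lemma insertion_inj x1 x2 e1 e2 T1 T2 g1 g2 T'' g'' :
  sorted_upto i.+1 j (T1, g1) -> sorted_upto i.+1 j (T2, g2) ->
  insertion i j x1 e1 (T1, g1) (T'', g'') ->
  insertion i j x2 e2 (T2, g2) (T'', g'') -> (T1, g1) = (T2, g2).
Proof.
move=> ok1 ok2 in1 in2.
have [xc1 c1 l1] := insertion_last ok1 in1.
have [xc2 c2 l2] := insertion_last ok2 in2.
have E := last_path_uniq (proj2 (andP xc1)) (proj2 (andP xc2)) c1 c2 l1 l2.
subst x2; have [p1 E1 _ _] := l1; have [p2 E2 _ _] := l2.
have ee r : i <= r <= x1.+1 -> e1 r = e2 r.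
  move=> /andP[ir rx]; apply/anti_leq/andP; split.
    by apply: (rpath_noncross_le p1 p2 ir rx) => //; rewrite ?E1 ?E2.
  by apply: (rpath_noncross_le p2 p1 ir rx) => //; rewrite ?E1 ?E2.
case: in1 => /= f1 _ s1 _ [h11 h12 h13]; case: in2 => /= f2 _ s2 _ [h21 h22 h23].
have [ix ei1 mono1 _ _] := f1; have [_ ei2 mono2 _ _] := f2.
congr (_, _).
  apply: tv_ext => // a b lab.
  rewrite (slide_unslideE ix ei1 s1) (slide_unslideE ix ei2 s2).
  by rewrite /unslide (eq_unslide ix ei1 ee).
apply: gv_ext => // a b lab.
have [on|off] := boolP ((b == j) && (i <= a <= x1)); last by rewrite -h13 // h23.
move: on => /and3P[/eqP bj ia ax]; rewrite bj in lab *.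
move: ia; rewrite leq_eqVlt => /predU1P[E|lt].
  have [_ _ k1 _] := ok1; have [_ _ k2 _] := ok2.
  have := k1 _ _ lab; have := k2 _ _ lab; rewrite -E.
  have -> /= : proc i.+1 j i j = false by rewrite /proc !ltnn andbF.
  by move=> /eqP-> /eqP->.
have ia : i <= a.-1 < x1 by clear -lt ax; lia.
have Ea : a.-1.+1 = a by clear -lt; lia.
have := h11 _ ia; have := h21 _ ia.
by rewrite Ea => -> ->.
Qed.

Lemma unslide_filling x e T'' : i <= x -> e i = j ->
  (forall r, i <= r <= x -> e r <= e r.+1) -> T'' \in tableaux la ->
  (forall r w, onpath i x e r w -> inl p r w) ->
  exists2 T, T \in tableaux la & slide i j x e (tv T) (tv T'').
Proof.
move=> ix ei mono T''t onin.
have ucin r w : inl p r w ->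
    inl p (unslide_cell i x e r w).1 (unslide_cell i x e r w).2.
  move=> lrw; have [on|off] := boolP (onpath i x e r w).
    exact/onin/(unslide_cell_onpath ix ei mono).
  by rewrite /unslide_cell (negPf off).
pose T : filling la :=
  [ffun c => inord (unslide i x e (tv T'') (val c).1 (val c).2)].
have tt'' := tv_tab T''t; have [_ inn'' out''] := tt''.
have TE c : T c = unslide i x e (tv T'') (val c).1 (val c).2 :> nat.
  rewrite ffunE inordK //.
  by have /andP[_] := inn'' _ _ (ucin _ _ (cell_inl c)).
have Tt : T \in tableaux la.
  apply/tableauxP; split=> [c d /(congr1 val)|c].
    rewrite /= !TE /unslide => /(tv_inj T''t (ucin _ _ (cell_inl c)) (ucin _ _ (cell_inl d))).
    rewrite -!surjective_pairing => /(unslide_cell_inj ix ei mono).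
    by rewrite -!surjective_pairing => /val_inj.
  by rewrite TE; have /andP[] := inn'' _ _ (ucin _ _ (cell_inl c)).
have tE r w : tv T r w = unslide i x e (tv T'') r w.
  have [l|nl] := boolP (inl p r w).
    by have [c Ec] := inlP l; have := tv_cell T c; rewrite TE Ec.
  have off : ~~ onpath i x e r w by apply: contra nl; exact: onin.
  rewrite /unslide /unslide_cell (negPf off) /= /tv.
  by rewrite insubN // mem_diagram.
exists T => //.
have [s1 s2 s3 s4] := unslide_slide ix ei mono (tv T'').
by split=> [r w h1 h2|r h1||r w h1]; rewrite ?tE; [apply: s1|apply: s2|apply: s3|apply: s4].
Qed.

Lemma unshift_hooks g'' x : i <= x -> x <= clj j -> exists g,
  [/\ gv g i j = 0, forall h, i < h <= x -> gv g h j = gv g'' h.-1 j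
    & forall h w, inl p h w -> ~~ ((w == j) && (i <= h <= x)) ->
        gv g'' h w = gv g h w].
Proof.
move=> ix xc.
pose g : filling la := [ffun c => if ((val c).2 == j) && (i <= (val c).1 <= x) then
   if (val c).1 == i then ord0 else inord (gv g'' (val c).1.-1 j) else g'' c].
exists g; split.
- by have [c Ec] := inlP lij; have := gv_cell g c; rewrite ffunE Ec /= !eqxx leqnn ix.
- move=> h hx; have h0 : 0 < h by clear -hx; lia.
  have lh : inl p h j by rewrite inl_clj //; clear -hx xc; lia.
  have [c Ec] := inlP lh; have := gv_cell g c; rewrite ffunE Ec /= eqxx => ->.
  rewrite ifT; last by clear -hx; lia.
  rewrite ifF; last by clear -hx; lia.
  rewrite inordK // /gv; case: insubP => // *; exact: ltn_ord.
- move=> h w lh off; have [c Ec] := inlP lh; have := gv_cell g c; have := gv_cell g'' c.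
  by rewrite ffunE Ec /= (negPf off) => -> ->.
Qed.

Lemma insertion_surj T'' g'' : sorted_upto i j (T'', g'') ->
  exists T g x e, sorted_upto i.+1 j (T, g) /\ insertion i j x e (T, g) (T'', g'').
Proof.
move=> [/= T''t o'' hk cg].
have icl : i <= clj j by rewrite -inl_clj.
have cc : cand (clen la) j (gv g'') (clj j) by exact: leq_addl.
have [x [e [xc cx lp]]] := last_path_exists cg icl cc.
have [rp _ _ _] := lp; have [ix ei mono _ _] := rp.
have lx := last_path_inl inl_clj lij hk xc cx lp.
have onin := last_path_onpath part_mono inl_clj lij hk xc cx lp.
have [T Tt sl] := unslide_filling ix ei mono T''t onin.
have inj'' a b c d := @tv_inj T'' a b c d T''t.
have [g [gi gmid gout]] := unshift_hooks g'' ix (proj2 (andP xc)).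
have fp := last_path_fpath part_mono inl_clj lij o'' hk xc cx lp sl.
have fe := last_path_fpath_end part_mono inl_clj lij o'' hk xc cx lp sl.
have o' := last_path_ord part_mono inl_clj lij o'' hk inj'' xc cx lp sl.
have hs := last_path_hook_step inl_clj lij hk xc cx lp gi gmid gout.
have hk' := last_path_hook_cond part_mono inl_clj lij hk xc cx lp gi gmid gout.
have cg' := last_path_cands_good part_mono inl_clj lij o'' hk cg xc cx lp sl gi gmid gout.
by exists T, g, x, e.
Qed.

End Step.

Section StepFunction.
Variable c : cell la.
Let i := (val c).1.
Let j := (val c).2.

Definition hook_update (c' : cell la) (g : filling la) : filling la :=
  [ffun a => if ((val a).2 == j) && (i <= (val a).1 < (val c').1)
    then inord (gv g (val a).1.+1 j)
    else if ((val a).2 == j) && ((val a).1 == (val c').1)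
    then inord ((val c').2 - j + (clj j - (val c').1))
    else g a].

(** The hook update needs only the cell in which the inserted entry comes to rest, so no path enters
    the definition. On tableaux the [pick] always succeeds. *)
Definition nps_pair (Tg : filling la * filling la) : filling la * filling la :=
  let T'' := (nps_insert (Tg.1 c) (Tg.1, 0)).1 in
  (T'', if [pick c' | T'' c' == Tg.1 c] is Some c' then hook_update c' Tg.2
        else Tg.2).

Lemma gv_bound g x y : gv g x y < (sumn la).+1.
Proof. by rewrite /gv; case: insubP => // *; exact: ltn_ord. Qed.

Lemma inl_i0 : 0 < i. Proof. by have := cell_inl c; rewrite /inl => /and3P[]. Qed.
Lemma inl_j0 : 0 < j. Proof. by have := cell_inl c; rewrite /inl => /and3P[]. Qed.

Lemma hook_update_step x e g (c' : cell la) : i <= x -> j <= e x.+1 ->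
  val c' = (x, e x.+1) -> hook_step p (clen la) i j x e (gv g) (gv (hook_update c' g)).
Proof.
move=> ix je Ec'; have i0 := inl_i0; have j0 := inl_j0.
have lx : inl p x (e x.+1) by have := cell_inl c'; rewrite Ec'.
have x0 : 0 < x by exact: leq_trans ix.
have xc : x <= clj j.
  rewrite -inl_clj //; apply: (inl_le part_mono lx) => //.
have lh h : 0 < h -> h <= x -> inl p h j.
  by move=> h0 hx; rewrite inl_clj //; exact: leq_trans xc.
split.
- move=> h /andP[ih hx]; have h0 := leq_trans i0 ih.
  have [a Ea] := inlP (lh h h0 (ltnW hx)); have := gv_cell (hook_update c' g) a.
  rewrite Ea ffunE Ea Ec' /= eqxx ih hx /= => ->.
  by rewrite inordK // gv_bound.
- have [a Ea] := inlP (lh x x0 (leqnn x)); have := gv_cell (hook_update c' g) a.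
  rewrite Ea ffunE Ea Ec' /= eqxx ltnn andbF eqxx /= => ->.
  rewrite inordK // ltnS.
  have cl0 : 0 < clj j by exact: leq_trans xc.
  have lc : inl p (clj j) j by rewrite inl_clj.
  apply: leq_trans (inl_hook la_pos lx lc xc).
  by rewrite leq_add2r leq_subr.
- move=> h w lhw off; have [a Ea] := inlP lhw.
  have := gv_cell (hook_update c' g) a; have := gv_cell g a.
  rewrite Ea ffunE Ea Ec' /= => -> ->.
  move: off; case: eqP => //= _ off.
  rewrite ifF; last by apply: contraNF off => /andP[-> /ltnW ->].
  by rewrite ifF //; apply: contraNF off => /eqP ->; rewrite ix leqnn.
Qed.

Lemma nps_pair_insertion T g : T \in tableaux la -> exists x e,
  [/\ (nps_pair (T, g)).1 \in tableaux la,
      insertion i j x e (T, g) (nps_pair (T, g))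
    & forall s, nps_insert (T c) (T, s) =
        ((nps_pair (T, g)).1, s + (x - i + (e x.+1 - j)))].
Proof.
move=> Tt; have lc : inl p i j := cell_inl c.
have i0 := inl_i0; have j0 := inl_j0.
have run0 := nps_run c 0 Tt; cbv zeta in run0.
have [T'' [x [e [T''t lx [fp fe sl] _ fx]]]] := run0.
exists x, e.
(* The algorithm starts from a running total [s] and [nps_pair] from 0; determinism of the path
   identifies the two runs. Rounds of the loop beyond the last exchange change nothing. *)
have ins s : nps_insert (T c) (T, s) = (T'', s + (x - i + (e x.+1 - j))).
  have runs := nps_run c s Tt; cbv zeta in runs.
  have [T2 [x2 [e2 [_ _ [fp2 fe2 sl2] it2 fx2]]]] := runs.
  have [Ex ee] := fpath_uniq fp fe fp2 fe2; subst x2.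
  have [ix _ _ _ _] := fp.
  have ET : T2 = T''.
    apply: tv_ext => // a b _; symmetry.
    exact: (slide_det sl sl2 ix ee).
  rewrite -ee ?leqnn ?(leqW ix) // in it2; rewrite ET in it2 fx2.
  have le : x - i + (e x.+1 - j) <= #|{: cell la}|.
    rewrite card_cell; have := inl_addn la_pos lx; clear -i0 j0 ix; lia.
  rewrite /nps_insert -(subnK le) iterD it2.
  by elim: (_ - _) => //= k ->.
have T''E : (nps_pair (T, g)).1 = T'' by rewrite /nps_pair /= ins.
rewrite T''E; split => //.
have [c' Ec'] := inlP lx.
have T''c' : T'' c' = T c.
  apply: val_inj; rewrite /= -!tv_cell Ec' /=; have [_ _ s3 _] := sl.
  by rewrite s3.
split; rewrite ?T''E //=.
rewrite /nps_pair /= ins /= -T''c' pick_entry //.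
have [ix _ _ _ _] := fp.
apply: hook_update_step => //.
by apply: (fpath_ge fp); rewrite ?(leqW ix).
Qed.

Lemma insertion_det x1 x2 e1 e2 T g P1 P2 : insertion i j x1 e1 (T, g) P1 ->
  insertion i j x2 e2 (T, g) P2 -> P1 = P2.
Proof.
move: P1 P2 => [T1 g1] [T2 g2] [/= fp1 fe1 s1 l1 [h11 h12 h13]].
move=> [/= fp2 fe2 s2 l2 [h21 h22 h23]].
have [E ee] := fpath_uniq fp1 fe1 fp2 fe2; subst x2.
have [ix _ _ _ _] := fp1.
congr (_, _).
  by apply: tv_ext => // a b _; exact: (slide_det s1 s2 ix ee).
apply: gv_ext => // a b lab.
have [on|off] := boolP ((b == j) && (i <= a <= x1)); last by rewrite h13 // h23.
move: on => /and3P[/eqP -> ia]; rewrite leq_eqVlt => /predU1P[->|lt].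
  by rewrite h12 h22 ee // leqnn (leqW ix).
by rewrite h11 ?h21 // ia lt.
Qed.

End StepFunction.

(** Formulated with predicates, because the invariant [sorted_upto] is a proposition. *)
Definition bij_on (X Y : Type) (A : X -> Prop) (B : Y -> Prop) (f : X -> Y) :=
  [/\ forall a, A a -> B (f a), forall a a', A a -> A a' -> f a = f a' -> a = a'
    & forall b, B b -> exists2 a, A a & f a = b].

Lemma bij_on_comp (X Y Z : Type) (A : X -> Prop) (B : Y -> Prop) (C : Z -> Prop) f h :
  bij_on A B f -> bij_on B C h -> bij_on A C (h \o f).
Proof.
move=> [f1 f2 f3] [h1 h2 h3]; split => [a Aa|a a' Aa Aa' /=|z Cz].
- by apply/h1/f1.
- by move/h2 => E; apply: f2 => //; apply: E; apply: f1.
- have [b Bb <-] := h3 _ Cz; have [a Aa <-] := f3 _ Bb.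
  by exists a.
Qed.

Lemma nps_pair_bij (c : cell la) :
  bij_on (sorted_upto (val c).1.+1 (val c).2) (sorted_upto (val c).1 (val c).2)
    (nps_pair c).
Proof.
have lc := cell_inl c; split.
- move=> [T g] ok; have [Tt _ _ _] := ok.
  have [x [e [T''t ins _]]] := nps_pair_insertion c g Tt.
  move: T''t ins; case: (nps_pair _ _) => T'' g'' /= T''t ins.
  exact: (insertion_sorted lc T''t ok ins).
- move=> [T1 g1] [T2 g2] ok1 ok2 E; have [T1t _ _ _] := ok1; have [T2t _ _ _] := ok2.
  have [x1 [e1 [_ ins1 _]]] := nps_pair_insertion c g1 T1t.
  have [x2 [e2 [_ ins2 _]]] := nps_pair_insertion c g2 T2t.
  rewrite -E in ins2; move: ins1 ins2; case: (nps_pair _ _) => T'' g''.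
  exact: (insertion_inj lc ok1 ok2).
- move=> [T'' g''] ok''.
  have [T [g [x [e [ok ins]]]]] := insertion_surj lc ok''.
  exists (T, g) => //; have [Tt _ _ _] := ok.
  have [x1 [e1 [_ ins1 _]]] := nps_pair_insertion c g Tt.
  exact: (insertion_det ins1 ins).
Qed.

(** * All insertions, column by column *)

Fixpoint column_cells (j i : nat) : seq (nat * nat) :=
  if i is i'.+1 then (i'.+1, j) :: column_cells j i' else [::].

Fixpoint cells_by_column (m : nat) : seq (nat * nat) :=
  if m is m'.+1 then column_cells m'.+1 (clj m'.+1) ++ cells_by_column m' else [::].

Lemma mem_column_cells j i a b :
  ((a, b) \in column_cells j i) = [&& b == j, 0 < a & a <= i].
Proof.
elim: i => [|i IH] /=; first by rewrite in_nil; lia.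
rewrite inE IH xpair_eqE; case: (b == j) => /=; rewrite ?andbF ?andbT //; clear; lia.
Qed.

Lemma mem_cells_by_column m a b :
  ((a, b) \in cells_by_column m) = [&& 0 < b, b <= m, 0 < a & a <= clj b].
Proof.
elim: m => [|m IH] /=; first by rewrite in_nil; lia.
rewrite mem_cat IH mem_column_cells.
by have [->|ne] := eqVneq b m.+1; lia.
Qed.

Let decr : rel (nat * nat) := fun c d => cell_le d c.

Let decr_trans : transitive decr.
Proof. by move=> [a b] [c d] [e f]; rewrite /decr /cell_le /=; lia. Qed.

Let decr_anti : antisymmetric decr.
Proof.
by move=> [a b] [c d]; rewrite /decr /cell_le /= => h; congr (_, _); lia.
Qed.

Let decr_total : total decr.
Proof. by move=> [a b] [c d]; rewrite /decr /cell_le /=; lia. Qed.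

Lemma column_cells_sorted j i : sorted decr (column_cells j i).
Proof.
case: i => //= i; elim: i => //= i IH.
by rewrite IH andbT /decr /cell_le /=; lia.
Qed.

Lemma cells_by_column_sorted m : sorted decr (cells_by_column m).
Proof.
elim: m => //= m IH.
rewrite (sorted_pairwise decr_trans) pairwise_cat.
rewrite -!(sorted_pairwise decr_trans) column_cells_sorted IH !andbT.
apply/allrelP => -[a b] [c d]; rewrite mem_column_cells mem_cells_by_column.
by rewrite /decr /cell_le /=; lia.
Qed.

Lemma column_cells_uniq j i : uniq (column_cells j i).
Proof. by elim: i => //= i ->; rewrite andbT mem_column_cells; lia. Qed.

Lemma cells_by_column_uniq m : uniq (cells_by_column m).
Proof.
elim: m => //= m IH; rewrite cat_uniq column_cells_uniq IH andbT /=.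
apply/hasPn => -[a b]; rewrite /= mem_column_cells mem_cells_by_column; lia.
Qed.

Lemma map_val_cells : map val (cells_decreasing la) = cells_by_column (p 1).
Proof.
apply: (sorted_eq decr_trans decr_anti); last 2 first.
- exact: cells_by_column_sorted.
- apply: uniq_perm; last 2 first.
  + exact: cells_by_column_uniq.
  + move=> [a b]; rewrite mem_cells_by_column; apply/mapP/idP.
      move=> [c _ E]; have := cell_inl c; rewrite -E /= => lab.
      have [a0 b0] : 0 < a /\ 0 < b by move: lab; rewrite /inl; clear; lia.
      have l1 := inl_le part_mono lab (leqnn 1) a0 b0 (leqnn b).
      rewrite inl_clj // in lab; move: l1; rewrite /inl; clear -lab a0; lia.
    move=> h; have lab : inl p a b by rewrite inl_clj; clear -h; lia.
    have [c Ec] := inlP lab; exists c => //.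
    by rewrite mem_sort mem_enum.
  + by rewrite (map_inj_uniq val_inj) sort_uniq enum_uniq.
- rewrite sorted_map; apply: sort_sorted => c d /=.
  exact: decr_total.
Qed.

Definition coord_pair (Tg : filling la * filling la) (d : nat * nat) :=
  if (insub d : option (cell la)) is Some c then nps_pair c Tg else Tg.

Definition nps_pairs (s : seq (nat * nat)) (Tg : filling la * filling la) :=
  foldl coord_pair Tg s.

Lemma coord_pairE (c : cell la) Tg : coord_pair Tg (val c) = nps_pair c Tg.
Proof. by rewrite /coord_pair valK. Qed.

Lemma column_bij j i : 0 < j -> i <= clj j ->
  bij_on (sorted_upto i.+1 j) (sorted_upto 1 j) (nps_pairs (column_cells j i)).
Proof.
move=> j0; elim: i => [|i IH] ic.
  by split=> //= b ok; exists b.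
have lij : inl p i.+1 j by rewrite inl_clj.
have [c Ec] := inlP lij.
have := nps_pair_bij c; rewrite Ec /= => b1.
have E : coord_pair ^~ (i.+1, j) =1 nps_pair c by move=> P; rewrite -Ec coord_pairE.
have [h1 h2 h3] := bij_on_comp b1 (IH (ltnW ic)).
split=> [a Aa|a a' Aa Aa'|b Bb] /=.
- by rewrite /nps_pairs /= E; exact: h1.
- by rewrite /nps_pairs /= !E; exact: h2.
- by have [a Aa <-] := h3 b Bb; exists a => //; rewrite /nps_pairs /= E.
Qed.

(** With the root in row 1 a way back never leaves the diagram upwards, since row 0 holds zeros and
    the left neighbour wins. So candidates are automatically good once a column is complete. *)
Lemma good_top j T x w : T \in tableaux la -> 0 < j -> 0 < x -> j <= w ->
  good 1 j (tv T) x w.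
Proof.
move=> /tv_tab [t0 inn out] j0; have [m] := ubnP (x + w).
elim: m x w => // m IH x w hm x0 jw.
have [->|wj] := eqVneq w j; first exact: good_col.
have Ew : w.-1.+1 = w by lia.
have Ex : x.-1.+1 = x by lia.
have [lt|le] := ltnP (tv T x.-1 w) (tv T x w.-1).
  by rewrite -Ew; apply: good_left; [lia|apply: IH; lia|rewrite Ew].
have x1 : 0 < x.-1.
  rewrite lt0n; apply/eqP => E; rewrite E t0 leqn0 in le.
  have [l|nl] := boolP (inl p x w.-1); first by have := inn _ _ l; rewrite (eqP le).
  by rewrite out // in le; lia.
by rewrite -Ex; apply: good_up; rewrite ?Ex; [lia|apply: IH; lia|right].
Qed.

(** Both instances have the same processed cells; the condition on candidates is automatic in the
    first, by [good_top], and empty in the second. *)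
Lemma sorted_upto_next j P : 0 < j ->
  sorted_upto 1 j.+1 P <-> sorted_upto (clj j).+1 j P.
Proof.
move=> j0; have prE a b : inl p a b -> proc 1 j.+1 a b = proc (clj j).+1 j a b.
  move=> lab; have [a0 b0] : 0 < a /\ 0 < b by move: lab; rewrite /inl; clear; lia.
  rewrite /proc; have [E|ne] := eqVneq b j; last by clear -a0 ne; lia.
  by move: lab; rewrite inl_clj // E; clear; lia.
split=> -[Tt o hk cg]; split => //.
- by move=> a b lab; rewrite -prE //; exact: o.
- by move=> a b lab; rewrite -prE //; exact: hk.
- by move=> h; clear; lia.
- by move=> a b lab; rewrite prE //; exact: o.
- by move=> a b lab; rewrite prE //; exact: hk.
- move=> h /andP[h0 _] ch; apply: good_top => //.
  by move: ch; rewrite /cand /cand_col; clear; lia.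
Qed.

Lemma bij_on_equiv (X : Type) (A A' B B' : X -> Prop) (f : X -> X) :
  (forall a, A a <-> A' a) -> (forall b, B b <-> B' b) ->
  bij_on A B f -> bij_on A' B' f.
Proof.
move=> AA BB [f1 f2 f3]; split=> [a /AA/f1/BB//|a a' /AA Aa /AA Aa'|b /BB/f3[a /AA]].
  exact: f2.
by exists a.
Qed.

Lemma cells_by_column_bij m : 0 < m ->
  bij_on (sorted_upto (clj m).+1 m) (sorted_upto 1 1)
    (nps_pairs (cells_by_column m)).
Proof.
elim: m => // m IH _; have c1 := column_bij (ltn0Sn m) (leqnn _).
have E : nps_pairs (cells_by_column m.+1) =1
    nps_pairs (cells_by_column m) \o nps_pairs (column_cells m.+1 (clj m.+1)).
  by move=> P; rewrite /nps_pairs /= foldl_cat.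
have c2 : bij_on (sorted_upto (clj m.+1).+1 m.+1) (sorted_upto 1 1)
    (nps_pairs (cells_by_column m) \o nps_pairs (column_cells m.+1 (clj m.+1))).
  have [m0|m0] := posnP m; first by move: c1; rewrite m0.
  exact: (bij_on_comp (bij_on_equiv (fun=> iff_refl _)
    (fun P => sorted_upto_next P m0) c1) (IH m0)).
have [h1 h2 h3] := c2; split=> [a Aa|a a' Aa Aa'|b Bb].
- by rewrite E; exact: h1.
- by rewrite !E; exact: h2.
- by have [a Aa <-] := h3 b Bb; exists a => //; rewrite E.
Qed.

(* [clj j - h] is the leg length, so that the terms are absolute hook values. *)
Definition column_dist i j g : nat :=
  \sum_(i <= h < (clj j).+1) absdiff (gv g h j) (clj j - h).

Definition potential i j M g : nat :=
  column_dist i j g + \sum_(j.+1 <= w < M.+1) column_dist 1 w g.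

Definition nps_fold T0 (s : seq (nat * nat)) (st : filling la * nat) :=
  foldl (fun st d => if (insub d : option (cell la)) is Some c
                     then nps_insert (T0 c) st else st) st s.

Lemma potential_step i j M x e T g P : inl p i j -> insertion i j x e (T, g) P ->
  potential i j M P.2 <= potential i.+1 j M g + (x - i + (e x.+1 - j)).
Proof.
move=> lij; have i0 : 0 < i by move: lij; rewrite /inl => /and3P[].
have j0 : 0 < j by move: lij; rewrite /inl => /and3P[].
case: P => T'' g'' [/= fp _ _ lx [g1 g2 g3]]; have [ix _ _ _ _] := fp.
have jx := fpath_ge fp (leqW ix) (leqnn _).
rewrite /potential addnAC; apply: leq_add.
  have xc : x <= clj j.
    have x0 : 0 < x by exact: leq_trans ix.
    by rewrite -inl_clj //; exact: (inl_le part_mono lx).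
  apply: column_dist_shift => //; first by rewrite ix.
  move=> h /andP[xh hc]; apply: g3; last by rewrite eqxx /= negb_and -!ltnNge xh orbT.
  by rewrite inl_clj //; exact: leq_ltn_trans xh.
apply: eq_leq; apply: eq_big_nat => w /andP[jw _].
apply: eq_big_nat => h /andP[h0 hc]; congr absdiff; apply: g3.
  by rewrite inl_clj //; exact: leq_ltn_trans jw.
by rewrite gtn_eqF.
Qed.

Lemma proc_cellS (c d : cell la) :
  ~~ proc (val c).1 (val c).2 (val d).1 (val d).2 ->
  ~~ proc (val c).1.+1 (val c).2 (val d).1 (val d).2.
Proof. by rewrite /proc; clear; lia. Qed.

(** The algorithm inserts entries of the initial tableau [T0], whereas [nps_pair] reads the current
    one. They agree because unprocessed cells still hold their initial entries, which is carried
    along. *)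
Lemma column_count T0 j i M T g k : 0 < j -> i <= clj j ->
  sorted_upto i.+1 j (T, g) ->
  (forall c : cell la, ~~ proc i.+1 j (val c).1 (val c).2 -> T c = T0 c) ->
  let P := nps_pairs (column_cells j i) (T, g) in
  exists k', [/\ nps_fold T0 (column_cells j i) (T, k) = (P.1, k'),
    potential 1 j M P.2 + k <= k' + potential i.+1 j M g
    & forall c : cell la, ~~ proc 1 j (val c).1 (val c).2 -> P.1 c = T0 c].
Proof.
move=> j0; elim: i T g k => [|i IH] T g k ic ok TT0 /=.
  by exists k; split => //; rewrite addnC.
have lij : inl p i.+1 j by rewrite inl_clj.
have [c Ec] := inlP lij; have [Tt _ _ _] := ok.
rewrite /nps_pairs /nps_fold /= -Ec coord_pairE valK.
have [x [e [T''t]]] := nps_pair_insertion c g Tt.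
have [Ec1 Ec2] : (val c).1 = i.+1 /\ (val c).2 = j by rewrite Ec.
rewrite Ec1 Ec2 => ins insE.
have Tc : T c = T0 c by apply: TT0; rewrite Ec /proc /= ltnn eqxx ltnn.
have ok'' : sorted_upto i.+1 j (nps_pair c (T, g)).
  by have [h1 _ _] := nps_pair_bij c; move: h1; rewrite Ec /=; apply.
rewrite -Tc insE.
have pot := potential_step M lij ins.
have unch : forall d : cell la, ~~ proc i.+1 j (val d).1 (val d).2 ->
    (nps_pair c (T, g)).1 d = T0 d.
  move=> d nd; rewrite -TT0; last first.
    by have := @proc_cellS c d; rewrite Ec /=; apply.
  apply: val_inj; rewrite /= -!tv_cell; have [fp _ [_ _ _ s4] _ _] := ins.
  apply: s4; apply: contra nd => on.
  have [[-> ->]|ne] := eqVneq ((val d).1, (val d).2) (i.+1, j).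
    by rewrite /proc eqxx leqnn orbT.
  have := onpath_proc (ltn0Sn i) j0 lij fp on ne; rewrite /proc => /orP[->//|/andP[-> /ltnW ->]].
  by rewrite orbT.
move: pot unch ok''; case: (nps_pair c (T, g)) insE => T'' g'' /= insE pot unch ok''.
have [k' [E1 E2 E3]] := IH T'' g'' (k + (x - i.+1 + (e x.+1 - j))) (ltnW ic) ok'' unch.
rewrite /nps_pairs in E1 E2 E3.
exists k'; split => //; move: E2 pot.
move: (potential 1 _ _ _) (potential i.+1 _ _ _) (potential i.+2 _ _ _) => a b d.
by clear; lia.
Qed.

Lemma column_dist_end j g : column_dist (clj j).+1 j g = 0.
Proof. by rewrite /column_dist big_geq. Qed.

Lemma cells_count T0 m M T g k : m <= M ->
  (0 < m -> sorted_upto (clj m).+1 m (T, g)) ->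
  (0 < m -> forall c : cell la, ~~ proc (clj m).+1 m (val c).1 (val c).2 ->
    T c = T0 c) ->
  let P := nps_pairs (cells_by_column m) (T, g) in
  exists k', nps_fold T0 (cells_by_column m) (T, k) = (P.1, k') /\
    \sum_(1 <= w < M.+1) column_dist 1 w P.2 + k <= k' + potential (clj m).+1 m M g.
Proof.
elim: m T g k => [|m IH] T g k mM ok TT0 /=.
  by exists k; split => //; rewrite /potential column_dist_end addnC.
rewrite /nps_pairs /nps_fold !foldl_cat.
have [k1 [E1 pot1 un1]] :=
  column_count M k (ltn0Sn m) (leqnn (clj m.+1)) (ok isT) (TT0 isT).
rewrite -/(nps_pairs (column_cells m.+1 (clj m.+1)) (T, g)) in E1 pot1 un1 *.
rewrite -/(nps_fold T0 (column_cells m.+1 (clj m.+1)) (T, k)) E1.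
have ok1 : sorted_upto 1 m.+1 (nps_pairs (column_cells m.+1 (clj m.+1)) (T, g)).
  by have [h _ _] := column_bij (ltn0Sn m) (leqnn (clj m.+1)); apply: h; exact: ok.
move: ok1 pot1 un1; case: (nps_pairs _ (T, g)) => T1 g1 /= ok1 pot1 un1.
have [||k2 [E2 pot2]] := IH T1 g1 k1 (ltnW mM).
- by move=> m0; apply/sorted_upto_next.
- move=> m0 c nc; apply: un1; apply: contra nc; rewrite /proc.
  have lc := cell_inl c; have [c1 c2] : 0 < (val c).1 /\ 0 < (val c).2.
    by move: lc; rewrite /inl => /and3P[].
  rewrite inl_clj // in lc.
  case: (eqVneq (val c).2 m.+1) => [->|_]; first by rewrite ltnSn.
  by rewrite /= orbF => /ltnW ->.
exists k2; split => //.
have EP : potential (clj m).+1 m M g1 = potential 1 m.+1 M g1.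
  by rewrite /potential column_dist_end big_ltn ?ltnS.
rewrite EP in pot2; move: pot1 pot2; rewrite /nps_pairs.
move: (potential 1 _ _ _) (potential (clj m.+1).+1 _ _ _) (\sum_(_ <= _ < _) _) => a b d.
by clear; lia.
Qed.

(** * Initial and final states, and the average *)

Definition zero_hooks : filling la := [ffun=> ord0].

Lemma gv_zero x y : gv zero_hooks x y = 0.
Proof. by rewrite /gv; case: insubP => // c _ _; rewrite ffunE. Qed.

Lemma proc_start x y : inl p x y -> proc (clj (p 1)).+1 (p 1) x y = false.
Proof.
move=> l; have [x0 y0] : 0 < x /\ 0 < y by move: l; rewrite /inl => /and3P[].
have /and3P[_ _ yp] := inl_le part_mono l (leqnn 1) x0 y0 (leqnn y).
move: l; rewrite inl_clj // /proc => xc; rewrite ltnNge yp /=.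
by case: eqP => //= <-; rewrite ltnNge xc.
Qed.

Lemma sorted_upto_start T g : sorted_upto (clj (p 1)).+1 (p 1) (T, g) <->
  T \in tableaux la /\ g = zero_hooks.
Proof.
split=> [[/= Tt _ hk _]|[Tt ->]].
  split=> //; apply: gv_ext => // a b lab; rewrite gv_zero.
  by have := hk _ _ lab; rewrite proc_start // => /eqP.
split=> //= [a b lab|a b lab|h]; rewrite ?proc_start ?gv_zero //.
by move=> /andP[lt]; rewrite leqNgt lt.
Qed.

Definition leg_len (c : cell la) : nat := clj (val c).2 - (val c).1.
Definition arm_len (c : cell la) : nat := p (val c).1 - (val c).2.

Definition standard_tableaux : {set filling la} :=
  [set T in tableaux la | `[< ord p 1 1 (tv T) >]]%SET.

Definition hook_functions : {set filling la} :=
  [set g : filling la | [forall c : cell la, g c <= arm_len c + leg_len c]]%SET.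

Lemma sorted_upto_end T g : sorted_upto 1 1 (T, g) <->
  T \in standard_tableaux /\ g \in hook_functions.
Proof.
have hkE : hook_cond p (clen la) 1 1 (gv g) <-> g \in hook_functions.
  rewrite inE; split=> [hk|/forallP hk x y l].
    apply/forallP => c; have lc := cell_inl c.
    have := hk _ _ lc; rewrite gv_cell /arm_len /leg_len.
    have [c1 c2] : 0 < (val c).1 /\ 0 < (val c).2 by move: lc; rewrite /inl => /and3P[].
    have pc : proc 1 1 (val c).1 (val c).2 by rewrite /proc; move: c1 c2; clear; lia.
    rewrite pc; have := lc; rewrite inl_clj //; move: lc => /and3P[_ _].
    by clear; lia.
  have [x0 y0] : 0 < x /\ 0 < y by move: l; rewrite /inl => /and3P[].
  have -> : proc 1 1 x y by rewrite /proc; move: x0 y0; clear; lia.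
  have [c Ec] := inlP l; have := hk c; have := gv_cell g c.
  rewrite /arm_len /leg_len Ec /= => ->; move: (l); rewrite inl_clj //.
  by move: l => /and3P[_ _]; clear; lia.
split=> [[/= Tt o hk _]|[+ gh]].
  by split; [rewrite inE Tt; apply/asboolP|apply/hkE].
rewrite inE => /andP[Tt /asboolP o]; split => //=; first exact/hkE.
move=> h /andP[h0 _] ch; apply: good_top => //.
by move: ch; rewrite /cand /cand_col; clear; lia.
Qed.

Definition hook_dist (g : filling la) : nat := \sum_c absdiff (g c) (leg_len c).

Lemma cells_sum (F : nat * nat -> nat) :
  \sum_(c : cell la) F (val c) = \sum_(1 <= w < (p 1).+1) \sum_(1 <= h < (clj w).+1) F (h, w).
Proof.
have cellsE : perm_eq (enum {: cell la}) (cells_decreasing la).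
  by rewrite perm_sym /cells_decreasing perm_sort.
rewrite -big_enum (perm_big _ cellsE) /=.
rewrite -[LHS](big_map val xpredT F) map_val_cells.
elim: (p 1) => [|m IH] /=; first by rewrite big_nil big_geq.
rewrite big_cat IH [RHS]big_nat_recr //= addnC; congr addn.
elim: (clj m.+1) => [|h IHh] /=; first by rewrite big_nil big_geq.
by rewrite big_cons IHh [RHS]big_nat_recr //= addnC.
Qed.

Lemma nps_exchanges_ge T : T \in tableaux la -> 0 < p 1 ->
  hook_dist (nps_pairs (cells_by_column (p 1)) (T, zero_hooks)).2 <=
  nps_exchanges T.
Proof.
move=> Tt p1.
have ok : sorted_upto (clj (p 1)).+1 (p 1) (T, zero_hooks) by apply/sorted_upto_start.
have [k' [E pot]] := cells_count 0 (leqnn (p 1)) (fun=> ok) (fun _ (c : cell la) _ => erefl (T c)).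
have -> : nps_exchanges T = k'.
  have -> : k' = (nps_fold T (cells_by_column (p 1)) (T, 0)).2 by rewrite E.
  rewrite /nps_exchanges /nps_fold -map_val_cells; congr (_.2).
  by elim: (cells_decreasing la) (T, 0) => //= c s IH st; rewrite valK.
move: pot; rewrite addn0 /potential column_dist_end (big_geq (m := (p 1).+1)) //.
rewrite !addn0; apply: leq_trans; rewrite /hook_dist.
set P := nps_pairs _ _; apply: eq_leq.
under eq_bigr do rewrite -gv_cell /leg_len.
exact: (cells_sum (fun d => absdiff (gv P.2 d.1 d.2) (clj d.2 - d.1))).
Qed.

Lemma nps_bijection : 0 < p 1 ->
  {in tableaux la &, injective (fun T => nps_pairs (cells_by_column (p 1)) (T, zero_hooks))} /\
  [set nps_pairs (cells_by_column (p 1)) (T, zero_hooks) | T in tableaux la]%SET =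
  finset.setX standard_tableaux hook_functions.
Proof.
move=> p1; have [h1 h2 h3] := cells_by_column_bij p1.
split=> [T1 T2 t1 t2 /h2 E|].
  by have [] : (T1, zero_hooks) = (T2, zero_hooks) by apply: E; apply/sorted_upto_start.
apply/setP => -[T g]; rewrite finset.in_setX; apply/imsetP/andP.
  move=> [T0 T0t E]; apply/sorted_upto_end; rewrite E.
  by apply: h1; apply/sorted_upto_start.
move=> /sorted_upto_end /h3[[T0 g0] /sorted_upto_start[T0t ->] <-].
by exists T0.
Qed.

(** The hook length formula, the number of hook functions being the product of the hook lengths. *)
Lemma card_tableaux : 0 < p 1 ->
  #|tableaux la| = #|standard_tableaux| * #|hook_functions|.
Proof.
move=> p1; have [inj im] := nps_bijection p1.
by rewrite -(card_in_imset inj) im cardsX.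
Qed.

Lemma sum_exchanges_ge : 0 < p 1 ->
  #|standard_tableaux| * \sum_(g in hook_functions) hook_dist g <=
  \sum_(T in tableaux la) nps_exchanges T.
Proof.
move=> p1; have [inj im] := nps_bijection p1.
apply: leq_trans (_ : \sum_(T in tableaux la)
    hook_dist (nps_pairs (cells_by_column (p 1)) (T, zero_hooks)).2 <= _); last first.
  by apply: leq_sum => T Tt; exact: nps_exchanges_ge.
rewrite -(big_imset (fun P => hook_dist P.2) inj) /= im.
rewrite (eq_bigl (fun P => (P.1 \in standard_tableaux) && (P.2 \in hook_functions))); last first.
  by move=> [a b]; rewrite finset.in_setX.
by rewrite -(pair_big (mem standard_tableaux) (mem hook_functions) (fun _ g => hook_dist g)) /= sum_nat_const.
Qed.

Lemma card_tableaux_fact : #|tableaux la| = (sumn la)`!.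
Proof.
have := card_inj_ffuns_on (cell la) (mem [set k : 'I_(sumn la).+1 | 0 < k]%SET).
rewrite card_cell.
have -> : #|[set k : 'I_(sumn la).+1 | 0 < k]%SET| = sumn la.
  rewrite (_ : finset _ = [set~ ord0]%SET) ?cardsC1 ?card_ord //.
  by apply/setP => k; rewrite !inE -val_eqE lt0n.
rewrite ffactnn => <-; apply: eq_card => T.
apply/tableauxP/idP => [[inj pos]|].
  rewrite inE; apply/andP; split; last exact/injectiveP.
  by apply/ffun_onP => c; rewrite inE.
rewrite inE => /andP[/ffun_onP on /injectiveP inj]; split => // c.
by have := on c; rewrite inE.
Qed.

(** A hook function is a free choice in each cell, so its value in [c] is uniform on [0..arm + leg];
    the equality of means is cross-multiplied to stay in [nat]. *)
Lemma hook_functions_sum (c : cell la) (F : nat -> nat) :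
  (arm_len c + leg_len c).+1 * \sum_(g in hook_functions) F (g c) =
  #|hook_functions| * \sum_(0 <= v < (arm_len c + leg_len c).+1) F v.
Proof.
pose Q (d : cell la) := [pred v : 'I_(sumn la).+1 | v <= arm_len d + leg_len d].
have hkE g : (g \in hook_functions) = (g \in family Q).
  rewrite inE; apply/forallP/familyP => h d; exact: h.
have bound d : arm_len d + leg_len d < (sumn la).+1.
  have ld := cell_inl d; rewrite ltnS /arm_len /leg_len.
  have [d1 d2] : 0 < (val d).1 /\ 0 < (val d).2 by move: ld; rewrite /inl => /and3P[].
  have l1 : inl p (val d).1 (p (val d).1).
    by move: ld; rewrite /inl => /and3P[-> _ le]; rewrite leqnn (leq_trans d2 le).
  have dc : (val d).1 <= clj (val d).2 by rewrite -inl_clj.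
  have l2 : inl p (clj (val d).2) (val d).2 by rewrite inl_clj // (leq_trans d1 dc).
  apply: leq_trans (inl_hook la_pos l1 l2 dc).
  by rewrite leq_add2r leq_subr.
have sumQ d (G : nat -> nat) : \sum_(v in Q d) G v =
    \sum_(0 <= v < (arm_len d + leg_len d).+1) G v.
  rewrite big_mkord (big_ord_widen _ G (bound d)) /=; apply: eq_bigl => v.
  by rewrite !inE ltnS.
pose Hk (d : cell la) := (arm_len d + leg_len d).+1.
have prodE (G : cell la -> nat -> nat) :
    \sum_(g in hook_functions) \prod_d G d (g d) = \prod_d \sum_(v in Q d) G d v.
  rewrite (bigA_distr_big_dep (fun d v => v \in Q d) (fun d (v : 'I_(sumn la).+1) => G d v)).
  exact: eq_bigl.
have cardE : #|hook_functions| = \prod_d Hk d.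
  rewrite -sum1_card; have := prodE (fun _ _ => 1).
  under eq_bigr do rewrite big1 //; move=> ->.
  by apply: eq_bigr => d _; rewrite (sumQ d (fun=> 1)) sum_nat_const_nat subn0 muln1.
have := prodE (fun d v => if d == c then F v else 1).
under eq_bigr => g _.
  rewrite (bigD1 c) //= eqxx big1 ?muln1; last by move=> d /negPf ->.
  over.
move=> ->; rewrite cardE (bigD1 c) //= eqxx [in RHS](bigD1 c) //=.
rewrite (sumQ c F) -/(Hk c) -!mulnA; congr muln; rewrite mulnC; congr muln.
apply: eq_bigr => d /negPf ne; rewrite ne.
by rewrite (sumQ d (fun=> 1)) sum_nat_const_nat subn0 muln1.
Qed.

Lemma nps_complexity_hook_ge (R : realType) : 0 < p 1 ->
  (\sum_(c : cell la) (arm_len c * (arm_len c).+1 + leg_len c * (leg_len c).+1)%:R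
     / (2 * (arm_len c + leg_len c).+1)%:R <= nps_complexity R la)%R.
Proof.
move=> p1; rewrite /nps_complexity -card_tableaux_fact card_tableaux //.
have : 0 < #|standard_tableaux| * #|hook_functions|.
  by rewrite -card_tableaux // card_tableaux_fact fact_gt0.
rewrite muln_gt0 => /andP[S0 H0].
set S := #|standard_tableaux| in S0 *; set H := #|hook_functions| in H0 *.
have le := sum_exchanges_ge p1.
apply: (@le_trans _ _ ((S * H)%:R^-1 * (S * \sum_(g in hook_functions) hook_dist g)%:R)%R);
  last by rewrite ler_wpM2l ?invr_ge0 // ler_nat.
rewrite !natrM invfM -mulrA mulrCA mulKf ?pnatr_eq0 -?lt0n //.
rewrite /hook_dist exchange_big /= natr_sum mulr_sumr ler_sum // => c _.
rewrite -sum_absdiff !natrM invfM.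
have E := hook_functions_sum c (fun v => absdiff v (leg_len c)).
have /(congr1 (fun n : nat => (n%:R : R)%R)) := E; rewrite !natrM => ER.
set X := (\sum_(g in hook_functions) absdiff (g c) (leg_len c))%N in ER *.
set Y := (\sum_(0 <= v < _) absdiff v _)%N in ER *.
have hc : ((arm_len c + leg_len c).+1%:R != 0 :> R)%R by rewrite pnatr_eq0.
have HH : (H%:R != 0 :> R)%R by rewrite pnatr_eq0 -lt0n.
rewrite mulrA [(_ * 2^-1)%R]mulrAC divff ?pnatr_eq0 // mul1r.
rewrite le_eqVlt; apply/orP; left; apply/eqP.
apply: (mulfI hc); rewrite mulrCA divff // mulr1 mulrCA ER.
by rewrite mulKf.
Qed.

Definition hook_kernel (R : realType) (A B : R) : R := (A + B ^+ 2 / A)%R.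

(** With [S = a + l] and [Q = a^2 + l^2], the claim for a cell is
    [Q / (2 S) <= (Q + S) / (2 (S + 1))], that is, [Q <= S^2]. For [S = 0] the kernel is 0, as
    division by 0 gives 0. *)
Lemma nps_complexity_kernel_ge (R : realType) : 0 < p 1 ->
  (\sum_(c : cell la)
     hook_kernel (arm_len c + leg_len c)%:R ((arm_len c)%:R - (leg_len c)%:R) / 4
   <= nps_complexity R la)%R.
Proof.
move=> p1; apply: le_trans (nps_complexity_hook_ge R p1).
apply: ler_sum => c _; rewrite /hook_kernel.
move: (arm_len c) (leg_len c) => a l.
have [E|al0] := posnP (a + l).
  by rewrite E invr0 mulr0 addr0 mul0r divr_ge0.
rewrite !natrM !natrD !natrM -[(a.+1%:R)%R]natr1 -[(l.+1%:R)%R]natr1 -[((a + l).+1%:R)%R]natr1 natrD.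
have a0 : (0 <= a%:R :> R)%R by [].
have l0 : (0 <= l%:R :> R)%R by [].
have : (0 < a%:R + l%:R :> R)%R by rewrite -natrD ltr0n.
move: (a%:R : R)%R (l%:R : R)%R a0 l0 => x y x0 y0 xy.
have -> : ((x + y + (x - y) ^+ 2 / (x + y)) / 4 = (x ^+ 2 + y ^+ 2) / (2 * (x + y)))%R.
  by field; lra.
rewrite ler_pdivrMr; last by lra.
rewrite mulrAC ler_pdivlMr; last by lra.
nra.
Qed.

End Fillings.

Import numFieldNormedType.Exports.
Local Open Scope ring_scope.
Local Open Scope classical_set_scope.

(** * From cells to Riemann sums *)

Section KernelEstimates.
Variable R : realType.
Implicit Types A B D e : R.

Definition lip1 (g : R -> R) := forall x y, `|g x - g y| <= `|x - y|.

Lemma hook_kernel_ge0 A B : 0 <= A -> 0 <= hook_kernel A B.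
Proof. by move=> A0; rewrite addr_ge0 // divr_ge0 // sqr_ge0. Qed.

Lemma hook_kernel_le A B : 0 <= A -> `|B| <= A -> hook_kernel A B <= 2 * A.
Proof.
move=> A0 /ler_normlP[B1 B2]; rewrite /hook_kernel.
have [->|nA] := eqVneq A 0; first by rewrite invr0 !mulr0 addr0.
have A1 : 0 < A by rewrite lt_neqAle eq_sym nA.
suff : B ^+ 2 / A <= A by lra.
rewrite ler_pdivrMr //; nra.
Qed.

Lemma hook_kernel_perturb A B D e : 0 < A -> `|B| <= A -> `|D| <= A ->
  `|B - D| <= e -> hook_kernel A D - 2 * e <= hook_kernel A B.
Proof.
move=> A0 /ler_normlP[B1 B2] /ler_normlP[D1 D2] /ler_normlP[e1 e2].
rewrite /hook_kernel -addrA lerD2l lerBlDr.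
have e0 : 0 <= e by lra.
rewrite ler_pdivrMr // mulrDl divfK ?gt_eqF //.
have [h1|h1] := leP 0 (B + D).
  have : 0 <= (e - (D - B)) * (B + D) by rewrite mulr_ge0 // subr_ge0; lra.
  have : 0 <= e * (2 * A - (B + D)) by rewrite mulr_ge0 //; lra.
  nra.
have : 0 <= (e - (B - D)) * - (B + D) by rewrite mulr_ge0 ?subr_ge0 //; lra.
have : 0 <= e * (2 * A + (B + D)) by rewrite mulr_ge0 //; lra.
nra.
Qed.

(** On [|B| <= A] the slope is at most 2 in [B] and at most 1 in [A]. The case split serves to
    change the variables in an order that keeps the intermediate pair in this region. *)
Lemma hook_kernel_lip A B A' B' e : 0 < A -> 0 < A' -> `|B| <= A -> `|B'| <= A' ->
  `|A - A'| <= e -> `|B - B'| <= e -> hook_kernel A' B' - 4 * e <= hook_kernel A B.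
Proof.
move=> A0 A0' hB hB' /ler_normlP[e1 e2] he.
have e0 : 0 <= e by lra.
have [le|lt] := leP A A'.
  (* Compare both kernels with the one of [(A', B)]. *)
  have k1 : hook_kernel A' B' - 2 * e <= hook_kernel A' B.
    by apply: hook_kernel_perturb => //; apply: le_trans le.
  have k2 : B ^+ 2 / A' <= B ^+ 2 / A.
    by rewrite ler_wpM2l ?sqr_ge0 // lef_pV2.
  by move: k1; rewrite /hook_kernel; lra.
have k1 : hook_kernel A B' - 2 * e <= hook_kernel A B.
  by apply: hook_kernel_perturb => //; apply: le_trans hB' _; exact: ltW.
suff : B' ^+ 2 / A' - B' ^+ 2 / A <= e by move: k1; rewrite /hook_kernel; lra.
have -> : B' ^+ 2 / A' - B' ^+ 2 / A = (B' ^+ 2 / A') * ((A - A') / A).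
  by field; rewrite !gt_eqF.
have q1 : (A - A') / A <= e / A by rewrite ler_pM2r ?invr_gt0.
have q2 : 0 <= B' ^+ 2 / A' <= A'.
  rewrite divr_ge0 ?sqr_ge0 ?(ltW A0') //= ler_pdivrMr //.
  by move: hB' => /ler_normlP[]; nra.
have q3 : 0 <= (A - A') / A by rewrite divr_ge0 ?(ltW A0) //; lra.
apply: le_trans (_ : A' * (e / A) <= _); last first.
  by rewrite mulrA ler_pdivrMr //; nra.
by case/andP: q2 => q2 q4; apply: ler_pM.
Qed.

(** For [x <= e] or [y <= e] the left side is not positive; so the bound allows for side lengths
    truncated at 0. *)
Lemma prod_pos_part_ge (x y e u v : R) : 0 <= x -> 0 <= y -> 0 <= e ->
  x - e <= u -> y - e <= v -> 0 <= u -> 0 <= v -> x * y - e * (x + y) <= u * v.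
Proof.
move=> x0 y0 e0 xu yv u0 v0.
have [xe|xe] := lerP x e.
  have : 0 <= (e - x) * y by rewrite mulr_ge0 // subr_ge0.
  by have := mulr_ge0 u0 v0; have := mulr_ge0 e0 x0; nra.
have [ye|ye] := lerP y e.
  have : 0 <= (e - y) * x by rewrite mulr_ge0 // subr_ge0.
  by have := mulr_ge0 u0 v0; have := mulr_ge0 e0 y0; nra.
have : (x - e) * (y - e) <= u * v by apply: ler_pM => //; lra.
by have := mulr_ge0 e0 e0; nra.
Qed.

Implicit Types (g : R -> R) (a d s t : R) (k l m : nat).

Definition grid (a d : R) (k : nat) : R := a + d * k%:R.
Definition col_incr (g : R -> R) (a d : R) (k : nat) : R :=
  (grid a d k.+1 - grid a d k) + (g (grid a d k.+1) - g (grid a d k)).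
Definition row_incr (g : R -> R) (a d : R) (l : nat) : R :=
  (grid a d l.+1 - grid a d l) - (g (grid a d l.+1) - g (grid a d l)).
Definition grid_kernel (g : R -> R) (a d : R) (k l : nat) : R :=
  hook_kernel (grid a d l - grid a d k) (g (grid a d l) - g (grid a d k)).
(** A Riemann sum against the measures of [x + g x] and [x - g x]. Diagonal blocks, where the kernel
    would have denominator 0, are left out. *)
Definition grid_sum (g : R -> R) (a d : R) (m : nat) : R :=
  \sum_(k < m) \sum_(l < m | (k < l)%N)
    grid_kernel g a d k l * (col_incr g a d k * row_incr g a d l).

Lemma grid_step a d k : grid a d k.+1 - grid a d k = d.
Proof. by rewrite /grid -natr1; ring. Qed.

Lemma grid_lt a d k l : 0 < d -> (k < l)%N -> grid a d k < grid a d l.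
Proof. by move=> d0 kl; rewrite ltrD2l ltr_pM2l // ltr_nat. Qed.

Lemma grid_le a d k l : 0 < d -> (k <= l)%N -> grid a d k <= grid a d l.
Proof. by move=> d0 kl; rewrite lerD2l ler_pM2l // ler_nat. Qed.

Lemma incr_bounds g a d k : lip1 g -> 0 < d ->
  0 <= col_incr g a d k <= 2 * d /\ 0 <= row_incr g a d k <= 2 * d.
Proof.
move=> lip d0; rewrite /col_incr /row_incr grid_step.
have := lip (grid a d k.+1) (grid a d k); rewrite grid_step (gtr0_norm d0).
by move=> /ler_normlP[h1 h2]; split; apply/andP; split; lra.
Qed.

Lemma lip_le g s t : lip1 g -> s <= t -> `|g t - g s| <= t - s.
Proof. by move=> lip st; have := lip t s; rewrite (ger0_norm (_ : 0 <= t - s)) // subr_ge0. Qed.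

Lemma sum_indicator a d m s : 0 < d ->
  \sum_(k < m) ((grid a d k <= s < grid a d k.+1)%R)%:R <= 1 :> R.
Proof.
move=> d0; have E k : ((grid a d k <= s < grid a d k.+1)%R)%:R =
    ((s < grid a d k.+1)%R)%:R - ((s < grid a d k)%R)%:R :> R.
  have := grid_lt a d0 (ltnSn k).
  by have [h1|h1] := lerP (grid a d k) s; have [h2|h2] := ltrP s (grid a d k.+1);
    rewrite /= ?subr0 ?subrr //; lra.
under eq_bigr do rewrite E.
rewrite -(big_mkord xpredT (fun k => ((s < grid a d k.+1)%R)%:R - ((s < grid a d k)%R)%:R)).
rewrite telescope_sumr //; case: (s < _); case: (s < _); rewrite /=; lra.
Qed.

Lemma sum_const_sqr (x : R) m : \sum_(k < m) \sum_(l < m) x = x * m%:R * m%:R.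
Proof. by rewrite !sumr_const !card_ord !mulr_natr. Qed.

Lemma cube_factor (x y z : R) : x * (8 * y ^+ 2 * z ^+ 3) = x * (8 * y ^+ 2 * z) * z * z.
Proof. ring. Qed.

End KernelEstimates.

(** * Boundary points of the diagram, arms and legs, counting of cells *)

Section Boundary.
Variables (R : realType) (la : seq nat).
Hypotheses (la_sorted : sorted geq la) (la_pos : 0%N \notin la).
Hypothesis n0 : (0 < sumn la)%N.

Implicit Types x y : R.

(** With [u = h (x + y)] and [v = h (y - x)], one has [u - v = 2 h x] and [u + v = 2 h y]. *)
Let h : R := Num.sqrt (sumn la)%:R / Num.sqrt 2.

Let h0 : 0 < h.
Proof. by rewrite divr_gt0 // sqrtr_gt0 // ltr0n. Qed.

Lemma absz_ceil (v : R) : 0 < v ->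
  let k := `|Num.ceil v|%N in (0 < k)%N /\ k%:R - 1 < v <= k%:R.
Proof.
move=> v0 k; have c0 : 0 < Num.ceil v by rewrite ceil_gt0.
have Ek : Num.ceil v = k%:Z by rewrite /k gtz0_abs.
split; first by rewrite -ltz_nat -Ek.
by have := ceil_itv v; rewrite Ek intrB.
Qed.

Lemma absz_ceil_nat (m : nat) : `|Num.ceil (m%:R : R)|%N = m.
Proof. by rewrite -[m%:R]/(m%:Z%:~R) intrKceil. Qed.

Lemma part_anti i k : (0 < i)%N -> (i <= k)%N -> (part la k <= part la i)%N.
Proof.
move=> i0; elim: k => [|k IH] ik; first by lia.
have [->//|ik'] : i = k.+1 \/ (i <= k)%N by lia.
by apply: leq_trans (IH ik'); apply: part_mono => //; lia.
Qed.

(* [h * (boundary la x - x)] is the v-coordinate of the boundary point above x. *)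
Definition bdry_row (x : R) : R := h * (boundary la x - x).
Definition bdry_col (x : R) : R := h * (boundary la x + x).

Lemma bdry_colE x : bdry_col x = bdry_row x + 2 * h * x.
Proof. by rewrite /bdry_col /bdry_row; ring. Qed.

Lemma scaled_diagramE x y : scaled_diagram la (x, y) <->
  let v := h * (y - x) in let u := v + 2 * h * x in
  (0 < v /\ 0 < u <= (part la `|Num.ceil v|%N)%:R) \/
  [/\ 0 <= u, 0 <= v & u * v = 0].
Proof.
rewrite /scaled_diagram /= -/h.
by have -> : h * (y - x) + 2 * h * x = h * (x + y) by ring.
Qed.

Lemma diagram_le_bound (c x y : R) : 0 <= c -> - (2 * h * x) <= c ->
  (forall v : R, c < v -> (part la `|Num.ceil v|%N)%:R < v + 2 * h * x) ->
  scaled_diagram la (x, y) -> h * (y - x) <= c.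
Proof.
move=> c0 zc H /scaled_diagramE /=; set v := h * (y - x).
case=> [[v0 /andP[_ le]]|[u0 v0 uv]].
  by rewrite leNgt; apply/negP => /H; lra.
by move: uv => /eqP; rewrite mulf_eq0 => /orP[] /eqP ?; lra.
Qed.

Lemma diagram_nonempty x : scaled_diagram la (x, `|x|).
Proof.
apply/scaled_diagramE => /=; right.
have [x0|x0] := ger0P x.
  by rewrite subrr !mulr0 add0r; split; rewrite ?mulr0 // !mulr_ge0 // ltW.
have -> : h * (- x - x) + 2 * h * x = 0 by ring.
rewrite mul0r; split => //; rewrite mulr_ge0 ?(ltW h0) //; lra.
Qed.

Let div_bound (c x y : R) : h * (y - x) <= c -> y <= x + c / h.
Proof. by move=> le; rewrite -lerBlDl ler_pdivlMr // mulrC. Qed.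

Lemma bdry_row_le (c x : R) : 0 <= c -> - (2 * h * x) <= c ->
  (forall v : R, c < v -> (part la `|Num.ceil v|%N)%:R < v + 2 * h * x) ->
  bdry_row x <= c.
Proof.
move=> c0 zc H.
suff : boundary la x <= x + c / h.
  by rewrite -lerBlDl ler_pdivlMr // mulrC.
apply: ge_sup; first by exists `|x|; exact: diagram_nonempty.
by move=> y /= /(diagram_le_bound c0 zc H) /div_bound.
Qed.

Lemma diagram_bounded x : has_ubound [set y | scaled_diagram la (x, y)].
Proof.
set z := 2 * h * x.
pose c : R := (part la 1)%:R + `|z|.
have nz := normr_ge0 z; have z1 := ler_norm z.
have z2 : - z <= `|z| by rewrite -normrN ler_norm.
have p0 : 0 <= (part la 1)%:R :> R by [].
exists (x + c / h) => y /= Dxy; apply: div_bound.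
apply: diagram_le_bound Dxy; rewrite -/z /c; try lra.
move=> v cv; have v0 : 0 < v by lra.
have [k0 _] := absz_ceil v0.
have : (part la `|Num.ceil v|%N)%:R <= (part la 1)%:R :> R by rewrite ler_nat part_anti.
lra.
Qed.

Lemma bdry_row_ge (v x : R) : let u := v + 2 * h * x in
  (0 < v /\ 0 < u <= (part la `|Num.ceil v|%N)%:R) \/
  [/\ 0 <= u, 0 <= v & u * v = 0] -> v <= bdry_row x.
Proof.
move=> u D; have E : h * (x + v / h - x) = v.
  by rewrite addrC addKr mulrC divfK // gt_eqF.
have : scaled_diagram la (x, x + v / h) by apply/scaled_diagramE; rewrite E.
move=> /(ub_le_sup (diagram_bounded x)); rewrite -/(boundary la x) => le.
by rewrite -E /bdry_row ler_pM2l // lerD2r.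
Qed.

(** The two half-axes belong to the scaled diagram, so the boundary is at least [|x|]. *)
Lemma bdry_row_axis x : 0 <= bdry_row x /\ - (2 * h * x) <= bdry_row x.
Proof.
have [x0|x0] := lerP 0 x.
  have hx : 0 <= h * x by rewrite mulr_ge0 // ltW.
  have le : 0 <= bdry_row x.
    by apply: bdry_row_ge; right; split; rewrite ?mulr0 //; lra.
  by split => //; lra.
have hx : 0 <= h * - x by rewrite mulr_ge0 ?oppr_ge0 // ltW.
have le : - (2 * h * x) <= bdry_row x.
  by apply: bdry_row_ge; right; split; rewrite ?addNr ?mul0r //; lra.
by split => //; lra.
Qed.

Lemma bdry_row_lt (m : nat) x :
  (part la m.+1)%:R - m.+1%:R < 2 * h * x -> bdry_row x <= m.+1%:R.
Proof.
move=> lt; have p0 : 0 <= (part la m.+1)%:R :> R by [].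
have m0 : 0 <= m.+1%:R :> R by [].
apply: bdry_row_le => //; first by lra.
move=> v mv; have v0 : 0 < v by lra.
have [k0 /andP[_ vk]] := absz_ceil v0.
have mk : (m.+1 <= `|Num.ceil v|)%N by rewrite -(ler_nat R); lra.
have : (part la `|Num.ceil v|%N)%:R <= (part la m.+1)%:R :> R by rewrite ler_nat part_anti.
lra.
Qed.

Lemma bdry_row_nat_ge (m : nat) x : (0 < m)%N ->
  2 * h * x <= (part la m)%:R - m%:R -> m%:R <= bdry_row x.
Proof.
move=> m0 le; have [zm|zm] := lerP (m%:R + 2 * h * x) 0.
  by have [_] := bdry_row_axis x; lra.
apply: bdry_row_ge; left; rewrite absz_ceil_nat ltr0n m0 zm; split => //=; lra.
Qed.

Lemma bdry_col_nat_ge (m : nat) x : (0 < m)%N ->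
  m%:R - (clen la m)%:R < 2 * h * x -> m%:R <= bdry_col x.
Proof.
move=> m0 lt; rewrite bdry_colE; have m0' : 0 < m%:R :> R by rewrite ltr0n.
have [zm|zm] := lerP (m%:R - 2 * h * x) 0.
  by have [] := bdry_row_axis x; lra.
rewrite -lerBlDr; apply: bdry_row_ge; left; split => //.
have [k0 /andP[k1 _]] := absz_ceil zm.
have -> : m%:R - 2 * h * x + 2 * h * x = m%:R by ring.
rewrite m0' ler_nat leq_part_clen //.
rewrite -ltnS -(ltr_nat R) -natr1; lra.
Qed.

Lemma bdry_col_gt (m : nat) x :
  2 * h * x <= m.+1%:R - (clen la m.+1)%:R -> bdry_col x <= m.+1%:R.
Proof.
move=> le; rewrite bdry_colE -lerBrDr.
have c0 : 0 <= (clen la m.+1)%:R :> R by [].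
have m0 : 0 <= m.+1%:R :> R by [].
apply: bdry_row_le; [lra|lra|] => v cv; have v0 : 0 < v by lra.
have [k0 /andP[_ vk]] := absz_ceil v0.
have : (clen la m.+1 < `|Num.ceil v|)%N by rewrite -(ltr_nat R); lra.
rewrite ltnNge -leq_part_clen // -ltnNge ltnS => pm.
have : (part la `|Num.ceil v|%N)%:R <= m%:R :> R by rewrite ler_nat.
have := @natr1 R m; lra.
Qed.

(** The boundary passes through [(u, v) = (part la i, i)], and by [bdry_col_eq] through
    [(j, clen la j)]. Thus arms and legs are read off the boundary without rounding. *)
Lemma bdry_row_eq (i : nat) x : (0 < i)%N -> (0 < part la i)%N ->
  2 * h * x = (part la i)%:R - i%:R -> bdry_row x = i%:R.
Proof.
move=> i0 pi0 E; apply/le_anti/andP; split; last by apply: bdry_row_nat_ge; rewrite // E.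
have p0 : 0 <= (part la i)%:R :> R by [].
have i0' : 0 <= i%:R :> R by [].
apply: bdry_row_le; [by []|lra|] => v iv; have v0 : 0 < v by lra.
have [k0 /andP[_ vk]] := absz_ceil v0.
have ik : (i <= `|Num.ceil v|)%N by rewrite -(ler_nat R); lra.
have : (part la `|Num.ceil v|%N)%:R <= (part la i)%:R :> R by rewrite ler_nat part_anti.
lra.
Qed.

Lemma bdry_col_eq (j : nat) x : (0 < j)%N -> (0 < clen la j)%N ->
  2 * h * x = j%:R - (clen la j)%:R -> bdry_col x = j%:R.
Proof.
move=> j0 cj0 E; have j0' : 0 < j%:R :> R by rewrite ltr0n.
have c0 : 0 < (clen la j)%:R :> R by rewrite ltr0n.
rewrite bdry_colE; suff -> : bdry_row x = (clen la j)%:R by lra.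
apply/le_anti/andP; split.
  apply: bdry_row_le; [lra|lra|] => v cv; have v0 : 0 < v by lra.
  have [k0 /andP[_ vk]] := absz_ceil v0.
  have : (clen la j < `|Num.ceil v|)%N by rewrite -(ltr_nat R); lra.
  rewrite ltnNge -leq_part_clen // -ltnNge => pm.
  have : (part la `|Num.ceil v|%N)%:R < j%:R :> R by rewrite ltr_nat.
  lra.
apply: bdry_row_ge; left; rewrite absz_ceil_nat; split => //.
have -> : (clen la j)%:R + 2 * h * x = j%:R by lra.
by rewrite j0' ler_nat leq_part_clen ?leqnn.
Qed.

Lemma down_closed_threshold (P : pred nat) :
  (forall i, (0 < i)%N -> P i.+1 -> P i) -> (exists m, ~~ P m.+1) ->
  exists U, forall j, (0 < j)%N -> (j <= U)%N = P j.
Proof.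
move=> dc ex; have [U nPU min] := ex_minnP ex.
have mono i k : (0 < i)%N -> (i <= k)%N -> P k -> P i.
  move=> i0; elim: k => [|k IH] ik; first by lia.
  have [->//|ik'] : i = k.+1 \/ (i <= k)%N by lia.
  by move=> /dc Pk; apply: IH => //; apply: Pk; lia.
exists U => j j0; apply/idP/idP => [jU|Pj].
  have [//|nPj] := boolP (P j).
  have Ej : j.-1.+1 = j by lia.
  by have := min j.-1; rewrite Ej => /(_ nPj); lia.
rewrite leqNgt; apply/negP => lt; move/negP: nPU; apply.
exact: mono lt Pj.
Qed.

Lemma clen_anti j k : (0 < j)%N -> (j <= k)%N -> (clen la k <= clen la j)%N.
Proof. by move=> j0 jk; apply: sub_count => l /=; exact: leq_trans. Qed.

Lemma col_threshold (z : R) : exists U : nat, forall j, (0 < j)%N ->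
  (j <= U)%N = (j%:R - (clen la j)%:R < z).
Proof.
apply: down_closed_threshold.
  move=> i i0; have : (clen la i.+1)%:R <= (clen la i)%:R :> R.
    by rewrite ler_nat clen_anti.
  by rewrite -natr1; lra.
exists (Num.truncn (`|z| + (clen la 1)%:R)); rewrite -leNgt.
set k := Num.truncn _; have : `|z| + (clen la 1)%:R < k.+1%:R.
  by apply: truncnS_gt.
have : (clen la k.+1)%:R <= (clen la 1)%:R :> R by rewrite ler_nat clen_anti.
by have := ler_norm z; lra.
Qed.

Lemma row_threshold (z : R) : exists V : nat, forall i, (0 < i)%N ->
  (i <= V)%N = (z <= (part la i)%:R - i%:R).
Proof.
apply: down_closed_threshold.
  move=> i i0; have : (part la i.+1)%:R <= (part la i)%:R :> R.
    by rewrite ler_nat part_anti.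
  by rewrite -natr1; lra.
exists (Num.truncn (`|z| + (part la 1)%:R)); rewrite -ltNge.
set k := Num.truncn _; have : `|z| + (part la 1)%:R < k.+1%:R.
  by apply: truncnS_gt.
have : (part la k.+1)%:R <= (part la 1)%:R :> R by rewrite ler_nat part_anti.
have : - z <= `|z| by rewrite -normrN ler_norm.
by lra.
Qed.

Lemma col_threshold_bdry (U : nat) (x : R) :
  (forall j, (0 < j)%N -> (j <= U)%N = (j%:R - (clen la j)%:R < 2 * h * x)) ->
  U%:R <= bdry_col x <= U%:R + 1.
Proof.
move=> UE; apply/andP; split.
  have [->|U0] := posnP U; first by rewrite bdry_colE; have [] := bdry_row_axis x; lra.
  by apply: bdry_col_nat_ge => //; rewrite -UE.
rewrite natr1; apply: bdry_col_gt.
by rewrite leNgt -UE // ltnn.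
Qed.

Lemma row_threshold_bdry (V : nat) (x : R) :
  (forall i, (0 < i)%N -> (i <= V)%N = (2 * h * x <= (part la i)%:R - i%:R)) ->
  V%:R <= bdry_row x <= V%:R + 1.
Proof.
move=> VE; apply/andP; split.
  have [->|V0] := posnP V; first by have [] := bdry_row_axis x.
  by apply: bdry_row_nat_ge => //; rewrite -VE.
rewrite natr1; apply: bdry_row_lt.
by rewrite ltNge -VE // ltnn.
Qed.

Lemma card_cells_ge (Q : pred (cell la)) (U1 U2 V3 V4 : nat) :
  (forall i j, (U1 < j <= U2)%N -> (V4 < i <= V3)%N -> inl (part la) i j) ->
  (forall c : cell la, (U1 < (val c).2 <= U2)%N -> (V4 < (val c).1 <= V3)%N -> Q c) ->
  ((U2 - U1) * (V3 - V4) <= #|Q|)%N.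
Proof.
move=> inla QE.
have ok (u : 'I_(U2 - U1) * 'I_(V3 - V4)) :
    inl (part la) (V4 + u.2).+1 (U1 + u.1).+1.
  by apply: inla; have := ltn_ord u.1; have := ltn_ord u.2; lia.
pose f u : cell la := sval (inlP la_sorted la_pos (ok u)).
have fE u : val (f u) = ((V4 + u.2).+1, (U1 + u.1).+1).
  by rewrite /f; case: (inlP _ _).
have f_inj : injective f.
  move=> [a b] [a' b'] /(congr1 val); rewrite !fE /= => -[/eqP + /eqP].
  by rewrite !eqn_add2l => /eqP/val_inj -> /eqP/val_inj ->.
have := card_codom f_inj; rewrite card_prod !card_ord => <-.
apply: subset_leq_card; apply/fintype.subsetP => c /codomP[[a b] ->].
have := ltn_ord a; have := ltn_ord b; move=> hb ha; have E := fE (a, b).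
by apply: QE; rewrite E /=; clear -ha hb; lia.
Qed.

Definition col_pos (c : cell la) : R := ((val c).2%:R - (clen la (val c).2)%:R) / (2 * h).
Definition row_pos (c : cell la) : R := ((part la (val c).1)%:R - (val c).1%:R) / (2 * h).

(** These columns and rows span a full rectangle of cells: for [(i, j)] outside the diagram
    [part la i < j] and [clen la j < i], so the abscissa of the row is left of that of the column,
    against [x2 <= x3]. Each side loses at most 1 by rounding. *)
Lemma card_cells_between (x1 x2 x3 x4 : R) : x2 <= x3 ->
  let Q := [pred c : cell la | (x1 <= col_pos c < x2) && (x3 <= row_pos c < x4)] in
  forall du dv : R, 0 <= du -> 0 <= dv ->
  du <= bdry_col x2 - bdry_col x1 - 1 ->
  dv <= bdry_row x3 - bdry_row x4 - 1 -> du * dv <= #|Q|%:R.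
Proof.
move=> x23 Q du dv du0 dv0 duE dvE; have hh0 : 0 < 2 * h by rewrite mulr_gt0.
have [U1 U1E] := col_threshold (2 * h * x1); have [U2 U2E] := col_threshold (2 * h * x2).
have [V3 V3E] := row_threshold (2 * h * x3); have [V4 V4E] := row_threshold (2 * h * x4).
have := col_threshold_bdry U1E; have := col_threshold_bdry U2E.
have := row_threshold_bdry V3E; have := row_threshold_bdry V4E.
move=> /andP[a1 a2] /andP[a3 a4] /andP[a5 a6] /andP[a7 a8].
have hx23 : 2 * h * x2 <= 2 * h * x3 by rewrite ler_pM2l.
have := @card_cells_ge Q U1 U2 V3 V4.
have inla i j : (U1 < j <= U2)%N -> (V4 < i <= V3)%N -> inl (part la) i j.
  move=> /andP[j1 j2] /andP[i1 i2].
  have j0 : (0 < j)%N by exact: leq_ltn_trans j1.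
  have i0 : (0 < i)%N by exact: leq_ltn_trans i1.
  rewrite U2E // in j2; rewrite V3E // in i2.
  rewrite /inl i0 j0 /= leqNgt; apply/negP => lt.
  have lt2 : (clen la j < i)%N by rewrite ltnNge -leq_part_clen // -ltnNge.
  have : (part la i)%:R + 1 <= j%:R :> R by rewrite natr1 ler_nat.
  have : (clen la j)%:R + 1 <= i%:R :> R by rewrite natr1 ler_nat.
  lra.
move=> /(_ inla) le.
have leQ : ((U2 - U1) * (V3 - V4) <= #|Q|)%N.
  apply: le => c /andP[j1 j2] /andP[i1 i2]; rewrite /Q /=.
  have j0 : (0 < (val c).2)%N by exact: leq_ltn_trans j1.
  have i0 : (0 < (val c).1)%N by exact: leq_ltn_trans i1.
  rewrite ltnNge U1E // -leNgt in j1; rewrite U2E // in j2.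
  rewrite ltnNge V4E // -ltNge in i1; rewrite V3E // in i2.
  rewrite /col_pos /row_pos !ler_pdivlMr // !ltr_pdivrMr //.
  by rewrite ![_ * (2 * h)]mulrC j1 j2 i1 i2.
apply: le_trans (_ : ((U2 - U1) * (V3 - V4))%:R <= _); last by rewrite ler_nat.
have natB (m k : nat) (d : R) : 0 <= d -> d <= m%:R - k%:R -> d <= (m - k)%:R.
  move=> d0; have [km|mk] := leqP k m; first by rewrite natrB.
  by have : m%:R < k%:R :> R by [rewrite ltr_nat]; lra.
by rewrite natrM ler_pM //; apply: natB => //; lra.
Qed.

Implicit Types g : R -> R.

(** Arm plus leg and arm minus leg are the differences of [u - v] and of [u + v] between the
    boundary points [(part la i, i)] and [(j, clen la j)]. *)
Lemma cell_kernel (c : cell la) :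
  let A : R := (arm_len c + leg_len c)%:R in
  let B : R := (arm_len c)%:R - (leg_len c)%:R in
  let s := col_pos c in let t := row_pos c in
  [/\ A = 2 * h * (t - s), B = 2 * h * (boundary la t - boundary la s), `|B| <= A & 0 <= A].
Proof.
move=> A B s t; have hh0 : 0 < 2 * h by rewrite mulr_gt0.
have lc := cell_inl la_sorted la_pos c.
set i := (val c).1 in lc *; set j := (val c).2 in lc *.
have [i0 j0 jp] : [/\ (0 < i)%N, (0 < j)%N & (j <= part la i)%N].
  by move: lc; rewrite /inl => /and3P[].
have ic : (i <= clen la j)%N by rewrite -leq_part_clen.
have Et : 2 * h * t = (part la i)%:R - i%:R by rewrite /t /row_pos mulrC divfK // gt_eqF.
have Es : 2 * h * s = j%:R - (clen la j)%:R by rewrite /s /col_pos mulrC divfK // gt_eqF.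
have := bdry_row_eq i0 (leq_trans j0 jp) Et; rewrite /bdry_row => Ht.
have := bdry_col_eq j0 (leq_trans i0 ic) Es; rewrite /bdry_col => Hs.
have Ea : (arm_len c)%:R = (part la i)%:R - j%:R :> R by rewrite /arm_len natrB.
have El : (leg_len c)%:R = (clen la j)%:R - i%:R :> R by rewrite /leg_len natrB.
have a0 : 0 <= (arm_len c)%:R :> R by [].
have l0 : 0 <= (leg_len c)%:R :> R by [].
have EA : A = (arm_len c)%:R + (leg_len c)%:R by rewrite /A natrD.
split; rewrite ?EA.
- by rewrite mulrBr Et Es Ea El; ring.
- by rewrite /B Ea El; move: Ht Hs Et Es; lra.
- by apply/ler_normlP; rewrite /B; split; lra.
- by rewrite addr_ge0.
Qed.

(** Moving to the grid points changes [t - s] and [g t - g s] by at most [2 d] each, which costs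
    [8 d] by [hook_kernel_lip]; replacing the boundary by [g] changes the increment by [2 eps] and
    costs [4 eps]. *)
Lemma cell_kernel_ge (g : R -> R) (eps d a : R) (k l : nat) (c : cell la) :
  lip1 g -> (forall x, `|g x - boundary la x| <= eps) -> 0 < d -> (k < l)%N ->
  grid a d k <= col_pos c < grid a d k.+1 ->
  grid a d l <= row_pos c < grid a d l.+1 ->
  2 * h * (grid_kernel g a d k l - (8 * d + 4 * eps)) <=
  hook_kernel (arm_len c + leg_len c)%:R ((arm_len c)%:R - (leg_len c)%:R).
Proof.
move=> lip close d0 kl /andP[s1 s2] /andP[t1 t2].
have hh0 : 0 < 2 * h by rewrite mulr_gt0.
have [-> -> + _] := cell_kernel c.
set s := col_pos c in s1 s2 *; set t := row_pos c in t1 t2 *.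
have xkl := grid_lt a d0 kl; have xSkl := grid_le a d0 (kl : (k.+1 <= l)%N).
have stepk := grid_step a d k; have stepl := grid_step a d l.
have st : s < t by apply: lt_le_trans s2 (le_trans xSkl t1).
have st0 : 0 < t - s by rewrite subr_gt0.
rewrite normrM (gtr0_norm hh0) ler_pM2l // => Bst.
have -> : hook_kernel (2 * h * (t - s)) (2 * h * (boundary la t - boundary la s)) =
    2 * h * hook_kernel (t - s) (boundary la t - boundary la s).
  by rewrite /hook_kernel; field; rewrite !gt_eqF.
rewrite ler_pM2l //.
have k1 : hook_kernel (t - s) (g t - g s) - 2 * (2 * eps) <=
    hook_kernel (t - s) (boundary la t - boundary la s).
  apply: hook_kernel_perturb => //; first exact: lip_le (ltW st).
  have := close t; have := close s => /ler_normlP[h1 h2] /ler_normlP[h3 h4].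
  by apply/ler_normlP; split; lra.
have k2 : grid_kernel g a d k l - 4 * (2 * d) <= hook_kernel (t - s) (g t - g s).
  have xt := lip_le lip t1; have xs := lip_le lip s1.
  apply: hook_kernel_lip => //.
  - by rewrite subr_gt0.
  - exact: lip_le (ltW st).
  - exact: lip_le (ltW xkl).
  - by apply/ler_normlP; split; lra.
  - by move: xt xs => /ler_normlP[h1 h2] /ler_normlP[h3 h4]; apply/ler_normlP; split; lra.
lra.
Qed.

(** In units of [h], each side of the rectangle loses [2 eps] to the approximation and [1 / h] to
    rounding; the two increments add up to at most [4 d]. *)
Lemma cell_count_ge (g : R -> R) (eps d a : R) (k l : nat) :
  lip1 g -> (forall x, `|g x - boundary la x| <= eps) -> 0 < d -> (k < l)%N ->
  h ^+ 2 * (col_incr g a d k * row_incr g a d l - (2 * eps + h^-1) * (4 * d)) <=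
  \sum_(c : cell la) (((grid a d k <= col_pos c < grid a d k.+1) &&
     (grid a d l <= row_pos c < grid a d l.+1))%R)%:R.
Proof.
move=> lip close d0 kl.
have eps0 : 0 <= eps by apply: le_trans (close 0).
have e0 : 0 <= 2 * eps + h^-1 by rewrite addr_ge0 ?mulr_ge0 ?invr_ge0 ?(ltW h0).
have [/andP[c0 c1] _] := incr_bounds a k lip d0.
have [_ /andP[r0 r1]] := incr_bounds a l lip d0.
pose du := Num.max 0 (bdry_col (grid a d k.+1) - bdry_col (grid a d k) - 1).
pose dv := Num.max 0 (bdry_row (grid a d l) - bdry_row (grid a d l.+1) - 1).
have := close (grid a d k.+1); have := close (grid a d k).
have := close (grid a d l.+1); have := close (grid a d l).
move=> /ler_normlP[a1 a2] /ler_normlP[a3 a4] /ler_normlP[a5 a6] /ler_normlP[a7 a8].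
have hV : h * h^-1 = 1 by rewrite divff // gt_eqF.
have hE (C : R) : h * (C - (2 * eps + h^-1)) = h * (C - 2 * eps) - 1.
  by rewrite opprD addrA mulrBr hV.
have duE : h * (col_incr g a d k - (2 * eps + h^-1)) <= du.
  rewrite /du le_max; apply/orP; right; rewrite /bdry_col /col_incr.
  by rewrite hE -mulrBr lerD2r ler_pM2l //; lra.
have dvE : h * (row_incr g a d l - (2 * eps + h^-1)) <= dv.
  rewrite /dv le_max; apply/orP; right; rewrite /bdry_row /row_incr.
  by rewrite hE -mulrBr lerD2r ler_pM2l //; lra.
have du0 : 0 <= du by rewrite le_max lexx.
have dv0 : 0 <= dv by rewrite le_max lexx.
set e := 2 * eps + h^-1 in e0 duE dvE *.
apply: le_trans (_ : du * dv <= _); last first.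
  have [Edu|du1] := eqVneq du 0; first by rewrite Edu mul0r sumr_ge0.
  have [Edv|dv1] := eqVneq dv 0; first by rewrite Edv mulr0 sumr_ge0.
  have lemax (z : R) : Num.max 0 z != 0 -> Num.max 0 z <= z.
    by case: (leP 0 z); rewrite ?eqxx.
  have := @card_cells_between (grid a d k) (grid a d k.+1) (grid a d l)
    (grid a d l.+1) (grid_le a d0 kl) du dv du0 dv0 (lemax _ du1) (lemax _ dv1).
  rewrite -sum1_card natr_sum [X in _ <= X -> _]big_mkcond /=.
  by move=> le; apply: le_trans le _; apply: ler_sum => c _; rewrite inE; case: ifP.
have := @prod_pos_part_ge R (h * col_incr g a d k) (h * row_incr g a d l) (h * e) du dv.
move=> P; have := P _ _ _ _ _ du0 dv0; rewrite !mulr_ge0 ?(ltW h0) // -!mulrBr.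
move=> /(_ isT isT isT duE dvE); apply: le_trans.
rewrite -subr_ge0.
have -> : h * col_incr g a d k * (h * row_incr g a d l) -
   h * e * (h * col_incr g a d k + h * row_incr g a d l) -
   h ^+ 2 * (col_incr g a d k * row_incr g a d l - e * (4 * d)) =
   (h ^+ 2 * e) * (4 * d - (col_incr g a d k + row_incr g a d l)) by ring.
by rewrite !mulr_ge0 ?sqr_ge0 // subr_ge0; lra.
Qed.

Let part1_gt0 : (0 < part la 1)%N.
Proof.
by move: n0 la_pos; rewrite /part; case: (la) => //= l s _; rewrite inE negb_or eq_sym lt0n => /andP[].
Qed.

Let h2 : h ^+ 2 = (sumn la)%:R / 2.
Proof. by rewrite /h expr_div_n !sqr_sqrtr. Qed.

Lemma grid_kernel_bounds g a d k l m : lip1 g -> 0 < d -> (k < l)%N -> (l < m)%N ->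
  0 <= grid_kernel g a d k l <= 2 * (d * m%:R).
Proof.
move=> lip d0 kl lm; have lt := grid_lt a d0 kl.
rewrite hook_kernel_ge0 /=; last by rewrite subr_ge0 ltW.
apply: le_trans (hook_kernel_le _ (lip_le lip (ltW lt))) _; first by rewrite subr_ge0 ltW.
rewrite ler_pM2l // /grid.
have : d * l%:R <= d * m%:R by rewrite ler_pM2l // ler_nat ltnW.
by have : 0 <= d * k%:R by [rewrite mulr_ge0 // ltW]; lra.
Qed.

(** The factor [h^3 / 2] is [2 h] from the kernel, [h^2] from the count and [1 / 4]. A kernel is at
    most [2 d m], so [m^2] blocks lose [8 d^2 m^3] times the side error; the kernel errors of the
    [n = 2 h^2] cells make up [16 d + 8 eps]. *)
Lemma complexity_grid_sum_ge (g : R -> R) (eps d a : R) (m : nat) :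
  lip1 g -> (forall x, `|g x - boundary la x| <= eps) -> 0 < d ->
  h ^+ 3 / 2 * (grid_sum g a d m - (2 * eps + h^-1) * (8 * d ^+ 2 * m%:R ^+ 3)
                - 16 * d - 8 * eps) <= nps_complexity R la.
Proof.
move=> lip close d0; apply: le_trans (nps_complexity_kernel_ge la_sorted la_pos R part1_gt0).
have eps0 : 0 <= eps by apply: le_trans (close 0).
have hh0 : 0 < 2 * h by rewrite pmulr_rgt0.
rewrite -mulr_suml ler_pdivlMr //.
pose HK (c : cell la) : R :=
  hook_kernel (arm_len c + leg_len c)%:R ((arm_len c)%:R - (leg_len c)%:R).
pose ik (k : nat) (c : cell la) : bool := grid a d k <= col_pos c < grid a d k.+1.
pose il (l : nat) (c : cell la) : bool := grid a d l <= row_pos c < grid a d l.+1.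
(* The number of blocks that contain the cell, at most 1. Cells in no block are dropped, their
   kernels being nonnegative. *)
pose W (c : cell la) : R := \sum_(k < m) \sum_(l < m | (k < l)%N) (ik k c && il l c)%:R.
have HK0 c : 0 <= HK c by apply: hook_kernel_ge0.
have W1 c : W c <= 1.
  have s1 := sum_indicator a m (col_pos c) d0; have s2 := sum_indicator a m (row_pos c) d0.
  apply: le_trans (_ : (\sum_(k < m) (ik k c)%:R) * (\sum_(l < m) (il l c)%:R) <= _).
    rewrite mulr_suml; apply: ler_sum => k _; rewrite mulr_sumr.
    rewrite [leLHS]big_mkcond; apply: ler_sum => l _.
    by case: ifP => _; case: (ik k c); case: (il l c); rewrite ?mulr1 ?mulr0.
  by rewrite -[leRHS]mulr1; apply: ler_pM; rewrite ?sumr_ge0.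
have W0 : forall c, 0 <= W c.
  by move=> c; apply: sumr_ge0 => k _; apply: sumr_ge0.
pose e0 := 8 * d + 4 * eps.
have e00 : 0 <= e0 by rewrite addr_ge0 // mulr_ge0 // ltW.
pose K (k l : nat) := grid_kernel g a d k l.
have HKge c : 2 * h * (\sum_(k < m) \sum_(l < m | (k < l)%N) K k l * (ik k c && il l c)%:R
    - e0) <= HK c.
  apply: le_trans (_ : W c * HK c <= _); last by rewrite ler_piMl.
  apply: le_trans (_ : 2 * h * (\sum_(k < m) \sum_(l < m | (k < l)%N)
      K k l * (ik k c && il l c)%:R - e0 * W c) <= _).
    by rewrite (ler_pM2l hh0) lerD2l lerN2 ler_piMr.
  rewrite /W mulr_suml mulr_sumr -sumrB mulr_sumr; apply: ler_sum => k _.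
  rewrite mulr_suml mulr_sumr -sumrB mulr_sumr; apply: ler_sum => l kl.
  have [b|_] := boolP (ik k c && il l c); last by rewrite /= !mulr0 subr0 mulr0 mul0r.
  by rewrite /= !mulr1 mul1r; case/andP: b => b1 b2; apply: cell_kernel_ge.
have cardc : \sum_(c : cell la) (e0 : R) = (sumn la)%:R * e0.
  by rewrite sumr_const card_cell mulr_natl.
apply: le_trans (ler_sum _ (fun c _ => HKge c)).
rewrite -mulr_sumr sumrB cardc exchange_big /=.
have -> : h ^+ 3 / 2 * (grid_sum g a d m - (2 * eps + h^-1) * (8 * d ^+ 2 * m%:R ^+ 3) -
   16 * d - 8 * eps) * 4 = 2 * h * (h ^+ 2 * (grid_sum g a d m -
   (2 * eps + h^-1) * (8 * d ^+ 2 * m%:R ^+ 3)) - h ^+ 2 * 2 * e0).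
  by rewrite /e0; move: (_ + h^-1) => q; field.
have -> : h ^+ 2 * 2 = (sumn la)%:R by rewrite h2 divfK.
rewrite (ler_pM2l hh0) lerD2r.
set E := 2 * eps + h^-1.
have E0 : 0 <= E by rewrite addr_ge0 ?mulr_ge0 ?invr_ge0 ?(ltW h0).
have term (k l : 'I_m) : (k < l)%N ->
  h ^+ 2 * (K k l * (col_incr g a d k * row_incr g a d l)) - h ^+ 2 * (E * (8 * d ^+ 2 * m%:R))
  <= \sum_(c : cell la) K k l * (ik k c && il l c)%:R.
  move=> kl; rewrite -mulr_sumr.
  have /andP[K0 K1] := grid_kernel_bounds a lip d0 kl (ltn_ord l).
  have := cell_count_ge a lip close d0 kl; rewrite -/E => cc.
  apply: le_trans (ler_wpM2l K0 cc); rewrite -/(K k l) in K0 K1 *.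
  have : 0 <= h ^+ 2 * E * (4 * d) * (2 * (d * m%:R) - K k l).
    by rewrite !mulr_ge0 ?sqr_ge0 ?(ltW d0) // subr_ge0.
  by nra.
have -> : E * (8 * d ^+ 2 * m%:R ^+ 3) =
    \sum_(k < m) \sum_(l < m) E * (8 * d ^+ 2 * m%:R).
  by rewrite sum_const_sqr cube_factor.
rewrite /grid_sum mulrBr !mulr_sumr -sumrB; apply: ler_sum => k _.
rewrite exchange_big /= !mulr_sumr.
apply: le_trans (ler_sum _ (fun l kl => term k l kl)).
rewrite sumrB lerD2l lerN2.
rewrite [leRHS](bigID (fun l : 'I_m => (k < l)%N)) /= lerDl sumr_ge0 // => l _.
exact: mulr_ge0 (sqr_ge0 _)
  (mulr_ge0 E0 (mulr_ge0 (mulr_ge0 (ler0n _ _) (sqr_ge0 _)) (ler0n _ _))).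
Qed.

End Boundary.

(** * Riemann sums bound the integral *)

Section LipschitzDensity.
Variable R : realType.
Notation mu := (@lebesgue_measure R).

Definition add_id (g : R -> R) (x : R) : R := x + g x.

Section Measure.
Variable g : R -> R.
Hypothesis lip : lip1 g.

Lemma add_id_nd : nondecreasing (add_id g).
Proof.
move=> x y xy; rewrite /add_id.
have := lip y x; rewrite (ger0_norm (_ : 0 <= y - x)) ?subr_ge0 //.
by move=> /ler_normlP[h1 h2]; lra.
Qed.

Lemma lip1_continuous : continuous g.
Proof.
move=> x; apply/cvgrPdist_le => e e0; near=> y.
apply: le_trans (lip _ _) _; near: y.
exact: cvgr_dist_le.
Unshelve. all: by end_near. Qed.

Lemma add_id_rc : right_continuous (add_id g).
Proof.
by apply: right_continuousW => x; apply: cvgD; [exact: cvg_id|exact: lip1_continuous].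
Qed.

HB.instance Definition _ :=
  isCumulative.Build R _ R (add_id g) add_id_nd add_id_rc.

Definition add_id_measure := lebesgue_stieltjes_measure (add_id g).

HB.instance Definition _ := Measure.on add_id_measure.

Lemma add_id_measure_itv x y : x <= y ->
  add_id_measure `]x, y]%classic = (add_id g y - add_id g x)%:E.
Proof.
move=> xy; rewrite /add_id_measure /lebesgue_stieltjes_measure /measure_extension.
rewrite measurable_mu_extE /=; last exact: is_ocitv.
by rewrite wlength_itv_bnd.
Qed.

End Measure.

Lemma lip1N (g : R -> R) : lip1 g -> lip1 (fun x => - g x).
Proof. by move=> lip x y; rewrite -opprD normrN; exact: lip. Qed.

(** The mean of the Stieltjes measures of [x + g x] and [x - g x] gives []x, y]] the mass [y - x],
    so it is the Lebesgue measure; its null sets are null for both summands. *)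
Lemma add_id_measure_null (g : R -> R) (lip : lip1 g) (A : set R) :
  measurable A -> mu A = 0%E -> add_id_measure lip A = 0%E.
Proof.
move=> mA muA.
pose m2 := measure_add (add_id_measure lip) (add_id_measure (lip1N lip)).
have half0 : 0 <= 2^-1 :> R by rewrite invr_ge0.
pose half : {nonneg R} := NngNum half0.
pose m3 := mscale half m2.
have m3E X : m3 X = ((2^-1)%:E * (add_id_measure lip X + add_id_measure (lip1N lip) X))%E.
  by congr (_ * _)%E; exact: measure_addE.
have E : mu A = m3 A.
  apply: (@lebesgue_measure_unique R m3 _ A mA).
  move=> _ [[x y] _ <-]; apply/esym/(etrans (m3E _))/esym => /=.
  rewrite lebesgue_measure_itv /= lte_fin.
  have [xy|yx] := ltP x y; last first.
    by rewrite set_itv_ge ?bnd_simp -?leNgt // !measure0 adde0 mule0.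
  rewrite !add_id_measure_itv ?(ltW xy) // -!EFinD -EFinM; congr EFin.
  by rewrite /add_id; field.
have : ((2^-1)%:E * (add_id_measure lip A + add_id_measure (lip1N lip) A) = 0)%E.
  by rewrite -m3E -E.
move=> /eqP; rewrite mule_eq0 => /orP[|].
  by rewrite eqe invr_eq0 pnatr_eq0.
have n1 := measure_ge0 (add_id_measure lip) A.
have n2 := measure_ge0 (add_id_measure (lip1N lip)) A.
by rewrite padde_eq0 // => /andP[/eqP].
Qed.

(** Restricting to []a, b]] makes the measure finite and its density integrable. Differentiating the
    integral of the density then shows that [g] is differentiable almost everywhere, with derivative
    [p x - 1]. *)
Lemma lip1_density (g : R -> R) (a b : R) : lip1 g -> a < b ->
  exists p : R -> R,
  [/\ measurable_fun [set: R] p, forall x, 0 <= p x,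
      {ae mu, forall x, a < x < b -> is_derive x 1 g (p x - 1)} &
      forall x y, a <= x -> x <= y -> y <= b ->
        (\int[mu]_(t in `]x, y]%classic) (p t)%:E = (add_id g y - add_id g x)%:E)%E].
Proof.
move=> lip ab; pose m1 : {measure set (measurableTypeR R) -> \bar R} := add_id_measure lip.
have mab : measurable (`]a, b]%classic : set (measurableTypeR R)) by exact: measurable_itv.
have fin : (m1 `]a, b]%classic < +oo)%E by rewrite /m1 /= add_id_measure_itv ?ltry // ltW.
pose nu : {finite_measure set (measurableTypeR R) -> \bar R} := mfrestr mab fin.
have nu_mu : nu `<< mu.
  apply/null_content_dominatesP => A mA muA; rewrite /nu /= /mfrestr /mrestr.
  apply: add_id_measure_null; first exact: measurableI.
  apply/eqP; rewrite eq_le measure_ge0 andbT -[leRHS]muA.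
  by apply: le_measure; rewrite ?inE //; exact: measurableI.
have [f [f0 ffin fint fE]] := radon_nikodym_sigma_finite nu_mu.
pose p x := fine (f x).
have pE x : (p x)%:E = f x by rewrite /p fineK.
have pint : mu.-integrable [set: R] (EFin \o p).
  by apply: eq_integrable fint => // x _; rewrite /= pE.
have pI x y : a <= x -> x <= y -> y <= b ->
    (\int[mu]_(t in `]x, y]%classic) (p t)%:E = (add_id g y - add_id g x)%:E)%E.
  move=> ax xy yb; under eq_integral do rewrite pE.
  rewrite -fE; last exact: measurable_itv.
  rewrite /nu /= /mfrestr /mrestr setIidl ?add_id_measure_itv //.
  by apply: subset_itv; rewrite bnd_simp.
have locp : locally_integrable [set: R] p.
  exact: (open_integrable_locally openT).
have intp y : mu.-integrable [set` Interval (BRight a) (BRight y)] (EFin \o p).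
  by apply: integrableS pint => //; exact: measurable_itv.
exists p; split => //.
- by apply/measurable_EFinP; exact: measurable_int pint.
- by move=> x; rewrite fine_ge0.
have := FTC1 intp locp; apply: filterS; first exact: (ae_filter_ringOfSetsType mu).
move=> x /= H /andP[ax xb].
have [dF eF] := H ax.
set F := (fun y => _) in dF eF.
have isF : is_derive x 1 F (p x) by rewrite -eF derive1E; exact: derivableP.
have isG : is_derive x 1 (fun y => F y + (- y + cst (a + g a) y)) (p x + (- 1 + 0)).
  apply: is_deriveD.
rewrite addr0 in isG.
apply: near_eq_is_derive isG.
have : \forall y \near x, a < y < b.
  near=> y; apply/andP; split; near: y; [exact: lt_nbhsr|exact: lt_nbhsl].
apply: filterS => y /andP[ay yb].
by rewrite /F /Rintegral pI ?(ltW ay) ?(ltW yb) // /add_id /cst /=; lra.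
Unshelve. all: by end_near. Qed.

End LipschitzDensity.

(** * Comparison of integrals with step functions times a density *)

Section GridIntegral.
Variable R : realType.
Notation mu := (@lebesgue_measure R).
Implicit Types (g p q : R -> R) (a b d : R).

Import HBNNSimple.

(* Without measurability of [f]: only the definition of its integral by simple
   functions is used. *)
Lemma ae_le_integral_setT (D : set R) (f g : R -> \bar R) :
  measurable_fun [set: R] g -> (forall x, 0 <= g x)%E ->
  {ae mu, forall x, D x -> (f x <= g x)%E} ->
  (\int[mu]_(x in D) f x <= \int[mu]_x g x)%E.
Proof.
move=> mg g0 fg; rewrite integralE.
apply: (@le_trans _ _ (\int[mu]_(x in D) f^\+ x))%E.
  by rewrite -[leRHS]sube0; apply: leeB => //; apply: integral_ge0 => x _; exact: funeneg_ge0.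
rewrite ge0_integralE => [|x _]; last exact: funepos_ge0.
apply: ge_ereal_sup => _ [h hf <-].
rewrite -integralT_nnsfun; apply: ae_ge0_le_integral => //.
- by move=> x _; rewrite lee_fin fun_ge0.
- exact/measurable_EFinP.
apply: filterS fg; first exact: (ae_filter_ringOfSetsType mu).
move=> x fgx _; have := hf x; rewrite /patch; case: ifPn => [/set_mem Dx|_ h0].
  by move=> /le_trans; apply; rewrite funeposE ge_max fgx //= g0.
exact: le_trans h0 (g0 x).
Qed.

Lemma grid_find a d m (x : R) : a < x -> x <= grid a d m ->
  exists2 k : 'I_m, grid a d k < x & x <= grid a d k.+1.
Proof.
elim: m => [|m IH] ax xm.
  by move: xm; rewrite /grid mulr0 addr0 leNgt ax.
have [xm'|xm'] := leP x (grid a d m); last by exists ord_max.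
by have [k] := IH ax xm'; exists (widen_ord (leqnSn m) k).
Qed.

Lemma integral_step_density p (c v : nat -> R) a d (m : nat) :
  measurable_fun [set: R] p -> (forall x, 0 <= p x) -> (forall k, 0 <= c k) ->
  (forall k, (k < m)%N ->
    \int[mu]_(x in `]grid a d k, grid a d k.+1]%classic) (p x)%:E = (v k)%:E)%E ->
  (\int[mu]_x (\sum_(k < m)
      c k * (p x * \1_(`]grid a d k, grid a d k.+1]%classic) x))%:E
    = (\sum_(k < m) c k * v k)%:E)%E.
Proof.
move=> mp p0 c0 pv.
have mt k : measurable_fun [set: R]
    (fun x => p x * \1_(`]grid a d k, grid a d k.+1]%classic) x).
  apply: measurable_funM => //; exact: measurable_indic.
under eq_integral do rewrite -sumEFin.
rewrite ge0_integral_sum //=; last first.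
- by move=> k x _; rewrite lee_fin !mulr_ge0.
- by move=> k; apply/measurable_EFinP; apply: measurable_funM => //; exact: mt.
rewrite -sumEFin; apply: eq_bigr => k _.
under eq_integral do rewrite EFinM.
rewrite ge0_integralZl_EFin //; last first.
- by apply/measurable_EFinP; exact: mt.
- by move=> x _; rewrite lee_fin mulr_ge0.
rewrite EFinM -pv // [in RHS]integral_mkcond epatch_indic; congr (_ * _)%E.
Qed.

End GridIntegral.

Section ShapeIntegral.
Variable R : realType.
Notation mu := (@lebesgue_measure R).
Implicit Types (g : R -> R) (a d : R).

(** Above the diagonal [8 d] covers the variation of the kernel in a block; otherwise it covers the
    kernel itself, at most [2 d] because [t - s <= d]. *)
Definition cell_bound g a d (k l : nat) : R :=
  (if (k < l)%N then grid_kernel g a d k l else 0) + 8 * d.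

Lemma cell_bound_ge0 g a d k l : 0 < d -> 0 <= cell_bound g a d k l.
Proof.
move=> d0; rewrite addr_ge0 ?mulr_ge0 ?(ltW d0) //; case: ifP => // kl.
by rewrite hook_kernel_ge0 // subr_ge0; apply: grid_le => //; exact: ltnW.
Qed.

Lemma hook_kernel_le_cell_bound g a d k l s t : lip1 g -> 0 < d ->
  grid a d k < s -> s <= grid a d k.+1 ->
  grid a d l < t -> t <= grid a d l.+1 -> s < t ->
  hook_kernel (t - s) (g t - g s) <= cell_bound g a d k l.
Proof.
move=> lip d0 ks sk lt tl st; rewrite /cell_bound.
have stepk := grid_step a d k; have stepl := grid_step a d l.
have lst := lip_le lip (ltW st).
have [kl|lk] := ltnP k l; last first.
  have := grid_le a d0 (lk : (l.+1 <= k.+1)%N) => lek.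
  have := hook_kernel_le (ltW (_ : 0 < t - s)) lst; rewrite subr_gt0 => /(_ st).
  lra.
have xkl := grid_lt a d0 kl.
rewrite -lerBlDr (_ : 8 * d = 4 * (2 * d)); last by ring.
apply: hook_kernel_lip; rewrite ?subr_gt0 //.
- exact: lip_le lip (ltW xkl).
- by apply/ler_normlP; split; lra.
have /ler_normlP[h1 h2] := lip_le lip (ltW lt).
have /ler_normlP[h3 h4] := lip_le lip (ltW ks).
by apply/ler_normlP; split; lra.
Qed.

Lemma sum_cell_bound_le g a d m : lip1 g -> 0 < d ->
  \sum_(k < m) (\sum_(l < m) cell_bound g a d k l * row_incr g a d l) * col_incr g a d k
  <= grid_sum g a d m + 32 * d * (d * m%:R) ^+ 2.
Proof.
move=> lip d0.
have -> : 32 * d * (d * m%:R) ^+ 2 = \sum_(k < m) \sum_(l < m) 32 * d ^+ 3.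
  by rewrite sum_const_sqr; move: (m%:R : R) => z; ring.
rewrite -big_split /=; apply: ler_sum => k _.
rewrite mulr_suml [X in _ <= X + _]big_mkcond -big_split /=; apply: ler_sum => l _.
have [/andP[u0 u1] _] := incr_bounds a k lip d0.
have [_ /andP[v0 v1]] := incr_bounds a l lip d0.
have uv : col_incr g a d k * row_incr g a d l <= 2 * d * (2 * d) by exact: ler_pM.
have := ler_wpM2l (_ : 0 <= 8 * d) uv; rewrite mulr_ge0 ?(ltW d0) // => /(_ isT).
by rewrite /cell_bound; case: ifP => _; nra.
Qed.

Lemma derive1_norm_lt g a x : (forall y, y <= a -> g y = `|y|) -> a <= 0 ->
  x < a -> derive1 g x = - 1.
Proof.
move=> gE a0 xa; rewrite derive1E.
suff H : is_derive x 1 g (- 1) by rewrite derive_val.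
apply: (@near_eq_is_derive _ _ _ (fun y : R => - y)).
  have : \forall y \near x, y < a by exact: lt_nbhsl.
  by apply: filterS => y ya; rewrite gE ?ltW // ler0_norm // ltW // (lt_le_trans ya).
Qed.

Lemma derive1_norm_gt g b x : (forall y, b <= y -> g y = `|y|) -> 0 <= b ->
  b < x -> derive1 g x = 1.
Proof.
move=> gE b0 bx; rewrite derive1E.
suff H : is_derive x 1 g 1 by rewrite derive_val.
apply: (@near_eq_is_derive _ _ _ (fun y : R => y)).
have : \forall y \near x, b < y by exact: lt_nbhsr.
by apply: filterS => y ya; rewrite gE ?ltW // ger0_norm // ltW // (le_lt_trans _ ya).
Qed.

Lemma ae_neq (a : R) : {ae mu, forall x, x <> a}.
Proof.
exists [set a]; split; [exact: measurable_set1|exact: lebesgue_measure_set1|].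
by move=> x /= /contrapT.
Qed.

(** [1 + g'] vanishes left of [a] and [1 - g'] right of the last grid point, so only [a < s < t < b]
    contributes. There the kernel is replaced by its block bound and the two factors by their
    densities [p] and [q]; the end points are discarded as null sets. *)
Lemma shape_integral_le g a d m : lip1 g -> 0 < d -> (0 < m)%N ->
  a <= 0 -> 0 <= grid a d m ->
  (forall x, x <= a -> g x = `|x|) -> (forall x, grid a d m <= x -> g x = `|x|) ->
  (\int[mu]_s \int[mu]_(t in `]s, +oo[)
      (((t - s) + (g t - g s) ^+ 2 / (t - s)) * (1 + derive1 g s) * (1 - derive1 g t))%:E
   <= (grid_sum g a d m + 32 * d * (d * m%:R) ^+ 2)%:E)%E.
Proof.
move=> lip d0 m0 a0 b0 gl gr; set b := grid a d m in b0 gr *.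
have F := ae_filter_ringOfSetsType mu.
have aE : grid a d 0 = a by rewrite /grid mulr0 addr0.
have ab : a < b by rewrite -aE; exact: grid_lt.
have in_ab k : (k < m)%N -> [/\ a <= grid a d k, grid a d k <= grid a d k.+1 &
    grid a d k.+1 <= b].
  move=> km; have := grid_le a d0 (leq0n k); rewrite aE => ak.
  by split; [exact: ak | exact: (grid_le a d0 (leqnSn k)) | exact: (grid_le a d0 km)].
have [p [mp p0 pder pint]] := lip1_density lip ab.
have [q [mq q0 qder qint]] := lip1_density (lip1N lip) ab.
have pv k : (k < m)%N -> (\int[mu]_(x in `]grid a d k, grid a d k.+1]%classic) (p x)%:E
    = (col_incr g a d k)%:E)%E.
  by move=> /in_ab[h1 h2 h3]; rewrite pint //; congr EFin; rewrite /add_id /col_incr; ring.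
have qv k : (k < m)%N -> (\int[mu]_(x in `]grid a d k, grid a d k.+1]%classic) (q x)%:E
    = (row_incr g a d k)%:E)%E.
  by move=> /in_ab[h1 h2 h3]; rewrite qint //; congr EFin; rewrite /add_id /row_incr; ring.
pose M k := \sum_(l < m) cell_bound g a d k l * row_incr g a d l.
have M0 k : 0 <= M k.
  apply: sumr_ge0 => l _; rewrite mulr_ge0 ?cell_bound_ge0 //.
  by have [_ /andP[]] := incr_bounds a l lip d0.
pose chi k := \1_(`]grid a d k, grid a d k.+1]%classic) : R -> R.
have chi0 k x : 0 <= chi k x by rewrite /chi indicE ler0n.
have chi1 k x : grid a d k < x -> x <= grid a d k.+1 -> chi k x = 1.
  by move=> h1 h2; rewrite /chi indicE mem_set //= in_itv /= h1.
have mstep (c : nat -> R) (r : R -> R) : measurable_fun [set: R] r ->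
    measurable_fun [set: R] (fun x => (\sum_(k < m) c k * (r x * chi k x))%:E).
  move=> mr; apply/measurable_EFinP; apply: measurable_sum => k.
  by apply: measurable_funM => //; apply: measurable_funM => //; exact: measurable_indic.
have inner s k : grid a d k < s -> s <= grid a d k.+1 -> a < s < b ->
    1 + derive1 g s = p s ->
  (\int[mu]_(t in `]s, +oo[)
      (((t - s) + (g t - g s) ^+ 2 / (t - s)) * (1 + derive1 g s) * (1 - derive1 g t))%:E
   <= (M k * p s)%:E)%E.
  move=> ks sk /andP[as_ sb] ->.
  have c0 l : 0 <= p s * cell_bound g a d k l by rewrite mulr_ge0 ?cell_bound_ge0.
  have -> : ((M k * p s)%:E = \int[mu]_t (\sum_(l < m)
      (p s * cell_bound g a d k l) * (q t * chi l t))%:E)%E.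
    rewrite (integral_step_density mq q0 c0 qv) mulr_suml; congr EFin.
    by apply: eq_bigr => l _; rewrite -!mulrA [RHS]mulrC -!mulrA.
  apply: ae_le_integral_setT.
  - exact: (mstep (fun l => p s * cell_bound g a d k l) q mq).
  - by move=> t; rewrite lee_fin sumr_ge0 // => l _; rewrite !mulr_ge0 ?chi0 ?cell_bound_ge0.
  apply: filterS2 qder (ae_neq b) => t /= tder tb; rewrite in_itv /= andbT => st.
  rewrite lee_fin.
  have rhs0 : 0 <= \sum_(l < m) (p s * cell_bound g a d k l) * (q t * chi l t).
    by apply: sumr_ge0 => l _; rewrite !mulr_ge0 ?chi0 ?cell_bound_ge0.
  have [lt_tb|bt|] := ltgtP t b; last by [].
    have at_ : a < t by exact: lt_trans as_ st.
    have -> : 1 - derive1 g t = q t.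
      have H : is_derive t 1 (fun x => - g x) (q t - 1) by apply: tder; rewrite at_.
      have H2 : is_derive t 1 g (- (q t - 1)).
        rewrite (_ : g = - (fun x => - g x)); last by apply/funext => x; rewrite fctE opprK.
        exact: is_deriveN.
      by rewrite derive1E derive_val; ring.
    have [l lt tl] := grid_find at_ (ltW lt_tb).
    rewrite (bigD1 l) //= chi1 // mulr1.
    apply: (@le_trans _ _ (p s * cell_bound g a d k l * q t)); last first.
      by rewrite lerDl sumr_ge0 // => i _; rewrite !mulr_ge0 ?chi0 ?cell_bound_ge0.
    rewrite ler_wpM2r // mulrC ler_wpM2l //.
    exact: hook_kernel_le_cell_bound.
  by rewrite (derive1_norm_gt gr b0 bt) subrr mulr0.
apply: le_trans (_ : (\sum_(k < m) M k * col_incr g a d k)%:E <= _)%E; last first.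
  by rewrite lee_fin; exact: sum_cell_bound_le.
rewrite -(integral_step_density mp p0 M0 pv).
apply: ae_le_integral_setT.
- exact: (mstep M p mp).
- by move=> t; rewrite lee_fin sumr_ge0 // => l _; rewrite !mulr_ge0 ?chi0 ?cell_bound_ge0.
apply: filterS3 pder (ae_neq a) (ae_neq b) => s /= sder sa sb _.
have rhs0 : 0 <= \sum_(k < m) M k * (p s * chi k s).
  by apply: sumr_ge0 => l _; rewrite !mulr_ge0 ?chi0 ?cell_bound_ge0.
have [lt_sb|bs|] := ltgtP s b; last by [].
  have [lt_as|lt_sa|] := ltgtP a s; last by move=> /esym.
    have [k ks sk] := grid_find lt_as (ltW lt_sb).
    apply: le_trans (inner s k ks sk _ _) _.
    - by rewrite lt_as.
    - have H : is_derive s 1 g (p s - 1) by apply: sder; rewrite lt_as.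
      by rewrite derive1E derive_val; ring.
    rewrite lee_fin (bigD1 k) //= -/(chi k s) chi1 // mulr1 lerDl.
    by apply: sumr_ge0 => i _; rewrite !mulr_ge0 ?chi0 ?cell_bound_ge0.
  rewrite integral0_eq ?lee_fin // => t _.
  by rewrite (derive1_norm_lt gl a0 lt_sa) subrr mulr0 mul0r.
rewrite integral0_eq ?lee_fin // => t; rewrite /= in_itv /= andbT => st.
by rewrite (derive1_norm_gt gr b0 (lt_trans bs st)) subrr mulr0.
Qed.

End ShapeIntegral.

(** * Asymptotics *)

Section Asymptotics.
Variable R : realType.
Implicit Types (g : R -> R) (a d e : R).

Lemma powR3_half_sqrt (n : nat) : n%:R `^ (3 / 2) = Num.sqrt n%:R ^+ 3 :> R.
Proof.
by rewrite mulrC powRrM powR12_sqrt // powR_mulrn ?sqrtr_ge0.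
Qed.

Lemma half_scale_cubed (n : nat) :
  (Num.sqrt n%:R / Num.sqrt 2) ^+ 3 / 2 = Num.sqrt 2 * n%:R `^ (3 / 2) / 8 :> R.
Proof.
have s0 : Num.sqrt 2 != 0 :> R by rewrite gt_eqF // sqrtr_gt0.
have s2 : Num.sqrt 2 ^+ 2 = 2 :> R by rewrite sqr_sqrtr.
rewrite powR3_half_sqrt expr_div_n.
rewrite (_ : Num.sqrt 2 ^+ 3 = 2 * Num.sqrt 2); last by rewrite exprSr s2.
move: (Num.sqrt n%:R) => z; apply: (mulIf s0).
rewrite (_ : Num.sqrt 2 * z ^+ 3 / 8 * Num.sqrt 2 = Num.sqrt 2 ^+ 2 * z ^+ 3 / 8); last by ring.
by rewrite s2; field.
Qed.

Lemma near_ge_nat (c : R) : \forall n \near \oo, c <= n%:R.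
Proof.
near=> n; apply: (@le_trans _ _ (Num.truncn `|c|).+1%:R).
  by rewrite (le_trans (ler_norm c)) // ltW // truncnS_gt.
by rewrite ler_nat; near: n; exists (Num.truncn `|c|).+1.
Unshelve. all: by end_near. Qed.

Lemma limit_shape_support g : limit_shape g -> exists a L,
  [/\ a <= 0, 0 < L, 0 <= a + L, forall x, x <= a -> g x = `|x| &
      forall x, a + L <= x -> g x = `|x|].
Proof.
move=> [_ [a0 [b0 g_out]]]; have A0 := normr_ge0 a0; have B0 := normr_ge0 b0.
exists (- (`|a0| + `|b0| + 1)), ((`|a0| + `|b0| + 1) + (`|a0| + `|b0| + 1)).
rewrite addKr; split; rewrite ?addr_ge0 //; [lra..| |].
- move=> x xa; apply: g_out; rewrite negb_and -!leNgt; apply/orP; left.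
  by apply: le_trans xa _; have := ler_norm (- a0); rewrite normrN; lra.
move=> x xa; apply: g_out; rewrite negb_and -!leNgt; apply/orP; right.
by apply: le_trans xa; have := ler_norm b0; lra.
Qed.

(** Formulated for a real [J] below all grid bounds, since finiteness of the integral is not known
    at this stage. *)
Lemma complexity_eventually_ge (la : nat -> seq nat) g (J : R) :
  (forall n, (0 < n)%N -> is_partition_of n (la n)) -> limit_shape g ->
  converges_uniformly la g ->
  (forall a d m, 0 < d -> (0 < m)%N -> a <= 0 -> 0 <= grid a d m ->
    (forall x, x <= a -> g x = `|x|) -> (forall x, grid a d m <= x -> g x = `|x|) ->
    J <= grid_sum g a d m + 32 * d * (d * m%:R) ^+ 2) ->
  forall e, 0 < e -> \forall n \near \oo,
    Num.sqrt 2 * n%:R `^ (3 / 2) / 8 * (J - e) <= nps_complexity R (la n).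
Proof.
move=> la_part shape [cvg _] JE e e0.
have [a [L [a_le L0 b_ge gl gr]]] := limit_shape_support shape.
have lip : lip1 g by move=> x y; have := shape.1 (x, y) (conj I I); rewrite /= mul1r.
(* This [m] gives [d (32 L^2 + 16) <= e / 2], which covers the diagonal error of the integral and
   the term [16 d]. *)
pose m := (Num.truncn (L * (32 * L ^+ 2 + 16) * 2 / e)).+1.
have m0 : 0 < m%:R :> R by rewrite ltr0n.
pose d := L / m%:R.
have d0 : 0 < d by rewrite divr_gt0.
have dm : d * m%:R = L by rewrite divfK // gt_eqF.
have de : d * (32 * L ^+ 2 + 16) <= e / 2.
  have := truncnS_gt (L * (32 * L ^+ 2 + 16) * 2 / e); rewrite -/m ltr_pdivrMr // => H.
  rewrite /d mulrAC ler_pdivrMr //.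
  by move: (L * _) H => z; lra.
pose B := 8 * d ^+ 2 * m%:R ^+ 3.
have B0 : 0 <= B
  := mulr_ge0 (mulr_ge0 (ler0n _ _) (sqr_ge0 _)) (exprn_ge0 _ (ltW m0)).
(* The terms [2 eps B] and [8 eps] together use [e / 4]; the last quarter is for [B / h], small for
   large [n]. *)
pose eps := e / (4 * (2 * B + 8)).
have eps0 : 0 < eps by rewrite divr_gt0 //; lra.
have epsE : (2 * B + 8) * eps = e / 4.
  by rewrite /eps; field; rewrite gt_eqF //; lra.
have Jle : J <= grid_sum g a d m + 32 * d * L ^+ 2.
  have gridm : grid a d m = a + L by rewrite /grid dm.
  by rewrite -dm; apply: JE => //; rewrite ?gridm.
have close : \forall n \near \oo, forall x, `|g x - boundary (la n) x| <= eps.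
  have eps0E : (0 < eps%:E)%E by rewrite lte_fin.
  have : \forall n \near \oo,
      (ereal_sup (range (fun x => `|g x - boundary (la n) x|%:E)) < eps%:E)%E.
    exact: cvg _ (open_ereal_lt' eps0E).
  apply: filterS => n lt_sup x; rewrite -lee_fin; apply: ltW.
  by apply: le_lt_trans lt_sup; apply: ereal_sup_ubound; exists x.
have hbig : \forall n \near \oo, B / (Num.sqrt n%:R / Num.sqrt 2) <= e / 4.
  near=> n.
  have n_big : 2 * (4 * B / e) ^+ 2 + 1 <= n%:R by near: n; exact: near_ge_nat.
  have n0 : 0 < n%:R :> R.
    by apply: lt_le_trans n_big; have := sqr_ge0 (4 * B / e); lra.
  have h0 : 0 < Num.sqrt n%:R / Num.sqrt 2 :> R by rewrite divr_gt0 ?sqrtr_gt0.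
  rewrite ler_pdivrMr //.
  have : 4 * B / e <= Num.sqrt n%:R / Num.sqrt 2.
    rewrite -[leLHS]ger0_norm; last by rewrite divr_ge0 ?mulr_ge0 // ltW.
    rewrite -sqrtr_sqr -sqrtrV // -sqrtrM ?ler0n //.
    by apply: ler_wsqrtr; rewrite ler_pdivlMr //; lra.
  by rewrite ler_pdivrMr //; lra.
near=> n.
have n0 : (0 < n)%N by near: n; exists 1%N.
have /and3P[la_s la_p /eqP la_n] := la_part n n0.
have sn : (0 < sumn (la n))%N by rewrite la_n.
have cl : forall x, `|g x - boundary (la n) x| <= eps by near: n.
have := complexity_grid_sum_ge la_s la_p sn a m lip cl d0.
rewrite la_n half_scale_cubed; apply: le_trans.
apply: ler_wpM2l; first by rewrite !mulr_ge0 ?sqrtr_ge0 ?powR_ge0.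
have hb : B / (Num.sqrt n%:R / Num.sqrt 2) <= e / 4 by near: n.
rewrite -/B; move: hb Jle de epsE.
rewrite [B / _]mulrC; move: (_^-1) (grid_sum _ _ _ _) => z G.
by lra.
Unshelve. all: by end_near. Qed.

End Asymptotics.

Theorem theorem4p3 (R : realType) (la : nat -> seq nat) (gamma : R -> R)
  (la_part : forall n : nat, (0 < n)%N -> is_partition_of n (la n))
  (gamma_shape : limit_shape1 gamma)
  (la_cvg : converges_uniformly la gamma) :
  exists r : nat -> R,
    r =o_\oo (fun n : nat => n%:R `^ (3 / 2)) /\
    forall n : nat, (0 < n)%N ->
      ((Num.sqrt 2 * n%:R `^ (3 / 2) / 8)%:E *
         (\int[lebesgue_measure]_s \int[lebesgue_measure]_(t in `]s, +oo[)
           (((t - s) + (gamma t - gamma s) ^+ 2 / (t - s)) *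
            (1 + derive1 gamma s) * (1 - derive1 gamma t))%:E)
       + (r n)%:E
       < (nps_complexity R (la n))%:E)%E.
Proof.
have [lipg _] := gamma_shape.1.
have lip : lip1 gamma by move=> x y; have := lipg (x, y) (conj I I); rewrite /= mul1r.
have le_grid a d m (d0 : 0 < d) m0 a0 b0 gl gr :=
  @shape_integral_le R gamma a d m lip d0 m0 a0 b0 gl gr.
have powR_gt n : (0 < n)%N -> 0 < Num.sqrt 2 * n%:R `^ (3 / 2) / 8 :> R.
  by move=> n0; rewrite divr_gt0 // mulr_gt0 ?sqrtr_gt0 // powR_gt0 // ltr0n.
move: le_grid.
(* The integral is a priori an extended real. The value [+oo] contradicts the bound from a grid with
   a single block, and [-oo] makes the left side [-oo], so that [r = 0] will do. *)
case: (\int[lebesgue_measure]_s _)%E => [J| |] le_grid.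
- have ev := complexity_eventually_ge la_part gamma_shape.1 la_cvg
    (fun a d m d0 m0 a0 b0 gl gr => le_grid a d m d0 m0 a0 b0 gl gr : J <= _).
  (* Only a shortfall of the complexity below the main term is recorded, as a possible excess need
     not be of smaller order; the [- 1] makes the inequality strict, and is absorbed by
     [n^(3/2) e / 2] once [n >= 2 / e]. *)
  exists (fun n => Num.min
    (nps_complexity R (la n) - Num.sqrt 2 * n%:R `^ (3 / 2) / 8 * J) 0 - 1); split.
    apply/eqoP => e e0; near=> n.
    have n0 : (0 < n)%N by near: n; exists 1%N.
    have K0 := powR_gt n n0.
    have ne : 2 / e <= n%:R by near: n; exact: near_ge_nat.
    have npow : n%:R <= n%:R `^ (3 / 2) :> R.
      rewrite -[leLHS]powRr1 //; apply: ler_powR; first by rewrite ler1n.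
      by lra.
    have evn : Num.sqrt 2 * n%:R `^ (3 / 2) / 8 * (J - e / 2) <= nps_complexity R (la n).
      by near: n; apply: ev; rewrite divr_gt0.
    have sqrt2 : Num.sqrt 2 <= 8 :> R.
      rewrite -(ler_pXn2r (ltn0Sn 1)) ?nnegrE ?sqrtr_ge0 // sqr_sqrtr //; lra.
    have pow0 : 0 <= n%:R `^ (3 / 2) :> R by exact: powR_ge0.
    rewrite ler_pdivrMr // in ne.
    have Kpow : Num.sqrt 2 * n%:R `^ (3 / 2) / 8 <= n%:R `^ (3 / 2) :> R by nra.
    move: (_ / 8) K0 evn Kpow => K K0 evn Kpow.
    have one : 1 <= n%:R `^ (3 / 2) * (e / 2).
      apply: le_trans (_ : n%:R * (e / 2) <= _); first by lra.
      by rewrite ler_wpM2r // ltW // divr_gt0.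
    have Ke : K * (e / 2) <= n%:R `^ (3 / 2) * (e / 2).
      by rewrite ler_wpM2r // ltW // divr_gt0.
    rewrite [`|n%:R `^ _|]ger0_norm //.
    have : nps_complexity R (la n) - K * J >= - (K * (e / 2)) by move: evn; lra.
    rewrite minElt; case: ltP => h1 h2; apply/ler_normlP; split; lra.
  move=> n n0; rewrite -EFinM -EFinD lte_fin.
  have : Num.min (nps_complexity R (la n) - Num.sqrt 2 * n%:R `^ (3 / 2) / 8 * J) 0
     <= nps_complexity R (la n) - Num.sqrt 2 * n%:R `^ (3 / 2) / 8 * J by rewrite ge_min lexx.
  by lra.
- have [a [L [a0 L0 b0 gl gr]]] := limit_shape_support gamma_shape.1.
  have gridE : grid a L 1 = a + L by rewrite /grid mulr1.
  by have := le_grid a L 1%N L0 isT a0; rewrite gridE leye_eq => /(_ b0 gl gr).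
exists (fun=> 0); split.
  by apply/eqoP => e e0; near=> n; rewrite normr0 mulr_ge0 // ltW.
by move=> n n0; rewrite gt0_muleNy ?lte_fin ?powR_gt // addNye ltNyr.
Unshelve. all: by end_near. Qed.
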